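(* Let $\mathcal{A},\mathcal{B}$ be metric spaces and let $f^{\alpha,\beta},c^{\alpha,\beta},a^{\alpha,\beta}:\mathbb{R}^n\to\mathbb{R}$ and $b^{\alpha,\beta}:\mathbb{R}^n\to\mathbb{R}^n$, $(\alpha,\beta)\in\mathcal{A}\times\mathcal{B}$, satisfy: (i) $\mathcal{A}$ and $\mathcal{B}$ are compact, and $a^{\alpha,\beta}(x)$, $b^{\alpha,\beta}(x)$, $c^{\alpha,\beta}(x)$, $f^{\alpha,\beta}(x)$ are continuous with respect to the variables $\alpha,\beta,x$; (ii) there is a constant $K$ such that $|a^{\alpha,\beta}|_{C^{0,1}(\mathbb{R}^n)}+|b^{\alpha,\beta}|_{C^{0,1}(\mathbb{R}^n)}+|c^{\alpha,\beta}|_{C^{0,1}(\mathbb{R}^n)}+|f^{\alpha,\beta}|_{C^{0,1}(\mathbb{R}^n)}\le K$ for all $(\alpha,\beta)\in\mathcal{A}\times\mathcal{B}$; (iii) there is a constant $\lambda>0$ such that $c^{\alpha,\beta}(x)>\lambda$ for all $\alpha,\beta,x$; (iv) there is a constant $\lambda_1>0$ such that $a^{\alpha,\beta}(x)>\lambda_1$ for all $\alpha,\beta,x$. Suppose the constant $\lambda$ in (iii) is large enough that the unique viscosity solution $u\in C_b(\mathbb{R}^n)$ of $$\sup_{\alpha\in\mathcal{A}}\inf_{\beta\in\mathcal{B}}\Big\{f^{\alpha,\beta}(x)+c^{\alpha,\beta}(x)u(x)+b^{\alpha,\beta}(x)\cdot\nabla u(x)+a^{\alpha,\beta}(x)(-\Delta)^{1/2}u(x)\Big\}=0,\quad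 x\in\mathbb{R}^n,$$ is Lipschitz continuous. Then $u$ is continuously differentiable and there are constants $\sigma\in(0,1)$ and $C$ such that $$|\nabla u(x)-\nabla u(y)|\le C|x-y|^{\sigma}\quad\text{for all }x,y\in\mathbb{R}^n.$$
   Context: $|h|_{C^{0,1}(\mathbb{R}^n)}=\sup_x|h(x)|+\sup_{x\ne y}|h(x)-h(y)|/|x-y|$. $USC_b(\mathbb{R}^n)$, $LSC_b(\mathbb{R}^n)$, $C_b(\mathbb{R}^n)$ are the bounded upper semicontinuous, lower semicontinuous, and continuous functions. The half-Laplacian is $(-\Delta)^{1/2}u(x)=c(n,1/2)\,\mathrm{p.v.}\int_{\mathbb{R}^n}\frac{u(x)-u(y)}{|x-y|^{n+1}}\,dy$, with $c(n,1/2)>0$ the usual normalizing constant depending only on $n$. For $\kappa\in(0,1)$ put $$\mathcal{I}_\kappa(\varphi)(x)=-c(n,1/2)\,\mathrm{p.v.}\int_{|z|<\kappa}\frac{\varphi(x+z)-\varphi(x)}{|z|^{n+1}}\,dz,\qquad \mathcal{I}^\kappa(u)(x)=-c(n,1/2)\int_{|z|\ge\kappa}\frac{u(x+z)-u(x)}{|z|^{n+1}}\,dz.$$ Viscosity solutions: $u\in USC_b(\mathbb{R}^n)$ is a viscosity subsolution of the equation if, for every $\varphi\in C^2(\mathbb{R}^n)$ and every global maximum point $x$ of $u-\varphi$, $$\sup_{\alpha}\inf_{\beta}\{f^{\alpha,\beta}(x)+c^{\alpha,\beta}(x)u(x)+b^{\alpha,\beta}(x)\cdot\nabla\varphi(x)+a^{\alpha,\beta}(x)\mathcal{I}_\kappa(\varphi)(x)+a^{\alpha,\beta}(x)\mathcal{I}^\kappa(u)(x)\}\le0$$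 for all $\kappa\in(0,1)$. $u\in LSC_b(\mathbb{R}^n)$ is a viscosity supersolution if the same holds with global minimum points and $\ge0$. $u\in C_b(\mathbb{R}^n)$ is a viscosity solution if it is both. Under (i)–(iv) there is a unique viscosity solution in $C_b(\mathbb{R}^n)$. *)

(* Defs.v *)
From HB Require Import structures.
From mathcomp Require Import all_boot all_order all_algebra.
From mathcomp Require Import all_classical all_reals all_analysis.

Set Implicit Arguments.
Unset Strict Implicit.
Unset Printing Implicit Defensive.

Import Order.TTheory GRing.Theory Num.Theory.
Import numFieldNormedType.Exports.

Local Open Scope classical_set_scope.
Local Open Scope ring_scope.

(* The library norm on ['rV[R]_n] is the sup norm; it is used only through the
   topology and the notion of differentiability.  Every quantitative condition
   below uses the Euclidean norm [enorm]. *)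

Section euclidean.
Context {R : realType} {n : nat}.
Implicit Types x y : 'rV[R]_n.

Definition dotp x y : R := \sum_(i < n) x 0 i * y 0 i.

Definition enorm x : R := Num.sqrt (dotp x x).

End euclidean.

Fact rV_display : measure_display.
Proof. exact: default_measure_display. Qed.

(* ['rV[R]_n] carries the sigma-algebra generated by the coordinates, that is,
   the Borel sigma-algebra. *)
Section rV_measurable.
Context {R : realType}.
Variable n : nat.

Definition rV_coord (i : 'I_n) (x : 'rV[R]_n) : measurableTypeR R := x 0 i.

Let rV_set0 : g_sigma_preimage rV_coord set0.
Proof. exact: sigma_algebra0. Qed.

Let rV_setC A : g_sigma_preimage rV_coord A -> g_sigma_preimage rV_coord (~` A).
Proof. exact: sigma_algebraC. Qed.

Let rV_bigcup (F : (set 'rV[R]_n)^nat) :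
  (forall i, g_sigma_preimage rV_coord (F i)) ->
  g_sigma_preimage rV_coord (\bigcup_i (F i)).
Proof. exact: sigma_algebra_bigcup. Qed.

HB.instance Definition _ := @isMeasurable.Build rV_display 'rV[R]_n
  (g_sigma_preimage rV_coord) rV_set0 rV_setC rV_bigcup.

End rV_measurable.

Lemma measurable_rV_coord {R : realType} n (i : 'I_n) :
  measurable_fun [set: 'rV[R]_n] (@rV_coord R n i).
Proof.
move=> _ Y mY; rewrite setTI; apply: sub_sigma_algebra => /=.
rewrite -bigcup_seq/=; exists i => /=; first by rewrite mem_index_enum.
by exists Y => //; rewrite setTI.
Qed.

Lemma measurable_fun_rVP {R : realType} d (T : measurableType d) n
    (f : T -> 'rV[R]_n) :
  (forall i, measurable_fun [set: T] (@rV_coord R n i \o f)) ->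
  measurable_fun [set: T] f.
Proof.
move=> mf _ A mA.
suff: g_sigma_preimage (fun i => @rV_coord R n i \o f) `<=` measurable.
  apply; rewrite g_sigma_preimage_comp.
  by exists A.
apply: smallest_sub; first exact: sigma_algebra_measurable.
rewrite -bigcup_seq /=; apply: bigcup_sub => i _ B [C mC <-].
exact: mf.
Qed.

Section product_rV.
Context {R : realType} {n : nat}.
Implicit Type mu : {sigma_finite_measure set 'rV[R]_n -> \bar R}.

Definition rV_cons (p : measurableTypeR R * 'rV[R]_n) : 'rV[R]_n.+1 :=
  row_mx (p.1)%:M p.2.

Definition rV_uncons (x : 'rV[R]_n.+1) : measurableTypeR R * 'rV[R]_n :=
  (x 0 0, rsubmx (x : 'rV[R]_(1 + n))).

Lemma rV_cons0 p : rV_cons p 0 0 = p.1.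
Proof.
have -> : (0 : 'I_n.+1) = lshift n (0 : 'I_1) by apply/val_inj.
by rewrite /rV_cons (row_mxEl (p.1)%:M p.2) mxE.
Qed.

Lemma rV_consS p (j : 'I_n) : rV_cons p 0 (lift 0 j) = p.2 0 j.
Proof.
have -> : lift 0 j = rshift 1 j by apply/val_inj.
by rewrite /rV_cons (row_mxEr (p.1)%:M p.2).
Qed.

Lemma rV_consK : cancel rV_cons rV_uncons.
Proof.
move=> p; rewrite /rV_uncons rV_cons0 /rV_cons row_mxKr.
by case: p.
Qed.

Lemma measurable_rV_cons : measurable_fun setT rV_cons.
Proof.
apply: measurable_fun_rVP => i.
case: (unliftP 0 i) => [j ->|->].
- rewrite (_ : _ \o _ = @rV_coord R n j \o snd); last first.
    by apply/funext => p /=; rewrite /rV_coord rV_consS.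
  by apply: measurableT_comp => //; exact: measurable_rV_coord.
- rewrite (_ : _ \o _ = fst) //.
  by apply/funext => p /=; rewrite /rV_coord rV_cons0.
Qed.

Lemma measurable_rV_uncons : measurable_fun setT rV_uncons.
Proof.
apply: measurable_fun_pair; first exact: (@measurable_rV_coord R n.+1 0).
apply: measurable_fun_rVP => i.
rewrite (_ : _ \o _ = @rV_coord R n.+1 (lift 0 i)).
  exact: measurable_rV_coord.
apply/funext => x /=; rewrite /rV_coord mxE; congr (x _ _).
by apply/val_inj.
Qed.

(* The product of one-dimensional Lebesgue measure (first coordinate) and [mu]
   (remaining coordinates), carried over to row vectors. *)
Definition product_rV mu : set 'rV[R]_n.+1 -> \bar R :=
  pushforward (lebesgue_measure \x mu)%E rV_cons.

Let product_rV_measure mu : {measure set 'rV[R]_n.+1 -> \bar R} :=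
  measure_function_pushforward__canonical__measure_function_Measure
    (lebesgue_measure \x mu)%E measurable_rV_cons.

HB.instance Definition _ mu := isMeasure.Build _ _ _ (product_rV mu)
  (measure0 (product_rV_measure mu)) (measure_ge0 (product_rV_measure mu))
  (@measure_semi_sigma_additive _ _ _ (product_rV_measure mu)).

Let product_rV_sigma_finite mu : sigma_finite setT (product_rV mu).
Proof.
have /sigma_finiteP[F [TF ndF mF]] := sigma_finiteT (@lebesgue_measure R).
have /sigma_finiteP[G [TG ndG mG]] := sigma_finiteT mu.
exists (fun k => rV_uncons @^-1` (F k `*` G k)).
  rewrite -preimage_bigcup (_ : \bigcup_k _ = setT) ?preimage_setT//.
  rewrite -setXTT TF TG; apply/seteqP; split => -[x y].
    by move=> [k _ []/= ? ?]; split; exists k.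
  move=> [/= [k _ Fkx] [l _ Gly]]; exists (maxn k l) => //; split.
    by move: x Fkx; exact/subsetPset/ndF/leq_maxl.
  by move: y Gly; exact/subsetPset/ndG/leq_maxr.
move=> k; have [mFk Fk] := mF k; have [mGk Gk] := mG k; split.
  by rewrite -[X in measurable X]setTI; apply: measurable_rV_uncons => //;
    exact: measurableX.
rewrite /product_rV /pushforward (_ : rV_cons @^-1` _ = F k `*` G k); last first.
  rewrite -comp_preimage (_ : rV_uncons \o rV_cons = id) ?preimage_id//.
  by apply/funext => p; exact: rV_consK.
by rewrite product_measure1E// lte_mul_pinfty// ge0_fin_numE.
Qed.

HB.instance Definition _ mu := Measure_isSigmaFinite.Build _ _ _ (product_rV mu)
  (product_rV_sigma_finite mu).

End product_rV.

Fixpoint lebesgue_rV {R : realType} (n : nat) :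
    {sigma_finite_measure set 'rV[R]_n -> \bar R} :=
  if n is n'.+1 then product_rV (lebesgue_rV n') else \d_(0 : 'rV[R]_0).

Lemma lebesgue_rV_box {R : realType} n (a : 'I_n -> set (measurableTypeR R)) :
  (forall i, measurable (a i)) ->
  lebesgue_rV n [set x | forall i, a i (x 0 i)] =
  (\prod_(i < n) lebesgue_measure (a i))%E.
Proof.
elim: n a => [|n IH] a ma.
  rewrite big_ord0 /= diracE mem_set //=; by case.
rewrite big_ord_recl -IH //= /product_rV /pushforward.
rewrite (_ : _ @^-1` _ =
    a ord0 `*` [set x : 'rV[R]_n | forall i, a (lift ord0 i) (x 0 i)]).
  rewrite product_measure1E //.
  rewrite (_ : [set x | _] =
      \bigcap_(i in [set: 'I_n]) (rV_coord i @^-1` a (lift ord0 i))).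
    apply: fin_bigcap_measurable => // i _.
    rewrite -[X in measurable X]setTI; exact: measurable_rV_coord.
  by apply/seteqP; split => x /= H i; [move=> _; exact: H|exact: (H i I)].
apply/seteqP; split => p /=.
  move=> H; split; first by have := H 0; rewrite rV_cons0.
  by move=> i; have := H (lift ord0 i); rewrite rV_consS.
move=> [H0 H1] i; case: (unliftP 0 i) => [j ->|->].
- by rewrite rV_consS.
- by rewrite rV_cons0.
Qed.

Section differential.
Context {R : realType} {n : nat}.
Implicit Type u : 'rV[R]_n -> R.

Definition grad u (x : 'rV[R]_n) : 'rV[R]_n := \row_i 'D_(delta_mx 0 i) u x.

Definition is_C1 u := (forall x, differentiable u x) /\ continuous (grad u).

Definition is_C2 u := is_C1 u /\ forall i, is_C1 (fun x => grad u x 0 i).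

Definition eucl_lipschitz u :=
  exists L : R, forall x y, `|u x - u y| <= L * enorm (x - y).

Definition upper_semicontinuous_real u :=
  lower_semicontinuous (fun x => (- u x)%:E).

Definition lower_semicontinuous_real u := lower_semicontinuous (fun x => (u x)%:E).

End differential.

(* The norm of C^{0,1}(R^n), extended-real valued (+oo when [h] is unbounded or
   not Lipschitz).  [N] is the Euclidean norm of the codomain. *)
Definition C01_norm {R : realType} {n : nat} {V : zmodType} (N : V -> R)
    (h : 'rV[R]_n -> V) : \bar R :=
  (ereal_sup [set (N (h x))%:E | x in setT] +
   ereal_sup [set (N (h p.1 - h p.2) / enorm (p.1 - p.2))%:E |
              p in [set p : 'rV[R]_n * 'rV[R]_n | p.1 != p.2]])%E.

(* Euler's integral, meant for 0 < s. *)
Definition Gamma {R : realType} (s : R) : R :=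
  \int[lebesgue_measure]_(t in `]0, +oo[) (t `^ (s - 1) * expR (- t)).

(* The constant c(n, s) = 4^s Gamma(n/2 + s) / (pi^(n/2) |Gamma(-s)|) of the
   fractional Laplacian at s = 1/2, where |Gamma(-1/2)| = 2 sqrt(pi). *)
Definition c_half (R : realType) (n : nat) : R :=
  Gamma (n.+1%:R / 2) / pi `^ (n.+1%:R / 2).

Section half_laplacian.
Context {R : realType} {n : nat}.
Implicit Types u phi : 'rV[R]_n -> R.

Definition diff_quot u (x z : 'rV[R]_n) : R := (u (x + z) - u x) / enorm z ^+ n.+1.

(* I_kappa; the principal value removes the balls |z| < eps and lets eps -> 0. *)
Definition I_near (kappa : R) phi (x : 'rV[R]_n) : R :=
  - c_half R n * lim ((\int[lebesgue_rV n]_(z in [set z | eps <= enorm z < kappa])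
                     diff_quot phi x z) @[eps --> 0^'+]).

(* I^kappa *)
Definition I_far (kappa : R) u (x : 'rV[R]_n) : R :=
  - c_half R n * \int[lebesgue_rV n]_(z in [set z | kappa <= enorm z])
               diff_quot u x z.

End half_laplacian.

(* Viscosity solutions of
     sup_alpha inf_beta {f + c u + b . grad u + a (-Delta)^(1/2) u} = 0. *)
Section viscosity.
Context {R : realType} {n : nat} {A B : Type}.
Variables (a c f : A -> B -> 'rV[R]_n -> R) (b : A -> B -> 'rV[R]_n -> 'rV[R]_n).
Implicit Types u phi : 'rV[R]_n -> R.

(* The extended-real sup and inf agree with the real ones when the latter exist
   and give -oo and +oo on an empty index set. *)
Definition isaacs (kappa : R) u phi (x : 'rV[R]_n) : \bar R :=
  ereal_sup (range (fun al => ereal_inf (range (fun be =>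
    (f al be x + c al be x * u x + dotp (b al be x) (grad phi x)
     + a al be x * I_near kappa phi x + a al be x * I_far kappa u x)%:E)))).

Definition viscosity_subsolution u :=
  [/\ upper_semicontinuous_real u, bounded_fun u &
    forall phi x, is_C2 phi -> (forall y, u y - phi y <= u x - phi x) ->
      forall kappa, 0 < kappa < 1 -> (isaacs kappa u phi x <= 0)%E].

Definition viscosity_supersolution u :=
  [/\ lower_semicontinuous_real u, bounded_fun u &
    forall phi x, is_C2 phi -> (forall y, u x - phi x <= u y - phi y) ->
      forall kappa, 0 < kappa < 1 -> (0 <= isaacs kappa u phi x)%E].

Definition viscosity_solution u :=
  [/\ continuous u, bounded_fun u, viscosity_subsolution u
    & viscosity_supersolution u].

End viscosity.

(* Main.v *)
Require Import Defs.
From HB Require Import structures.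
From mathcomp Require Import all_boot all_order all_algebra.
From mathcomp Require Import all_classical all_reals all_analysis.
From mathcomp Require Import measurable_realfun ring lra.

Set Implicit Arguments.
Unset Strict Implicit.
Unset Printing Implicit Defensive.

Import Order.TTheory GRing.Theory Num.Theory.
Import numFieldNormedType.Exports.

Local Open Scope classical_set_scope.
Local Open Scope ring_scope.

(** Why the theorem is true.

    The coefficient [a] multiplies the half-Laplacian only and is bounded away
    from 0, so dividing by it turns the equation into
    [(-Delta)^(1/2) u + H (x, u, grad u) = 0] with [H] Lipschitz for bounded
    gradients.  An increment [W x = u (x + h1) - u (x + h2)] of the Lipschitz
    solution [u] then solves, up to an error of size [t = |h1 - h2|], a linear
    equation [|(-Delta)^(1/2) W| <= C |grad W| + C t] with a bounded drift, which
    has the same order as the diffusion.  The heart of the matter is that such [W]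
    are Holder continuous with a bound proportional to [t]
    ([increments_holder]).

    This follows from an improvement of oscillation ([improvement]).  If [W] is at
    most [m] on a fixed part of a ball of radius [r], then near the centre [W] stays
    strictly below its upper bound [m + T].  Otherwise [W] minus a multiple of the
    profile [(1 + |x - x0|^2 / r^2)^s] has a maximum point in the ball.  There the
    half-Laplacian sees the set where [W <= m], a gain of order [T / r]
    ([far_gain]), whereas the half-Laplacian and the gradient of the profile are only
    of order [s T / r] ([growth_bound]), and [s] is at our disposal.  Smallness of
    [s] also beats the drift, however large.  The profile grows like a power, so it
    dominates the tails of [W] when the improvement is iterated over the scales
    [4^-k] ([oscillation_decay]).

    None of this can be done pointwise, since [u] is only a viscosity solution.
    The argument runs on the doubled function
    [u (x + h1) - u (y + h2) - 2 T profile x - b |x - y|^2], which has a maximum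
    point ([doubling_max]); the two viscosity inequalities there are subtracted
    ([isaacs_difference]).  Because the increments of [u] at both points are
    evaluated at the same [z], the penalty cancels in the nonlocal terms, and the
    Lipschitz bound on [u] makes the error from [x <> y] as small as desired.
    Symmetrizing in [z] and [- z] and using concavity of the power replaces every
    singular integral by a second difference; in particular no principal value has
    to be shown to converge ([lim_right_le]).

    Finally, [|W x - W y| <= C t |x - y|^sigma] says that difference quotients over
    different steps agree up to a power of the step, so they converge; the partial
    derivatives inherit the Holder bound and give the differential by telescoping
    over the coordinates ([C1_of_increments]). *)

(** * The Euclidean norm *)

Section euclid.
Context {R : realType} {n : nat}.
Implicit Types x y z : 'rV[R]_n.

Lemma dotpC x y : dotp x y = dotp y x.
Proof. by apply: eq_bigr => i _; rewrite mulrC. Qed.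

Lemma dotpDl x y z : dotp (x + y) z = dotp x z + dotp y z.
Proof. by rewrite -big_split; apply: eq_bigr => i _; rewrite mxE mulrDl. Qed.

Lemma dotpDr x y z : dotp z (x + y) = dotp z x + dotp z y.
Proof. by rewrite dotpC dotpDl !(dotpC z). Qed.

Lemma dotpZl k x y : dotp (k *: x) y = k * dotp x y.
Proof. by rewrite mulr_sumr; apply: eq_bigr => i _; rewrite mxE mulrA. Qed.

Lemma dotpZr k x y : dotp x (k *: y) = k * dotp x y.
Proof. by rewrite dotpC dotpZl dotpC. Qed.

Lemma dotpNl x y : dotp (- x) y = - dotp x y.
Proof. by rewrite -scaleN1r dotpZl mulN1r. Qed.

Lemma dotpNr x y : dotp x (- y) = - dotp x y.
Proof. by rewrite dotpC dotpNl dotpC. Qed.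

Lemma dotp_ge0 x : 0 <= dotp x x.
Proof. by apply: sumr_ge0 => i _; rewrite -expr2 sqr_ge0. Qed.

Lemma dotp_eq0 x : (dotp x x == 0) = (x == 0).
Proof.
rewrite /dotp psumr_eq0; last by move=> i _; rewrite -expr2 sqr_ge0.
apply/idP/eqP => [/allP h|->]; last by apply/allP => i _ /=; rewrite mxE mulr0.
apply/rowP => i; rewrite mxE; have := h i (mem_index_enum _).
by rewrite /= mulf_eq0 orbb => /eqP.
Qed.

Lemma enorm_ge0 x : 0 <= enorm x. Proof. exact: sqrtr_ge0. Qed.

Lemma sqr_enorm x : enorm x ^+ 2 = dotp x x.
Proof. by rewrite sqr_sqrtr ?dotp_ge0. Qed.

Lemma enorm_eq0 x : (enorm x == 0) = (x == 0).
Proof. by rewrite /enorm sqrtr_eq0 -dotp_eq0 eq_le dotp_ge0 andbT. Qed.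

Lemma enorm0 : enorm (0 : 'rV[R]_n) = 0.
Proof. by apply/eqP; rewrite enorm_eq0. Qed.

Lemma enorm_gt0 x : (0 < enorm x) = (x != 0).
Proof. by rewrite lt_neqAle enorm_ge0 andbT eq_sym enorm_eq0. Qed.

Lemma enormZ k x : enorm (k *: x) = `|k| * enorm x.
Proof.
by rewrite /enorm dotpZl dotpZr mulrA -expr2 sqrtrM ?sqr_ge0// sqrtr_sqr.
Qed.

Lemma enormN x : enorm (- x) = enorm x.
Proof. by rewrite -scaleN1r enormZ normrN1 mul1r. Qed.

Lemma enormB x y : enorm (x - y) = enorm (y - x).
Proof. by rewrite -enormN opprB. Qed.

(** Cauchy-Schwarz, from [0 <= |q x - p y|^2] with [p = x.y] and [q = y.y]. *)
Lemma dotp_le_enorm x y : `|dotp x y| <= enorm x * enorm y.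
Proof.
rewrite -(@ler_pXn2r _ 2)// ?nnegrE ?mulr_ge0 ?enorm_ge0//.
rewrite exprMn !sqr_enorm real_normK ?num_real//.
have [/eqP|y0] := eqVneq (dotp y y) 0.
  rewrite dotp_eq0 => /eqP ->.
  by rewrite -(scale0r 0) !dotpZr !mul0r expr2 !mul0r mulr0.
have ypos : 0 < dotp y y by rewrite lt_neqAle eq_sym y0 dotp_ge0.
have := dotp_ge0 (dotp y y *: x - dotp x y *: y).
rewrite !(dotpDl, dotpDr, dotpNl, dotpNr, dotpZl, dotpZr) (dotpC y x).
set a := dotp x x; set p := dotp x y; set q := dotp y y.
rewrite (_ : _ + _ = q * (a * q - p ^+ 2)); last by ring.
by rewrite pmulr_rge0// subr_ge0.
Qed.

Lemma ler_enormD x y : enorm (x + y) <= enorm x + enorm y.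
Proof.
rewrite -(@ler_pXn2r _ 2)// ?nnegrE ?addr_ge0 ?enorm_ge0//.
rewrite sqrrD !sqr_enorm !(dotpDl, dotpDr) (dotpC y x).
have := le_trans (ler_norm _) (dotp_le_enorm x y).
by move=> h; rewrite mulr2n; lra.
Qed.

Lemma coord_le_enorm x i : `|x 0 i| <= enorm x.
Proof.
rewrite -(@ler_pXn2r _ 2)// ?nnegrE ?enorm_ge0// sqr_enorm real_normK ?num_real//.
rewrite /dotp (bigD1 i)//= expr2 lerDl.
by apply: sumr_ge0 => j _; rewrite -expr2 sqr_ge0.
Qed.

Lemma enorm_le_sum x : enorm x <= \sum_i `|x 0 i|.
Proof.
have S0 : 0 <= \sum_i `|x 0 i| by apply: sumr_ge0.
rewrite -(@ler_pXn2r _ 2)// ?nnegrE ?enorm_ge0// sqr_enorm.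
rewrite expr2 mulr_suml; apply: ler_sum => i _.
rewrite (le_trans (ler_norm _))// normrM ler_wpM2l//.
by rewrite (bigD1 i)//= lerDl sumr_ge0.
Qed.

Lemma enorm_delta i (k : R) : enorm (k *: delta_mx 0 i : 'rV[R]_n) = `|k|.
Proof.
rewrite enormZ /enorm /dotp (bigD1 i)//= big1 => [|j ji].
  by rewrite !mxE !eqxx/= mulr1 addr0 sqrtr1 mulr1.
by rewrite !mxE (negbTE ji) andbF mulr0.
Qed.

Lemma dotp_sqrD x z : dotp (x + z) (x + z) = dotp x x + 2 * dotp x z + dotp z z.
Proof. rewrite !(dotpDl, dotpDr) (dotpC z x); ring. Qed.

Lemma norm_coord_le x i : `|x 0 i| <= `|x|.
Proof.
by rewrite [leRHS]/Num.norm /= mx_normrE; apply/bigmax_geP; right => /=; exists (0, i).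
Qed.

Lemma norm_le_enorm x : `|x| <= enorm x.
Proof.
rewrite [leLHS]/Num.norm /= mx_normrE; apply/bigmax_leP; split; first exact: enorm_ge0.
by move=> [i j] _ /=; rewrite (ord1 i); exact: coord_le_enorm.
Qed.

Lemma enorm_le_norm x : enorm x <= n%:R * `|x|.
Proof.
apply: (le_trans (enorm_le_sum x)).
rewrite mulr_natl -[n in _ *+ n]card_ord -sumr_const; apply: ler_sum => i _.
exact: norm_coord_le.
Qed.
End euclid.

(** * Lebesgue measure on row vectors *)

Section box.
Context {R : realType} {n : nat}.
Implicit Types a b : 'I_n -> set (measurableTypeR R).

Definition box a : set 'rV[R]_n := [set x | forall i, a i (x 0 i)].

Lemma measurable_box a : (forall i, measurable (a i)) -> measurable (box a).
Proof.
move=> ma; rewrite (_ : box a = \bigcap_(i in [set: 'I_n]) (rV_coord i @^-1` a i)).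
  apply: fin_bigcap_measurable => // i _.
  by rewrite -[X in measurable X]setTI; exact: measurable_rV_coord.
by apply/seteqP; split => x /= H i; [move=> _; exact: H|exact: (H i I)].
Qed.

(** Coordinate cylinders are boxes with all other sides full; unlike cylinders, boxes
    are stable under intersection. *)
Lemma measurable_rV_box :
  @measurable rV_display 'rV[R]_n =
  <<s [set box a | a in [set a | forall i, measurable (a i)]] >>.
Proof.
apply/seteqP; split; last first.
  apply: smallest_sub; first exact: sigma_algebra_measurable.
  by move=> _ [a ma <-]; exact: measurable_box.
apply: smallest_sub; first exact: smallest_sigma_algebra.
rewrite -bigcup_seq/=; apply: bigcup_sub => i _ _ [Y mY <-].
apply: sub_sigma_algebra; exists (fun j => if j == i then Y else setT).
  by move=> j; case: ifP => _ //; exact: measurableT.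
rewrite setTI; apply/seteqP; split => x /=; first by move=> /(_ i); rewrite eqxx.
by move=> Yx j; case: eqP => [->//|].
Qed.

(** Boxes form a pi-system containing an exhaustion by cubes of finite measure. *)
Lemma lebesgue_rV_unique (m : {measure set 'rV[R]_n -> \bar R}) :
  (forall a, (forall i, measurable (a i)) -> lebesgue_rV n (box a) = m (box a)) ->
  forall S, measurable S -> lebesgue_rV n S = m S.
Proof.
move=> mE S mS.
pose g k : 'I_n -> set (measurableTypeR R) :=
  fun=> `]- k%:R, k%:R[%classic.
have mg k i : measurable (g k i) by exact: measurable_itv.
apply: (measure_unique [set box a | a in [set a | forall i, measurable (a i)]]
  (fun k => box (g k))) => //.
- exact: measurable_rV_box.
- move=> _ _ [a ma <-] [b mb <-]; exists (fun i => a i `&` b i).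
    by move=> i; exact: measurableI.
  apply/seteqP; split=> x /= H; first by split=> i; have [] := H i.
  by move=> i; have [Ha Hb] := H; split.
- by move=> k; exists (g k).
- apply/seteqP; split => // x _; exists (Num.truncn `|x|).+1 => //= i.
  rewrite /g /= in_itv/= -ltr_norml (le_lt_trans (norm_coord_le _ _))//.
  by rewrite truncnS_gt.
- by move=> _ [a ma <-]; exact: mE.
- move=> k /=; rewrite (lebesgue_rV_box (mg k)).
  set p := (X in (X < _)%E); suff /andP[] : (0 <= p < +oo)%E by [].
  rewrite /p; apply: (big_ind (fun y : \bar R => (0 <= y < +oo)%E)).
  + by rewrite lee01 ltry.
  + move=> y z /andP[y0 yo] /andP[z0 zo].
    by rewrite mule_ge0//= lte_mul_pinfty// ge0_fin_numE.
  + move=> i _; rewrite measure_ge0/= lebesgue_measure_itv/=.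
    by case: ifP => _; rewrite ?ltry// -EFinB ltry.
Qed.
End box.

Section isometry.
Context {R : realType}.

Lemma lebesgue_measure_affine (y s : R) : `|s| = 1 ->
  forall S : set (measurableTypeR R), measurable S ->
  lebesgue_measure ((fun t : R => y + s * t) @^-1` S) = lebesgue_measure S.
Proof.
move=> s1 S mS.
have mT : measurable_fun [set: measurableTypeR R]
    ((fun t : R => y + s * t) : measurableTypeR R -> measurableTypeR R).
  by apply: measurable_funD => //; exact: measurable_funM.
apply/esym.
pose m := measure_function_pushforward__canonical__measure_function_Measure
  (@lebesgue_measure R) mT.
apply: (@lebesgue_measure_unique _ m) => // X /ocitvP[->|[[a b] /= ab ->]].
  by rewrite /m/= /pushforward preimage_set0 !measure0.
rewrite /m/= /pushforward.
have s0 : s != 0 by rewrite -normr_eq0 s1 oner_eq0.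
have [sp|sn] := ltP 0 s.
  have {s1} -> : s = 1 by rewrite -s1 gtr0_norm.
  rewrite (_ : _ @^-1` _ = `]a - y, b - y]%classic).
    rewrite !lebesgue_measure_itv/= !lte_fin ltrD2r; case: ifP => // _.
    by rewrite -!EFinB opprB addrA subrK.
  by apply/seteqP; split => t /=; rewrite !in_itv/= mul1r ltrBlDl lerBrDl.
have {s1} -> : s = -1.
  have := ler0_norm sn; rewrite s1 => ->; by rewrite opprK.
rewrite (_ : _ @^-1` _ = `[y - b, y - a[%classic).
  rewrite !lebesgue_measure_itv/= !lte_fin ltrD2l ltrN2; case: ifP => // _.
  by rewrite -!EFinB; congr EFin; ring.
by apply/seteqP; split => t /=; rewrite !in_itv/= mulN1r; lra.
Qed.

Context {n : nat}.
Implicit Types y z : 'rV[R]_n.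

Lemma measurable_rV_affine y (s : R) :
  measurable_fun [set: 'rV[R]_n] (fun z => y + s *: z).
Proof.
apply: measurable_fun_rVP => i.
rewrite (_ : _ \o _ = fun z => y 0 i + s * rV_coord i z); last first.
  by apply/funext => z; rewrite /rV_coord/= !mxE.
apply: measurable_funD => //; apply: measurable_funM => //.
exact: measurable_rV_coord.
Qed.

(** The map acts coordinatewise, so it pulls boxes back to boxes and invariance reduces
    to the line. *)
Lemma lebesgue_rV_affine y (s : R) : `|s| = 1 ->
  forall S : set 'rV[R]_n, measurable S ->
  lebesgue_rV n ((fun z => y + s *: z) @^-1` S) = lebesgue_rV n S.
Proof.
move=> s1 S mS; apply/esym.
pose m := measure_function_pushforward__canonical__measure_function_Measure
  (@lebesgue_rV R n) (measurable_rV_affine y s).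
apply: (@lebesgue_rV_unique _ _ m) => // a ma.
rewrite /m/= /pushforward.
rewrite (_ : _ @^-1` _ = box (fun i => (fun t => y 0 i + s * t) @^-1` a i)); last first.
  by apply/seteqP; split=> z /= H i; have := H i; rewrite /= !mxE.
have mp i : measurable ((fun t => y 0 i + s * t) @^-1` a i).
  rewrite -[X in measurable X]setTI.
  have : measurable_fun setT (fun t : R => y 0 i + s * t).
    by apply: measurable_funD => //; exact: measurable_funM.
  by apply => //; exact: ma.
rewrite /box (lebesgue_rV_box ma) (lebesgue_rV_box mp).
by apply: eq_bigr => i _; rewrite lebesgue_measure_affine.
Qed.

End isometry.

Section continuous_measurable.
Context {R : realType} {n : nat}.

(** An open set is the union of the countably many rational cubes it contains. *)
Lemma open_rV_measurable (U : set 'rV[R]_n) : open U -> measurable U.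
Proof.
move=> oU.
pose B (p : 'rV[rat]_n * nat) : set 'rV[R]_n :=
  box (fun i => `]ratr (p.1 0 i) - p.2.+1%:R^-1, ratr (p.1 0 i) + p.2.+1%:R^-1[%classic).
rewrite (_ : U = \bigcup_p (if `[< B p `<=` U >] then B p else set0)).
  apply: countable_bigcupT_measurable => // p; case: ifP => _ //.
  by apply: measurable_box => i; exact: measurable_itv.
apply/seteqP; split => [x Ux|x [p _]]; last by case: asboolP => // pU /pU.
have /nbhs_ballP[e /= e0 xeU] := open_nbhs_nbhs (conj oU Ux).
pose k := Num.truncn (2 / e).
have ke : 2 * k.+1%:R^-1 < e.
  rewrite ltr_pdivrMr ?ltr0n// mulrC -ltr_pdivrMr//.
  exact: truncnS_gt.
have k0 : 0 < k.+1%:R^-1 :> R by rewrite invr_gt0 ltr0n.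
have /choice[q qP] : forall i : 'I_n, exists q : rat,
    ratr q \in `]x 0 i - k.+1%:R^-1, x 0 i + k.+1%:R^-1[.
  by move=> i; apply: rat_in_itvoo; rewrite ltrBlDr -addrA ltrDl addr_gt0.
move: k0 ke qP; set d : R := k.+1%:R^-1 => k0 ke qP.
have qP' i : `|x 0 i - ratr (q i)| < d.
  by have := qP i; rewrite in_itv/= => /andP[? ?]; rewrite ltr_norml; lra.
exists (\row_i q i, k) => //; rewrite ifT; last first.
  apply/asboolP => y By; apply: xeU; split => // i j; rewrite (ord1 i).
  have := By j; rewrite /= mxE in_itv/= -/d => /andP[? ?].
  have := qP' j; rewrite ltr_norml => /andP[? ?].
  by rewrite /ball/= ltr_norml; lra.
move=> i /=; rewrite mxE in_itv/= -/d.
by have := qP' i; rewrite ltr_norml => /andP[? ?]; lra.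
Qed.

Lemma continuous_rV_measurable (f : 'rV[R]_n -> R) :
  continuous f -> measurable_fun [set: 'rV[R]_n] f.
Proof.
move=> /continuousP cf; apply: (measurability _ (RGenOpens.measurableE R)).
move=> _ [_ [a [b ->] <-]]; rewrite setTI.
by apply: open_rV_measurable; apply: cf; exact: interval_open.
Qed.

Lemma continuous_enorm : continuous (@enorm R n).
Proof.
move=> x; apply/(@cvgrPdist_lt _ _ _ (nbhs x)) => e e0.
have en0 : 0 < e / n.+1%:R by rewrite divr_gt0 ?ltr0n.
apply: filterS (nbhsx_ballx x _ en0) => y; rewrite -ball_normE /= => xy.
have h z w : enorm z - enorm w <= enorm (z - w).
  by rewrite lerBlDr -{1}(subrK w z) ler_enormD.
apply: (@le_lt_trans _ _ (enorm (x - y))).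
  by rewrite ler_norml h andbT lerNl opprB enormB h.
apply: le_lt_trans (enorm_le_norm _) _.
apply: (@le_lt_trans _ _ (n.+1%:R * `|x - y|)); first by rewrite ler_wpM2r// ler_nat.
by rewrite mulrC -ltr_pdivlMr ?ltr0n.
Qed.

Lemma measurable_enorm : measurable_fun [set: 'rV[R]_n] (@enorm R n).
Proof. exact: continuous_rV_measurable continuous_enorm. Qed.

End continuous_measurable.

(** * Moments of the kernel of the half-Laplacian *)

(** [f] is dominated by the sum of the [c j] times the indicators of [E j], and the
    integrals of these form a geometric series. *)
Lemma integral_dyadic_cover_le d (T : measurableType d) (R : realType)
    (mu : {measure set T -> \bar R}) (D : set T) (f : T -> R)
    (c : nat -> R) (E : nat -> set T) (C : R) :
  measurable D -> measurable_fun D f -> (forall z, D z -> 0 <= f z) ->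
  (forall j, 0 <= c j) -> (forall j, measurable (E j)) -> 0 <= C ->
  (forall z, D z -> exists2 j, E j z & f z <= c j) ->
  (forall j, ((c j)%:E * mu (E j) <= (C / (2 ^ j.+1)%:R)%:E)%E) ->
  (\int[mu]_(z in D) (f z)%:E <= C%:E)%E.
Proof.
move=> mD mf f0 c0 mE C0 fc cE.
pose g j z := (c j * \1_(E j) z)%:E.
have g0 j z : (0 <= g j z)%E by rewrite lee_fin mulr_ge0// indicE ler0n.
have mg j : measurable_fun D (g j).
  apply/measurable_EFinP; apply: measurable_funM => //.
apply: (@le_trans _ _ (\int[mu]_(z in D) (\sum_(j <oo) g j z))%E).
  apply: ge0_le_integral => //.
  - exact/measurable_EFinP.
  - by apply: ge0_emeasurable_sum => // j z _; rewrite ?g0.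
  - move=> z Dz; have [j Ejz fj] := fc z Dz.
    apply: (@le_trans _ _ (g j z)).
      by rewrite lee_fin indicE mem_set// mulr1.
    rewrite (nneseriesD1 (n := j))//=.
    rewrite leeDl//; exact: nneseries_ge0.
rewrite integral_nneseries//.
apply: le_trans (epsilon_trick0 xpredT C0).
apply: lee_nneseries => [j _ _|j _].
  by apply: integral_ge0 => z _.
apply: le_trans (cE j).
rewrite /g; under eq_integral do rewrite EFinM.
rewrite ge0_integralZl//.
- rewrite integral_indic//; apply: lee_wpmul2l; first by rewrite lee_fin.
  by apply: le_measure; rewrite ?inE//; exact: measurableI.
- by apply/measurable_EFinP; exact: (@measurable_indic _ _ R D _ (mE j)).
- by rewrite lee_fin.
Qed.

Section kernel_integrals.
Context {R : realType} {n : nat}.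
Implicit Types z : 'rV[R]_n.

Definition jump_kernel z : R := (enorm z ^+ n.+1)^-1.

Lemma jump_kernel_ge0 z : 0 <= jump_kernel z. Proof. by rewrite invr_ge0 exprn_ge0 ?enorm_ge0. Qed.

Lemma jump_kernelN z : jump_kernel (- z) = jump_kernel z. Proof. by rewrite /jump_kernel enormN. Qed.

Lemma measurable_jump_kernel : measurable_fun [set: 'rV[R]_n] jump_kernel.
Proof.
rewrite (_ : jump_kernel = (fun x : R => x `^ (-1)) \o (fun z => enorm z ^+ n.+1)).
  apply: measurableT_comp; first exact: measurable_powR.
  by apply: measurable_funX; exact: measurable_enorm.
by apply/funext => z; rewrite /= powR_inv1// exprn_ge0// enorm_ge0.
Qed.

Lemma measurable_eball (r : R) : measurable [set z : 'rV[R]_n | enorm z < r].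
Proof.
rewrite (_ : [set _ | _] = @enorm R n @^-1` `]-oo, r[%classic).
  by rewrite -[X in measurable X]setTI; apply: measurable_enorm.
by apply/seteqP; split=> z; rewrite /= in_itv.
Qed.

Lemma measurable_eballC (r : R) : measurable [set z : 'rV[R]_n | r <= enorm z].
Proof.
rewrite (_ : [set _ | _] = @enorm R n @^-1` `[r, +oo[%classic).
  by rewrite -[X in measurable X]setTI; apply: measurable_enorm.
by apply/seteqP; split=> z; rewrite /= in_itv/= andbT.
Qed.

Lemma measurable_eannulus (r s : R) :
  measurable [set z : 'rV[R]_n | r <= enorm z < s].
Proof.
rewrite (_ : [set _ | _] = [set z | r <= enorm z] `&` [set z | enorm z < s]).
  by apply: measurableI; [exact: measurable_eballC|exact: measurable_eball].
by apply/seteqP; split=> z /=; [move=> /andP[]|move=> [-> ->]].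
Qed.

Lemma lebesgue_eball_le (r : R) : 0 < r ->
  (lebesgue_rV n [set z : 'rV[R]_n | (enorm z < r)%R] <= ((2 * r) ^+ n)%:E)%E.
Proof.
move=> r0; pose a : 'I_n -> set (measurableTypeR R) := fun=> `]- r, r[%classic.
have ma i : measurable (a i) by exact: measurable_itv.
apply: (@le_trans _ _ (lebesgue_rV n (box a))).
  apply: le_measure; rewrite ?inE.
  - exact: measurable_eball.
  - exact: measurable_box.
  - move=> z /= zr i; rewrite /a /= in_itv/= -ltr_norml.
    exact: le_lt_trans (coord_le_enorm _ _) zr.
rewrite /box (lebesgue_rV_box ma) /a.
under eq_bigr do rewrite lebesgue_measure_itv/= lte_fin gtrN//.
rewrite -EFinD opprK (_ : r + r = 2 * r); last by ring.
have : 0 <= 2 * r by rewrite mulr_ge0// ltW.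
elim: (n) => [|m ih] p0; first by rewrite big_ord0 expr0.
rewrite big_ord_recl exprS (EFinM _ (_ ^+ _)); apply: lee_wpmul2l; [by rewrite lee_fin|exact: ih p0].
Qed.

Lemma measurable_near_integrand D :
  measurable_fun D (fun z => enorm z ^+ 2 * jump_kernel z).
Proof.
apply: measurable_funTS; apply: measurable_funM; last exact: measurable_jump_kernel.
by apply: measurable_funX; exact: measurable_enorm.
Qed.

Lemma measurable_far_integrand D :
  measurable_fun D (fun z => Num.sqrt (enorm z) * jump_kernel z).
Proof.
apply: measurable_funTS; apply: measurable_funM; last exact: measurable_jump_kernel.
apply: (@measurableT_comp _ _ _ _ _ _ (@Num.sqrt R)); last exact: measurable_enorm.
by apply: continuous_measurable_fun; exact: sqrt_continuous.
Qed.

End kernel_integrals.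

Section dyadic.
Context {R : realType}.

Lemma dyadic_below (x : R) : 0 < x -> x < 1 ->
  exists j : nat, (2 ^+ j.+1)^-1 <= x < (2 ^+ j)^-1.
Proof.
move=> x0 x1.
have ex : exists j, (2 ^+ j.+1)^-1 <= x.
  exists (Num.truncn x^-1); rewrite invf_ple ?posrE ?exprn_gt0//.
  rewrite -natrX ltW// (lt_trans (truncnS_gt _))// ltr_nat.
  by rewrite (ltn_expl _ (isT : 1 < 2)%N).
have [j jx jmin] := ex_minnP ex; exists j; rewrite jx/=.
case: j jx jmin => [|j] _ jmin; first by rewrite expr0 invr1.
by rewrite ltNge; apply/negP => /jmin; rewrite ltnn.
Qed.

Lemma dyadic_above (x : R) : 1 <= x ->
  exists j : nat, 4 ^+ j <= x < 4 ^+ j.+1.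
Proof.
move=> x1.
have ex : exists j, x < 4 ^+ j.+1.
  exists (Num.truncn x); apply: lt_trans (truncnS_gt _) _.
  by rewrite -natrX ltr_nat (ltn_expl _ (isT : 1 < 4)%N).
have [j jx jmin] := ex_minnP ex; exists j; rewrite jx andbT.
case: j jx jmin => [|j] _ jmin; first by rewrite expr0.
by rewrite leNgt; apply/negP => /jmin; rewrite ltnn.
Qed.

End dyadic.

Section moments.
Context {R : realType} {n : nat}.

(** Bounds both geometric series below. *)
Definition moment_const : R := 4 * 8 ^+ n.+1.

Lemma moment_const_ge0 : 0 <= moment_const. Proof. by rewrite mulr_ge0// exprn_ge0. Qed.

(** The integrand is [|z|^(-n)] in dimension [n + 1], and the ball of radius [r / 2^j]
    contributes [O(r / 2^j)]. *)
Lemma near_moment (r : R) : 0 < r ->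
  (\int[lebesgue_rV n.+1]_(z in [set z : 'rV[R]_n.+1 | (enorm z < r)%R])
    (enorm z ^+ 2 * jump_kernel z)%:E <= (moment_const * r)%:E)%E.
Proof.
move=> r0.
pose c j : R := ((r / 2 ^+ j.+1) ^+ n)^-1.
have p2 j : 0 < 2 ^+ j :> R by rewrite exprn_gt0.
apply: (@integral_dyadic_cover_le _ _ _ _ _ _ c
  (fun j => [set z : 'rV[R]_n.+1 | enorm z < r / 2 ^+ j])).
- exact: measurable_eball.
- exact: measurable_near_integrand.
- by move=> z _; rewrite mulr_ge0// ?sqr_ge0// jump_kernel_ge0.
- by move=> j; rewrite invr_ge0 exprn_ge0// divr_ge0// ltW.
- by move=> j; exact: measurable_eball.
- by rewrite mulr_ge0 ?moment_const_ge0// ltW.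
- move=> z /= zr; have [/eqP|z0] := eqVneq (enorm z) 0.
    rewrite enorm_eq0 => /eqP ->; exists 0%N.
      by rewrite enorm0 expr0 divr1.
    by rewrite enorm0 expr0n mul0r invr_ge0 exprn_ge0// divr_ge0// ltW.
  have zp : 0 < enorm z by rewrite lt_neqAle eq_sym z0 enorm_ge0.
  have [||j /andP[j1 j2]] := @dyadic_below R (enorm z / r).
  + by rewrite divr_gt0.
  + by rewrite ltr_pdivrMr// mul1r.
  exists j; first by move: j2; rewrite ltr_pdivrMr// mulrC.
  rewrite /jump_kernel -[n.+2]/(2 + n)%N exprD invfM mulrA divff ?mul1r; last first.
    by rewrite expf_neq0.
  rewrite /c lef_pV2 ?posrE ?exprn_gt0 ?divr_gt0// lerXn2r ?nnegrE ?enorm_ge0//.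
    by rewrite divr_ge0// ltW.
  by move: j1; rewrite ler_pdivlMr// mulrC.
- move=> j; have := @lebesgue_eball_le R n.+1 (r / 2 ^+ j).
  move=> /(_ (divr_gt0 r0 (p2 _))) h.
  apply: (@le_trans _ _ ((c j)%:E * ((2 * (r / 2 ^+ j)) ^+ n.+1)%:E)%E).
    by rewrite lee_wpmul2l// lee_fin invr_ge0 exprn_ge0// divr_ge0// ltW.
  rewrite -EFinM lee_fin natrX.
  rewrite (_ : c j * _ = 4 ^+ n.+1 * r / 2 ^+ j.+1).
    rewrite ler_pM2r ?invr_gt0// ler_pM2r// /moment_const.
    apply: (@le_trans _ _ (8 ^+ n.+1)); last by rewrite ler_peMl ?exprn_ge0//; lra.
    by rewrite lerXn2r ?nnegrE//; lra.
  rewrite /c -(mulrA _ r); set w := r / 2 ^+ j.+1.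
  have w0 : w != 0 by rewrite gt_eqF// divr_gt0.
  rewrite (_ : 2 * (r / 2 ^+ j) = 4 * w); last first.
    by rewrite /w exprS; field; rewrite gt_eqF.
  rewrite (exprMn _ 4) (exprS w); field.
  by rewrite expf_neq0.
Qed.

(** The kernel decays one power faster than volumes grow, so half a power can be
    spared.  The radii [4^j r] make the square roots powers of 2. *)
Lemma far_moment (r : R) : 0 < r ->
  (\int[lebesgue_rV n.+1]_(z in [set z : 'rV[R]_n.+1 | (r <= enorm z)%R])
    (Num.sqrt (enorm z) * jump_kernel z)%:E <= (moment_const / Num.sqrt r)%:E)%E.
Proof.
move=> r0.
have p4 j : 0 < 4 ^+ j :> R by rewrite exprn_gt0.
have p2 j : 0 < 2 ^+ j :> R by rewrite exprn_gt0.
have sr0 : 0 < Num.sqrt r by rewrite sqrtr_gt0.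
pose c j : R := 2 ^+ j.+1 * Num.sqrt r / (4 ^+ j * r) ^+ n.+2.
have c0 j : 0 <= c j.
  by apply: divr_ge0; [rewrite mulr_ge0 ?exprn_ge0 ?sqrtr_ge0|rewrite exprn_ge0 ?mulr_ge0 ?exprn_ge0 ?ltW].
apply: (@integral_dyadic_cover_le _ _ _ _ _ _ c
  (fun j => [set z : 'rV[R]_n.+1 | enorm z < 4 ^+ j.+1 * r])).
- exact: measurable_eballC.
- exact: measurable_far_integrand.
- by move=> z _; rewrite mulr_ge0// ?sqrtr_ge0// jump_kernel_ge0.
- by [].
- by move=> j; exact: measurable_eball.
- by rewrite divr_ge0 ?moment_const_ge0// ltW.
- move=> z /= zr.
  have [|j /andP[j1 j2]] := @dyadic_above R (enorm z / r).
    by rewrite ler_pdivlMr// mul1r.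
  have zp : 0 < enorm z by exact: lt_le_trans r0 zr.
  exists j; first by move: j2; rewrite ltr_pdivrMr.
  rewrite /c /jump_kernel; apply: ler_pM; rewrite ?sqrtr_ge0 ?invr_ge0 ?exprn_ge0 ?enorm_ge0//.
    rewrite (_ : 2 ^+ j.+1 = Num.sqrt (4 ^+ j.+1)); last first.
      rewrite (_ : 4 = 2 ^+ 2); last by rewrite expr2; lra.
      by rewrite exprAC sqrtr_sqr ger0_norm// ltW.
    rewrite -sqrtrM ?(ltW (p4 _))// ler_wsqrtr//.
    by apply: ltW; move: j2; rewrite ltr_pdivrMr.
  rewrite lef_pV2 ?posrE ?exprn_gt0 ?mulr_gt0//.
  rewrite lerXn2r ?nnegrE ?mulr_ge0 ?(ltW zp) ?(ltW r0) ?(ltW (p4 _))//.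
  by move: j1; rewrite ler_pdivlMr.
- move=> j; have := @lebesgue_eball_le R n.+1 (4 ^+ j.+1 * r).
  move=> /(_ (mulr_gt0 (p4 _) r0)) h.
  apply: (@le_trans _ _ ((c j)%:E * ((2 * (4 ^+ j.+1 * r)) ^+ n.+1)%:E)%E).
    by rewrite lee_wpmul2l// lee_fin.
  rewrite -EFinM lee_fin natrX le_eqVlt; apply/orP; left; apply/eqP.
  rewrite /c /moment_const (exprS _ n.+1) (exprS 4 j) (exprS 2 j).
  rewrite (_ : 2 * (4 * 4 ^+ j * r) = 8 * (4 ^+ j * r)); last by ring.
  rewrite (exprMn _ 8).
  have e4 : 4 ^+ j = 2 ^+ j * 2 ^+ j :> R.
    by rewrite -exprMn; congr (_ ^+ _); lra.
  have er : Num.sqrt r * Num.sqrt r = r by rewrite -expr2 sqr_sqrtr// ltW.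
  set E := (4 ^+ j * r) ^+ n.+1.
  have E0 : E != 0 by rewrite gt_eqF// exprn_gt0// mulr_gt0.
  rewrite e4 -{2}er; field.
  by rewrite E0 !gt_eqF.
Qed.

End moments.

(** * Symmetric integrals and one-sided limits *)

Section reflection.
Context {R : realType} {n : nat}.
Implicit Types (D : set 'rV[R]_n).
Local Notation mu := (lebesgue_rV n).

Lemma measurable_oppr : measurable_fun [set: 'rV[R]_n] (fun z : 'rV[R]_n => - z).
Proof.
rewrite (_ : (fun z => - z) = fun z : 'rV[R]_n => 0 + (-1) *: z).
  exact: measurable_rV_affine.
by apply/funext => z; rewrite add0r scaleN1r.
Qed.

Lemma lebesgue_rV_opp (S : set 'rV[R]_n) : measurable S ->
  mu ((fun z => - z) @^-1` S) = mu S.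
Proof.
rewrite (_ : (fun z => - z) = fun z : 'rV[R]_n => 0 + (-1) *: z).
  by apply: lebesgue_rV_affine; rewrite normrN1.
by apply/funext => z; rewrite add0r scaleN1r.
Qed.

Local Notation pmu := (measure_function_pushforward__canonical__measure_function_Measure
  (@lebesgue_rV R n) measurable_oppr).

Lemma opp_pushforward D (f : 'rV[R]_n -> \bar R) : measurable D ->
  (\int[mu]_(z in D) f z = \int[pmu]_(z in D) f z)%E.
Proof.
move=> mD; apply: eq_measure_integral => A mA _.
by apply/esym; exact: lebesgue_rV_opp.
Qed.

Lemma integrable_opp D (f : 'rV[R]_n -> R) :
  measurable D -> measurable_fun setT f -> (forall z, D z -> D (- z)) ->
  mu.-integrable D (EFin \o f) -> mu.-integrable D (fun z => (f (- z))%:E).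
Proof.
move=> mD mf DN /integrableP[_ ifin]; apply/integrableP; split.
  apply/measurable_EFinP; apply: measurable_funTS.
  by apply: measurableT_comp mf _; exact: measurable_oppr.
apply: le_lt_trans ifin.
rewrite [leRHS]opp_pushforward// ge0_integral_pushforward//.
- rewrite (_ : _ @^-1` D = D)//.
  by apply/seteqP; split => z /= /DN//; rewrite opprK.
- exact: measurable_oppr.
- by apply: measurableT_comp => //; apply/measurable_EFinP; exact: measurable_funTS.
Qed.

Lemma Rintegral_opp D (f : 'rV[R]_n -> R) :
  measurable D -> measurable_fun setT f -> (forall z, D z -> D (- z)) ->
  mu.-integrable D (EFin \o f) ->
  \int[mu]_(z in D) f z = \int[mu]_(z in D) f (- z).
Proof.
move=> mD mf DN fi; rewrite /Rintegral; congr fine.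
have DE : (fun z : 'rV[R]_n => - z) @^-1` D = D.
  by apply/seteqP; split => z /= /DN//; rewrite opprK.
rewrite opp_pushforward// integral_pushforward ?DE//.
- exact: measurable_oppr.
- exact/measurable_EFinP.
- exact: integrable_opp.
Qed.

Lemma integrable_even D (f : 'rV[R]_n -> R) :
  measurable D -> measurable_fun setT f -> (forall z, D z -> D (- z)) ->
  mu.-integrable D (EFin \o f) ->
  mu.-integrable D (EFin \o (fun z => f z + f (- z))).
Proof.
move=> mD mf DN fi; have fNi := integrable_opp mD mf DN fi.
rewrite (_ : _ \o _ = (EFin \o f) \+ (fun z => (f (- z))%:E))%E //.
exact: integrableD.
Qed.

(** Over a symmetric domain only the even part of [f] contributes, which is what
    turns first-order singular integrands into second-order ones. *)
Lemma Rintegral_even D (f : 'rV[R]_n -> R) :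
  measurable D -> measurable_fun setT f -> (forall z, D z -> D (- z)) ->
  mu.-integrable D (EFin \o f) ->
  2 * \int[mu]_(z in D) f z = \int[mu]_(z in D) (f z + f (- z)).
Proof.
move=> mD mf DN fi; have fNi := integrable_opp mD mf DN fi.
by rewrite RintegralD// -Rintegral_opp// mulr_natl mulr2n.
Qed.

End reflection.

Section compact_ball.
Context {R : realType} {n : nat}.

Lemma compact_eball (r : R) : compact [set z : 'rV[R]_n | enorm z <= r].
Proof.
apply: bounded_closed_compact.
  exists r; split; first exact: num_real.
  move=> M rM z /= zr; apply: le_trans (norm_le_enorm _) _.
  exact: le_trans zr (ltW rM).
rewrite (_ : [set _ | _] = @enorm R n @^-1` [set t | t <= r])//.
by apply: closed_comp => [z _|]; [exact: continuous_enorm|exact: closed_le].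
Qed.

Lemma bounded_on_eball (f : 'rV[R]_n -> R) (r : R) : continuous f ->
  exists2 M, 0 <= M & forall z, enorm z <= r -> `|f z| <= M.
Proof.
move=> cf; have cK := @compact_eball r.
have : bounded_set (f @` [set z : 'rV[R]_n | enorm z <= r]).
  apply: compact_bounded; apply: continuous_compact => //.
  exact: continuous_subspaceT.
move=> [M [_ MP]]; exists (`|M| + 1); first by rewrite addr_ge0.
move=> z zr; apply: (MP (`|M| + 1)) => /=; last by exists z.
by rewrite (le_lt_trans (ler_norm _))// ltrDl.
Qed.

End compact_ball.

(** A function without limit has [lim] equal to 0, so a bound on the integrals over
    annuli bounds the principal value whether or not the latter exists. *)
Lemma lim_right_le (R : realType) (F : R -> R) (C : R) :
  0 <= C -> (forall eps, 0 < eps -> F eps <= C) ->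
  lim (F eps @[eps --> 0^'+]) <= C.
Proof.
move=> C0 FC; have [cv|ncv] := pselect (cvg (F eps @[eps --> 0^'+])).
  apply: limr_le => //; near=> e; apply: FC; near: e.
  exact: nbhs_right_gt.
by rewrite (dvgP ncv).
Unshelve. all: by end_near. Qed.

Lemma lim_right_ge (R : realType) (F : R -> R) (C : R) :
  C <= 0 -> (forall eps, 0 < eps -> C <= F eps) ->
  C <= lim (F eps @[eps --> 0^'+]).
Proof.
move=> C0 FC; have [cv|ncv] := pselect (cvg (F eps @[eps --> 0^'+])).
  apply: limr_ge => //; near=> e; apply: FC; near: e.
  exact: nbhs_right_gt.
by rewrite (dvgP ncv).
Unshelve. all: by end_near. Qed.

(** * The singular part of the half-Laplacian *)

Section near.
Context {R : realType} {n : nat}.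
Implicit Types (phi : 'rV[R]_n.+1 -> R) (x z : 'rV[R]_n.+1).
Local Notation mu := (lebesgue_rV n.+1).
Local Notation N := (@moment_const R n).

Lemma measurable_diff_quot phi x :
  continuous phi -> measurable_fun setT (diff_quot phi x).
Proof.
move=> cphi; apply: measurable_funM; last exact: measurable_jump_kernel.
apply: measurable_funB => //.
apply: (measurableT_comp (continuous_rV_measurable cphi)).
rewrite (_ : +%R x = fun z => x + 1 *: z).
  exact: measurable_rV_affine.
by apply/funext => z; rewrite scale1r.
Qed.

Lemma integrable_near (D : set 'rV[R]_n.+1) (r : R) : 0 < r -> measurable D ->
  D `<=` [set z | enorm z < r] ->
  mu.-integrable D (EFin \o (fun z => enorm z ^+ 2 * jump_kernel z)).
Proof.
move=> r0 mD Dr; apply: (integrableS _ mD Dr); first exact: measurable_eball.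
apply/integrableP; split; first by apply/measurable_EFinP; exact: measurable_near_integrand.
apply: le_lt_trans (ltry (N * r)).
apply: le_trans (near_moment r0); rewrite le_eqVlt; apply/orP; left; apply/eqP.
by apply: eq_integral => z _ /=; rewrite ger0_norm// mulr_ge0 ?sqr_ge0 ?jump_kernel_ge0.
Qed.

Lemma Rintegral_near_le (D : set 'rV[R]_n.+1) (r : R) : 0 < r -> measurable D ->
  D `<=` [set z | enorm z < r] ->
  \int[mu]_(z in D) (enorm z ^+ 2 * jump_kernel z) <= N * r.
Proof.
move=> r0 mD Dr; rewrite /Rintegral -lee_fin fineK.
  apply: le_trans (near_moment r0); apply: ge0_subset_integral => //.
  - exact: measurable_eball.
  - by apply/measurable_EFinP; exact: measurable_near_integrand.
  - by move=> z _; rewrite lee_fin mulr_ge0 ?sqr_ge0 ?jump_kernel_ge0.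
by apply: integrable_fin_num => //; exact: (integrable_near r0 mD Dr).
Qed.

Lemma integrable_diff_quot_annulus phi x (e r : R) : continuous phi ->
  0 < e -> mu.-integrable [set z | e <= enorm z < r] (EFin \o diff_quot phi x).
Proof.
move=> cphi e0; have [r0|r0] := leP r 0.
  rewrite (_ : [set z | _] = set0); first exact: integrable_set0.
  apply/seteqP; split => z //= /andP[ez zr].
  by have := lt_trans (lt_le_trans e0 ez) zr; rewrite ltNge r0.
have mA := @measurable_eannulus R n.+1 e r.
apply: measurable_bounded_integrable => //.
- apply: (@le_lt_trans _ _ (mu [set z | (enorm z < r)%R])).
    apply: le_measure; rewrite ?inE//; first exact: measurable_eball.
    by move=> z /= /andP[].
  by apply: le_lt_trans (lebesgue_eball_le r0) (ltry _).
- by apply: measurable_funTS; exact: measurable_diff_quot.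
have [M M0 MP] := @bounded_on_eball R _ phi (enorm x + r) cphi.
exists ((M + M) * (e ^+ n.+2)^-1); split; first exact: num_real.
move=> M' MM' z /= /andP[ez zr]; apply: le_trans (ltW MM').
rewrite /diff_quot normrM; apply: ler_pM => //.
  apply: le_trans (ler_normB _ _) _; apply: lerD; apply: MP.
    by rewrite (le_trans (ler_enormD _ _))// lerD2l ltW.
  by rewrite lerDl ltW.
rewrite ger0_norm ?invr_ge0 ?exprn_ge0 ?enorm_ge0//.
have z0 := lt_le_trans e0 ez.
by rewrite lef_pV2 ?posrE ?exprn_gt0// lerXn2r// nnegrE ?enorm_ge0// ltW.
Qed.

(** Averaging over [z] and [- z] cancels the gradient of [phi] and leaves second
    differences. *)
Lemma near_integral_le phi x (Lam e r : R) : continuous phi -> 0 <= Lam ->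
  (forall z, phi (x + z) + phi (x - z) - 2 * phi x <= 2 * Lam * enorm z ^+ 2) ->
  0 < e -> 0 < r ->
  \int[mu]_(z in [set z | e <= enorm z < r]) diff_quot phi x z <= Lam * (N * r).
Proof.
move=> cphi Lam0 H e0 r0; set A := [set z | _].
have mA : measurable A by exact: measurable_eannulus.
have Ar : A `<=` [set z | enorm z < r] by move=> z /= /andP[].
have iA := integrable_near r0 mA Ar.
have ANA z : A z -> A (- z) by rewrite /A/= enormN.
have mq := @measurable_diff_quot phi x cphi.
have iq := @integrable_diff_quot_annulus phi x e r cphi e0.
rewrite -(ler_pM2l (ltr0n R 2)) Rintegral_even//.
apply: (@le_trans _ _ (\int[mu]_(z in A) (2 * Lam * (enorm z ^+ 2 * jump_kernel z)))).
  apply: le_Rintegral => //.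
  - exact: integrable_even.
  - exact: (integrableZl mA (2 * Lam) iA).
  - move=> z _; rewrite /diff_quot enormN -/(jump_kernel z) -mulrDl !mulrA.
    by apply: ler_wpM2r; [exact: jump_kernel_ge0|move: (H z); lra].
rewrite RintegralZl// -mulrA; apply: ler_wpM2l => //; apply: ler_wpM2l => //.
exact: Rintegral_near_le.
Qed.

Lemma I_near_ge phi x (Lam r : R) : 0 <= c_half R n.+1 -> continuous phi -> 0 <= Lam ->
  (forall z, phi (x + z) + phi (x - z) - 2 * phi x <= 2 * Lam * enorm z ^+ 2) ->
  0 < r -> - (c_half R n.+1 * (Lam * (N * r))) <= I_near r phi x.
Proof.
move=> c0 cphi Lam0 H r0; rewrite /I_near mulNr lerN2; apply: ler_wpM2l => //.
apply: lim_right_le; first by rewrite !mulr_ge0 ?moment_const_ge0// ltW.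
by move=> e e0; exact: near_integral_le.
Qed.

Lemma I_near_le phi x (Lam r : R) : 0 <= c_half R n.+1 -> continuous phi -> 0 <= Lam ->
  (forall z, - (2 * Lam * enorm z ^+ 2) <= phi (x + z) + phi (x - z) - 2 * phi x) ->
  0 < r -> I_near r phi x <= c_half R n.+1 * (Lam * (N * r)).
Proof.
move=> c0 cphi Lam0 H r0; rewrite /I_near mulNr -[leRHS]opprK lerN2 -mulrN.
apply: ler_wpM2l => //.
apply: lim_right_ge; first by rewrite oppr_le0 !mulr_ge0 ?moment_const_ge0// ltW.
move=> e e0; rewrite lerNl.
have cN : continuous (fun y => - phi y) by move=> y; apply: (@continuousN _ _ _ phi); exact: cphi.
have := @near_integral_le (fun y => - phi y) x Lam e r cN Lam0.
move=> /(_ _ e0 r0) H'; apply: le_trans (H' _); last by move=> z; move: (H z); lra.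
rewrite -mulN1r -RintegralZl//; last 2 first.
- exact: measurable_eannulus.
- exact: integrable_diff_quot_annulus.
rewrite le_eqVlt; apply/orP; left; apply/eqP.
by apply: eq_Rintegral => z _; rewrite /diff_quot; ring.
Qed.

End near.

(** * The far part of the half-Laplacian *)

Section far.
Context {R : realType} {n : nat}.
Implicit Types (z : 'rV[R]_n.+1).
Local Notation mu := (lebesgue_rV n.+1).
Local Notation N := (@moment_const R n).
Local Notation rV := ('rV[R]_n.+1).

(** Bounds [(1 + |z|^2 / r^2)^s - 1] up to a factor proportional to [s], and is integrable
    against the kernel both at the origin and at infinity. *)
Definition growth (r : R) z : R :=
  if enorm z < r then enorm z ^+ 2 / r ^+ 2 else Num.sqrt (enorm z) / Num.sqrt r.

Lemma growth_ge0 (r : R) z : 0 <= growth r z.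
Proof.
rewrite /growth; case: ifP => _; first by rewrite divr_ge0 ?sqr_ge0.
by rewrite divr_ge0 ?sqrtr_ge0.
Qed.

Lemma integrable_far (D : set rV) (r : R) : 0 < r -> measurable D ->
  D `<=` [set z | r <= enorm z] ->
  mu.-integrable D (EFin \o (fun z => Num.sqrt (enorm z) * jump_kernel z)).
Proof.
move=> r0 mD Dr; apply: (integrableS _ mD Dr); first exact: measurable_eballC.
apply/integrableP; split; first by apply/measurable_EFinP; exact: measurable_far_integrand.
apply: le_lt_trans (ltry (N / Num.sqrt r)).
apply: le_trans (far_moment r0); rewrite le_eqVlt; apply/orP; left; apply/eqP.
by apply: eq_integral => z _ /=; rewrite ger0_norm// mulr_ge0 ?sqrtr_ge0 ?jump_kernel_ge0.
Qed.

Lemma integrable_bounded_far (g : rV -> R) (M r : R) : 0 < r ->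
  measurable_fun setT g -> (forall z, `|g z| <= M) ->
  mu.-integrable [set z | r <= enorm z] (EFin \o (fun z => g z * jump_kernel z)).
Proof.
move=> r0 mg gM; set D := [set z | _].
have mD : measurable D by exact: measurable_eballC.
have M0 : 0 <= M by exact: le_trans (normr_ge0 _) (gM 0).
have iD := integrableZl mD (M / Num.sqrt r) (integrable_far r0 mD (@subset_refl _ D)).
apply: le_integrable iD => //.
  apply/measurable_EFinP; apply: measurable_funTS; apply: measurable_funM => //.
  exact: measurable_jump_kernel.
move=> z /= rz; rewrite lee_fin !normrM mulrA ler_wpM2r//.
have sr : 0 < Num.sqrt r by rewrite sqrtr_gt0.
apply: le_trans (gM z) _; rewrite (ger0_norm M0) -[leLHS]mulr1 -mulrA ler_wpM2l//.
rewrite !ger0_norm ?invr_ge0 ?sqrtr_ge0// mulrC ler_pdivlMr// mul1r.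
by rewrite ler_wsqrtr.
Qed.

Lemma measurable_growth_integrand (r : R) :
  measurable_fun setT (fun z => growth r z * jump_kernel z).
Proof.
apply: measurable_funM; last exact: measurable_jump_kernel.
have me : measurable_fun [set: rV] (@enorm R n.+1) by exact: measurable_enorm.
apply: measurable_fun_ifT.
- exact: measurable_fun_ltr.
- by apply: measurable_funM => //; exact: measurable_funX.
- apply: measurable_funM => //.
  apply: (@measurableT_comp _ _ _ _ _ _ (@Num.sqrt R)) => //.
  by apply: continuous_measurable_fun; exact: sqrt_continuous.
Qed.

Lemma growth_moment (r : R) : 0 < r ->
  (\int[mu]_z (growth r z * jump_kernel z)%:E <= (2 * N / r)%:E)%E.
Proof.
move=> r0.
have sr : 0 < Num.sqrt r by rewrite sqrtr_gt0.
rewrite (_ : [set: rV] = [set z | enorm z < r] `|` [set z | r <= enorm z]); last first.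
  by apply/seteqP; split => // z _ /=; case: (ltP (enorm z) r); [left|right].
rewrite ge0_integral_setU//=; last 5 first.
- exact: measurable_eball.
- exact: measurable_eballC.
- apply/measurable_EFinP; apply: measurable_funTS; exact: measurable_growth_integrand.
- by move=> z _; rewrite lee_fin mulr_ge0 ?growth_ge0 ?jump_kernel_ge0.
- by apply/disj_setPS => z [/= zr]; rewrite leNgt zr.
have k0 z : 0 <= jump_kernel z by exact: jump_kernel_ge0.
rewrite [X in (X + _)%E](_ : _ = \int[mu]_(z in [set z | (enorm z < r)%R])
    ((r ^- 2)%:E * (enorm z ^+ 2 * jump_kernel z)%:E))%E; last first.
  apply: eq_integral => z; rewrite inE /= => zr.
  by rewrite -EFinM /growth zr mulrA (mulrC (r ^- 2)).
rewrite ge0_integralZl; last 4 first.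
- exact: measurable_eball.
- by apply/measurable_EFinP; exact: measurable_near_integrand.
- by move=> z _; rewrite lee_fin mulr_ge0 ?sqr_ge0.
- by rewrite lee_fin invr_ge0 sqr_ge0.
rewrite [X in (_ + X)%E](_ : _ = \int[mu]_(z in [set z | (r <= enorm z)%R])
    (((Num.sqrt r)^-1)%:E * (Num.sqrt (enorm z) * jump_kernel z)%:E))%E; last first.
  apply: eq_integral => z; rewrite inE /= => zr.
  by rewrite -EFinM /growth ltNge zr /= mulrA (mulrC (Num.sqrt r)^-1).
rewrite ge0_integralZl; last 4 first.
- exact: measurable_eballC.
- by apply/measurable_EFinP; exact: measurable_far_integrand.
- by move=> z _; rewrite lee_fin mulr_ge0 ?sqrtr_ge0.
- by rewrite lee_fin invr_ge0 sqrtr_ge0.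
apply: (@le_trans _ _ ((r ^- 2)%:E * (N * r)%:E + (Num.sqrt r)^-1%:E * (N / Num.sqrt r)%:E))%E.
  apply: leeD; apply: lee_wpmul2l; rewrite ?lee_fin ?invr_ge0 ?sqr_ge0 ?sqrtr_ge0//.
    exact: near_moment.
  exact: far_moment.
rewrite -!EFinM -EFinD lee_fin le_eqVlt; apply/orP; left; apply/eqP.
have er : Num.sqrt r * Num.sqrt r = r by rewrite -expr2 sqr_sqrtr// ltW.
rewrite (_ : (Num.sqrt r)^-1 * (N / Num.sqrt r) = N / r); last first.
  by rewrite -{3}er invfM; ring.
by field; rewrite gt_eqF.
Qed.

Lemma integrable_growth (r : R) (D : set rV) : 0 < r -> measurable D ->
  mu.-integrable D (EFin \o (fun z => growth r z * jump_kernel z)).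
Proof.
move=> r0 mD; apply: (integrableS _ mD (@subsetT _ D)) => //.
apply/integrableP; split; first by apply/measurable_EFinP; exact: measurable_growth_integrand.
apply: le_lt_trans (ltry (2 * N / r)); apply: le_trans (growth_moment r0).
rewrite le_eqVlt; apply/orP; left; apply/eqP.
by apply: eq_integral => z _ /=; rewrite ger0_norm// mulr_ge0 ?growth_ge0 ?jump_kernel_ge0.
Qed.

Lemma Rintegral_growth_le (r : R) (D : set rV) : 0 < r -> measurable D ->
  \int[mu]_(z in D) (growth r z * jump_kernel z) <= 2 * N / r.
Proof.
move=> r0 mD; rewrite /Rintegral -lee_fin fineK.
  apply: le_trans (growth_moment r0); apply: ge0_subset_integral => //.
  - by apply/measurable_EFinP; exact: measurable_growth_integrand.
  - by move=> z _; rewrite lee_fin mulr_ge0 ?growth_ge0 ?jump_kernel_ge0.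
by apply: integrable_fin_num => //; exact: integrable_growth.
Qed.

Lemma integrable_indic_far (S : set rV) (kappa : R) : 0 < kappa -> measurable S ->
  mu.-integrable [set z | kappa <= enorm z] (EFin \o (fun z => \1_S z * jump_kernel z)).
Proof.
move=> k0 mS; apply: (@integrable_bounded_far _ 1) => //.
by move=> z; rewrite indicE; case: (_ \in _); rewrite ?normr0 ?normr1.
Qed.

Lemma Rintegral_indic_far_ge (S : set rV) (m0 r kappa : R) :
  0 < r -> 0 < kappa -> measurable S -> S `<=` [set z | enorm z < r] ->
  (m0%:E <= mu S)%E ->
  (m0 - (2 * kappa) ^+ n.+1) / r ^+ n.+2 <=
  \int[mu]_(z in [set z | kappa <= enorm z]) (\1_S z * jump_kernel z).
Proof.
move=> r0 k0 mS Sr m0S; set D := [set z | _].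
have mD : measurable D by exact: measurable_eballC.
rewrite /Rintegral -lee_fin fineK; last first.
  by apply: integrable_fin_num => //; exact: integrable_indic_far.
apply: (@le_trans _ _ (\int[mu]_(z in D) ((r ^- n.+2)%:E * (\1_S z)%:E))%E); last first.
  apply: ge0_le_integral => //.
  - by move=> z _; rewrite -EFinM lee_fin indicE mulr_ge0 ?ler0n ?invr_ge0 ?exprn_ge0 ?(ltW r0).
  - apply: measurable_funeM; apply/measurable_EFinP.
    exact: (@measurable_indic _ _ R _ _ mS).
  - apply/measurable_EFinP; apply: measurable_funTS; apply: measurable_funM.
      exact: (@measurable_indic _ _ R _ _ mS).
    exact: measurable_jump_kernel.
  - move=> z kz; rewrite -EFinM lee_fin indicE.
    case: (boolP (z \in S)) => [/set_mem/Sr/= zr|_]; last by rewrite mulr0 mul0r.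
    rewrite mulr1 mul1r lef_pV2 ?posrE ?exprn_gt0//; last exact: lt_le_trans kz.
    by rewrite lerXn2r ?nnegrE ?enorm_ge0// ltW.
rewrite ge0_integralZl//; last 2 first.
- by apply/measurable_EFinP; exact: (@measurable_indic _ _ R _ _ mS).
- by rewrite lee_fin invr_ge0 exprn_ge0// ltW.
rewrite integral_indic// mulrC EFinM; apply: lee_wpmul2l.
  by rewrite lee_fin invr_ge0 exprn_ge0// ltW.
rewrite EFinB leeBlDr//.
apply: le_trans m0S _.
apply: (@le_trans _ _ (mu ((S `&` D) `|` [set z | (enorm z < kappa)%R]))%E).
  apply: le_measure; rewrite ?inE//.
    by apply: measurableU; [exact: measurableI|exact: measurable_eball].
  by move=> z Sz; case: (ltP (enorm z) kappa) => ?; [right|left].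
apply: le_trans (measureU2 _ _ _) _ => //.
- exact: measurableI.
- exact: measurable_eball.
by apply: leeD => //; exact: lebesgue_eball_le.
Qed.

(** The kernel is at least [(2 r)^(-n-2)] on [S], so the gain on [S] survives
    integration; the error is measured by the moments of [growth]. *)
Lemma far_lower (B : rV -> R) (S : set rV) (M r kappa delta eta m0 : R) :
  0 < r -> 0 < kappa -> 0 <= delta -> 0 <= eta ->
  measurable_fun setT B -> (forall z, `|B z| <= M) ->
  measurable S -> S `<=` [set z | enorm z < 2 * r] -> (m0%:E <= mu S)%E ->
  (forall z, kappa <= enorm z ->
    delta * \1_S z - eta * growth r z <= B z + B (- z)) ->
  delta * ((m0 - (2 * kappa) ^+ n.+1) / (2 * r) ^+ n.+2) - eta * (2 * N / r) <=
  2 * \int[mu]_(z in [set z | kappa <= enorm z]) (B z * jump_kernel z).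
Proof.
move=> r0 k0 d0 e0 mB BM mS Sr m0S H; set D := [set z | _].
have mD : measurable D by exact: measurable_eballC.
have iS := integrable_indic_far k0 mS.
have iG := integrable_growth r0 mD.
have iB : mu.-integrable D (EFin \o (fun z => B z * jump_kernel z)).
  exact: (@integrable_bounded_far _ M).
have i1 := integrableZl mD delta iS.
have i2 := integrableZl mD eta iG.
apply: (@le_trans _ _
  (\int[mu]_(z in D) (delta * (\1_S z * jump_kernel z) - eta * (growth r z * jump_kernel z)))).
  rewrite RintegralB// !RintegralZl//; apply: lerB.
    apply: ler_wpM2l => //; apply: Rintegral_indic_far_ge => //.
    by rewrite mulr_gt0.
  by apply: ler_wpM2l => //; exact: Rintegral_growth_le.
have mBk : measurable_fun setT (fun z => B z * jump_kernel z).
  by apply: measurable_funM => //; exact: measurable_jump_kernel.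
have DN z : D z -> D (- z) by rewrite /D/= enormN.
rewrite Rintegral_even//; apply: le_Rintegral => //.
- exact: (integrableB mD i1 i2).
- exact: integrable_even.
- move=> z Dz; rewrite jump_kernelN.
  have := ler_wpM2r (jump_kernel_ge0 z) (H z Dz); rewrite mulrBl mulrDl; lra.
Qed.

End far.

(** * Smooth functions and test functions *)

Section smooth.
Context {R : realType} {n : nat}.
Implicit Types (f g : 'rV[R]_n -> R) (x y : 'rV[R]_n).
Local Notation e i := (delta_mx 0 i : 'rV[R]_n).

Lemma continuous_rVP (T : topologicalType) (F : T -> 'rV[R]_n) :
  (forall i, continuous (fun t => F t 0 i)) -> continuous F.
Proof.
move=> cF x; apply/cvg_ballP => eps eps0.
have : \forall y \near x, forall i : 'I_n, ball (F x 0 i) eps (F y 0 i).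
  apply: filter_forall => i.
  by have /cvg_ballP := cF i x; exact.
by apply: filterS => y H; split => // i j; rewrite (ord1 i).
Qed.

Lemma continuous_add (T : topologicalType) (F G : T -> R) :
  continuous F -> continuous G -> continuous (fun t => F t + G t).
Proof. by move=> cF cG t; exact: (continuousD (cF t) (cG t)). Qed.

Lemma continuous_mul (T : topologicalType) (F G : T -> R) :
  continuous F -> continuous G -> continuous (fun t => F t * G t).
Proof. by move=> cF cG t; exact: (continuousM (cF t) (cG t)). Qed.

Lemma is_C1P f : is_C1 f <->
  (forall x, differentiable f x) /\ forall i, continuous (fun x => 'D_(e i) f x).
Proof.
split=> -[df cf]; split => //.
  move=> i; rewrite (_ : (fun x => 'D_(e i) f x) = (fun M : 'rV[R]_n => M 0 i) \o grad f).
    by move=> x; apply: continuous_comp; [exact: cf|exact: coord_continuous].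
  by apply/funext => x /=; rewrite mxE.
apply: continuous_rVP => i.
by under eq_fun do rewrite mxE; exact: cf.
Qed.

Lemma is_C1_continuous f : is_C1 f -> continuous f.
Proof. by move=> [df _] x; exact: differentiable_continuous. Qed.

Lemma is_C1_cst (c : R) : is_C1 (fun _ : 'rV[R]_n => c).
Proof.
apply/is_C1P; split => [x|i]; first exact: differentiable_cst.
by under eq_fun do rewrite derive_cst; move=> x; exact: cst_continuous.
Qed.

Lemma deriveD_C1 f g x v : is_C1 f -> is_C1 g ->
  'D_v (fun x => f x + g x) x = 'D_v f x + 'D_v g x.
Proof. by move=> [df _] [dg _]; rewrite deriveD//; exact: diff_derivable. Qed.

Lemma deriveM_C1 f g x v : is_C1 f -> is_C1 g ->
  'D_v (fun x => f x * g x) x = f x * 'D_v g x + g x * 'D_v f x.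
Proof. by move=> [df _] [dg _]; rewrite deriveM//; exact: diff_derivable. Qed.

Lemma is_C1D f g : is_C1 f -> is_C1 g -> is_C1 (fun x => f x + g x).
Proof.
move=> Cf Cg; have [df cf] := (is_C1P f).1 Cf; have [dg cg] := (is_C1P g).1 Cg.
apply/is_C1P; split => [x|i]; first exact: differentiableD.
under eq_fun do rewrite (deriveD_C1 _ _ Cf Cg).
by apply: continuous_add; [exact: cf|exact: cg].
Qed.

Lemma is_C1M f g : is_C1 f -> is_C1 g -> is_C1 (fun x => f x * g x).
Proof.
move=> Cf Cg; have [df cf] := (is_C1P f).1 Cf; have [dg cg] := (is_C1P g).1 Cg.
apply/is_C1P; split => [x|i]; first exact: differentiableM.
under eq_fun do rewrite (deriveM_C1 _ _ Cf Cg).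
apply: continuous_add; apply: continuous_mul => //; exact: is_C1_continuous.
Qed.

Lemma derive_coord i x v : 'D_v (fun y : 'rV[R]_n => y 0 i) x = v 0 i.
Proof.
rewrite deriveE; last exact: differentiable_coord.
have lf : linear ((fun y : 'rV[R]_n => y 0 i) : 'rV[R]_n -> R).
  by move=> k y z; rewrite !mxE.
pose F : {linear 'rV[R]_n -> R} :=
  HB.pack (fun y : 'rV[R]_n => y 0 i) (GRing.isLinear.Build _ _ _ _ _ lf).
rewrite (_ : (fun y => _) = F)// diff_lin//; exact: coord_continuous.
Qed.

Lemma is_C1_coord i : is_C1 (fun x => x 0 i).
Proof.
apply/is_C1P; split => [x|j]; first exact: differentiable_coord.
by under eq_fun do rewrite derive_coord; move=> x; exact: cst_continuous.
Qed.

Lemma derive_powR_C1 f (s : R) x v : is_C1 f -> 0 < f x ->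
  'D_v (fun x => f x `^ s) x = s * f x `^ (s - 1) * 'D_v f x.
Proof.
move=> [df _] f0.
have dp : differentiable (fun t : R => t `^ s) (f x).
  by apply/derivable1_diffP; exact: (@ex_derive _ _ _ _ _ _ _ (is_derive1_powR s f0)).
have dc : differentiable ((fun t : R => t `^ s) \o f) x by exact: differentiable_comp.
rewrite (_ : (fun x => _) = (fun t : R => t `^ s) \o f)// deriveE// diff_comp//=.
rewrite [in RHS]deriveE// diff1E// /= derive1E.
rewrite (@derive_val _ _ _ _ _ _ _ (is_derive1_powR s f0)).
by rewrite [LHS]mulrC.
Qed.

Lemma is_C1_powR f (s : R) : is_C1 f -> (forall x, 0 < f x) ->
  is_C1 (fun x => f x `^ s).
Proof.
move=> Cf f0; have [df cf] := (is_C1P f).1 Cf.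
have dpow p (t : R) : 0 < t -> differentiable (fun t : R => t `^ p) t.
  by move=> t0; apply/derivable1_diffP;
    exact: (@ex_derive _ _ _ _ _ _ _ (is_derive1_powR p t0)).
apply/is_C1P; split => [x|i].
  by apply: (@differentiable_comp _ _ _ _ f (fun t : R => t `^ s)) => //; exact: dpow.
under eq_fun do rewrite (derive_powR_C1 _ _ Cf)//.
apply: continuous_mul; last exact: cf.
apply: continuous_mul; first by move=> x; exact: cst_continuous.
move=> x.
apply: (@continuous_comp _ _ _ f (fun t : R => t `^ (s - 1))).
  exact: is_C1_continuous.
by apply: differentiable_continuous; exact: dpow.
Qed.

Lemma is_C2_cst (c : R) : is_C2 (fun _ : 'rV[R]_n => c).
Proof.
split; first exact: is_C1_cst.
move=> i; under eq_fun do rewrite mxE derive_cst; exact: is_C1_cst.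
Qed.

Lemma is_C2_coord i : is_C2 (fun x => x 0 i).
Proof.
split; first exact: is_C1_coord.
move=> j; under eq_fun do rewrite mxE derive_coord; exact: is_C1_cst.
Qed.

Lemma is_C2D f g : is_C2 f -> is_C2 g -> is_C2 (fun x => f x + g x).
Proof.
move=> [Cf C2f] [Cg C2g]; split; first exact: is_C1D.
move=> i; rewrite (_ : (fun x => _) = fun x => grad f x 0 i + grad g x 0 i).
  exact: (is_C1D (C2f i) (C2g i)).
by apply/funext => x; rewrite !mxE deriveD_C1.
Qed.

Lemma is_C2M f g : is_C2 f -> is_C2 g -> is_C2 (fun x => f x * g x).
Proof.
move=> [Cf C2f] [Cg C2g]; split; first exact: is_C1M.
move=> i; rewrite (_ : (fun x => _) =
    fun x => f x * grad g x 0 i + g x * grad f x 0 i).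
  exact: (is_C1D (is_C1M Cf (C2g i)) (is_C1M Cg (C2f i))).
by apply/funext => x; rewrite !mxE deriveM_C1.
Qed.

Lemma is_C2_powR f (s : R) : is_C2 f -> (forall x, 0 < f x) ->
  is_C2 (fun x => f x `^ s).
Proof.
move=> [Cf C2f] f0; split; first exact: is_C1_powR.
move=> i; rewrite (_ : (fun x => _) =
    fun x => s * f x `^ (s - 1) * grad f x 0 i).
  exact: (is_C1M (is_C1M (is_C1_cst s) (is_C1_powR (s - 1) Cf f0)) (C2f i)).
by apply/funext => x; rewrite !mxE derive_powR_C1.
Qed.

Lemma dotpB_sum x y :
  dotp (x - y) (x - y) = \sum_(i <- index_enum 'I_n) (x 0 i + - y 0 i) * (x 0 i + - y 0 i).
Proof. by apply: eq_bigr => i _; rewrite mxE [(- y) 0 i]mxE. Qed.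

Lemma is_C2_sqdist y : is_C2 (fun x => dotp (x - y) (x - y)).
Proof.
under eq_fun do rewrite dotpB_sum.
elim: (index_enum _) => [|i s ih].
  by under eq_fun do rewrite big_nil; exact: is_C2_cst.
under eq_fun do rewrite big_cons.
have Ci := is_C2D (is_C2_coord i) (is_C2_cst (- y 0 i)).
exact: (is_C2D (is_C2M Ci Ci) ih).
Qed.

Lemma derive_sqdist y x v : 'D_v (fun x => dotp (x - y) (x - y)) x = 2 * dotp (x - y) v.
Proof.
under eq_fun do rewrite dotpB_sum.
rewrite /dotp mulr_sumr.
have Cc i : is_C1 (fun x => x 0 i + - y 0 i).
  exact: (is_C1D (is_C1_coord i) (is_C1_cst _)).
have Cs (s : seq 'I_n) : is_C1 (fun x => \sum_(i <- s) (x 0 i + - y 0 i) * (x 0 i + - y 0 i)).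
  elim: s => [|i s ih]; first by under eq_fun do rewrite big_nil; exact: is_C1_cst.
  under eq_fun do rewrite big_cons; exact: (is_C1D (is_C1M (Cc i) (Cc i)) ih).
elim: (index_enum _) => [|i s ih].
  by under eq_fun do rewrite big_nil; rewrite derive_cst big_nil.
under eq_fun do rewrite big_cons.
rewrite (deriveD_C1 x v (is_C1M (Cc i) (Cc i)) (Cs s)).
rewrite ih big_cons (deriveM_C1 x v (Cc i) (Cc i)).
rewrite (deriveD_C1 x v (is_C1_coord i) (is_C1_cst _)).
rewrite derive_coord derive_cst !mxE; congr (_ + _); ring.
Qed.

(** Grows like [|x - y|^(2 s)]: slowly enough to be integrable against the kernel
    of the half-Laplacian at infinity, fast enough to dominate tails. *)
Definition profile (s k : R) y x : R := (1 + k * dotp (x - y) (x - y)) `^ s.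

Lemma profile_base (k : R) y x : 0 <= k -> 1 <= 1 + k * dotp (x - y) (x - y).
Proof. by move=> k0; rewrite lerDl mulr_ge0// dotp_ge0. Qed.

Lemma is_C2_profile (s k : R) y : 0 <= k -> is_C2 (profile s k y).
Proof.
move=> k0; apply: is_C2_powR => [|x].
  exact: (is_C2D (is_C2_cst 1) (is_C2M (is_C2_cst k) (is_C2_sqdist y))).
by rewrite (lt_le_trans ltr01)// profile_base.
Qed.

(** The paraboloid is the penalty of the doubling argument, frozen in one variable. *)
Definition test_fun (A s k : R) y (B : R) (w : 'rV[R]_n) x : R :=
  A * profile s k y x + B * dotp (x - w) (x - w).

Lemma is_C2_test_fun (A s k : R) y (B : R) w : 0 <= k -> is_C2 (test_fun A s k y B w).
Proof.
move=> k0; exact: (is_C2D (is_C2M (is_C2_cst A) (is_C2_profile s y k0))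
  (is_C2M (is_C2_cst B) (is_C2_sqdist w))).
Qed.

Lemma dotp_delta x i : dotp x (e i) = x 0 i.
Proof.
rewrite /dotp (bigD1 i)//= big1 => [|j ji].
  by rewrite !mxE !eqxx mulr1 addr0.
by rewrite !mxE (negbTE ji) andbF mulr0.
Qed.

Lemma grad_test_fun (A s k : R) y (B : R) w x : 0 <= k ->
  grad (test_fun A s k y B w) x =
  (2 * A * s * k * (1 + k * dotp (x - y) (x - y)) `^ (s - 1)) *: (x - y)
  + (2 * B) *: (x - w).
Proof.
move=> k0; have Cc c : is_C1 (fun _ : 'rV[R]_n => c) by exact: is_C1_cst.
have Cd z : is_C1 (fun x => dotp (x - z) (x - z)) by case: (is_C2_sqdist z).
have Cb : is_C1 (fun x => 1 + k * dotp (x - y) (x - y)).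
  exact: (is_C1D (Cc 1) (is_C1M (Cc k) (Cd y))).
have Cp : is_C1 (profile s k y) by case: (is_C2_profile s y k0).
apply/rowP => i; rewrite !mxE.
rewrite (deriveD_C1 x (e i) (is_C1M (Cc A) Cp) (is_C1M (Cc B) (Cd w))).
rewrite (deriveM_C1 x (e i) (Cc A) Cp) (deriveM_C1 x (e i) (Cc B) (Cd w)).
rewrite !derive_cst derive_sqdist derive_powR_C1//; last first.
  by rewrite (lt_le_trans ltr01)// profile_base.
rewrite (deriveD_C1 x (e i) (Cc 1) (is_C1M (Cc k) (Cd y))).
rewrite (deriveM_C1 x (e i) (Cc k) (Cd y)).
rewrite !derive_cst derive_sqdist !dotp_delta !mxE; ring.
Qed.

End smooth.

(** * Positivity of the normalizing constant *)

Section gamma.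
Context {R : realType}.
Local Notation mu := (@lebesgue_measure R).
Local Notation g a := (fun t : R => t `^ a * expR (- t)).

Lemma measurable_gamma_integrand (a : R) D : measurable_fun D (g a).
Proof.
apply: measurable_funTS; apply: measurable_funM; first exact: measurable_powR.
by apply: measurableT_comp => //; exact: measurable_expR.
Qed.

(** From [1 + t / (2 m) <= exp (t / (2 m))], raised to an integer power [m >= a]. *)
Lemma powR_le_expR (a : R) : 0 <= a ->
  exists2 C : R, 0 <= C & forall t, 0 < t -> t `^ a <= C * expR (t / 2).
Proof.
move=> a0; pose m := (Num.truncn a).+1.
have am : a <= m%:R by exact: ltW (truncnS_gt a).
have m0 : 0 < m%:R :> R by rewrite ltr0n.
exists ((2 * m%:R) ^+ m) => [|t t0]; first by rewrite exprn_ge0// mulr_ge0// ltW.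
have t1 : 1 <= 1 + t by rewrite lerDl ltW.
apply: (@le_trans _ _ ((1 + t) `^ a)).
  by apply: ge0_ler_powR => //; rewrite ?nnegrE ?(ltW t0)//; lra.
apply: (@le_trans _ _ ((1 + t) `^ m%:R)); first exact: ler_powR.
rewrite powR_mulrn; last lra.
have h : 1 + t <= 2 * m%:R * expR (t / 2 / m%:R).
  have := expR_ge1Dx (t / 2 / m%:R).
  rewrite -(@ler_pM2l _ (2 * m%:R)) ?mulr_gt0//; apply: le_trans.
  rewrite mulrDr mulr1 (_ : 2 * m%:R * _ = t); last by field; rewrite gt_eqF.
  by rewrite lerD2r (_ : 1 = 1%:R)// -natrM ler_nat.
apply: (@le_trans _ _ ((2 * m%:R * expR (t / 2 / m%:R)) ^+ m)).
  by rewrite lerXn2r// nnegrE ?mulr_ge0 ?expR_ge0 ?(ltW m0)//; lra.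
rewrite exprMn -expRM_natl (_ : m%:R * (t / 2 / m%:R) = t / 2)//.
by field; rewrite gt_eqF.
Qed.

Lemma integrable_gamma (a : R) : 0 <= a -> mu.-integrable `]0, +oo[ (EFin \o g a).
Proof.
move=> a0; have [C C0 H] := powR_le_expR a0.
have r0 : 0 < 2^-1 :> R by rewrite invr_gt0.
have i1 := integrable_exponential_pdf r0.
have mI : measurable (`]0%R, +oo[%classic : set (measurableTypeR R)) by exact: measurable_itv.
have i1' := integrableS (@measurableT _ (measurableTypeR R)) mI (@subsetT _ _) i1.
have i2 := integrableZl mI (C * 2) i1'.
apply: le_integrable i2 => //.
  by apply/measurable_EFinP; exact: measurable_gamma_integrand.
move=> t /=; rewrite in_itv/= andbT => t0; rewrite lee_fin.
rewrite exponential_pdfE; last exact: ltW.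
rewrite ger0_norm ?mulr_ge0 ?powR_ge0 ?expR_ge0// ger0_norm; last first.
  by rewrite !mulr_ge0 ?expR_ge0 ?invr_ge0.
apply: (@le_trans _ _ (C * expR (t / 2) * expR (- t))).
  by rewrite ler_wpM2r ?expR_ge0// H.
rewrite -mulrA -expRD -!mulrA ler_wpM2l//.
rewrite (_ : t / 2 + - t = - 2^-1 * t); last by field.
by rewrite mulrA divff ?mul1r.
Qed.

(** A divergent integral would make [Gamma s] equal to 0, so integrability comes
    first; the interval from 1 to 2 then contributes a positive amount. *)
Lemma Gamma_gt0 (s : R) : 1 <= s -> 0 < Gamma s.
Proof.
move=> s1; have a0 : 0 <= s - 1 by rewrite subr_ge0.
have mg (D : set (measurableTypeR R)) : measurable_fun D (EFin \o g (s - 1)).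
  by apply/measurable_EFinP; exact: measurable_gamma_integrand.
rewrite /Gamma /Rintegral -lte_fin fineK; last first.
  apply: integrable_fin_num => //; exact: integrable_gamma.
apply: (@lt_le_trans _ _ (\int[mu]_(t in `[1%R, 2%R]) (expR (- 2))%:E)%E).
  rewrite integral_cst//= lebesgue_measure_itv/= lte_fin ltr1n.
  by rewrite -EFinB -EFinM lte_fin mulr_gt0 ?expR_gt0//; lra.
apply: (@le_trans _ _ (\int[mu]_(t in `[1%R, 2%R]) (g (s - 1) t)%:E)%E).
  apply: ge0_le_integral => //.
  move=> t /=; rewrite in_itv/= => /andP[t1 t2]; rewrite lee_fin.
    rewrite -[leLHS]mul1r; apply: ler_pM; rewrite ?expR_ge0//.
      by rewrite -[leLHS](powRr0 t) ler_powR.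
    by rewrite ler_expR lerN2.
apply: ge0_subset_integral => //.
- by move=> t _; rewrite lee_fin mulr_ge0 ?powR_ge0 ?expR_ge0.
- by move=> t /=; rewrite !in_itv/= andbT => /andP[t1 _]; exact: (lt_le_trans ltr01 t1).
Qed.

Lemma c_half_gt0 n : 0 < c_half R n.+1.
Proof.
rewrite /c_half divr_gt0// ?powR_gt0 ?pi_gt0//.
apply: Gamma_gt0; rewrite ler_pdivlMr// mul1r ler_nat.
by [].
Qed.

End gamma.

(** * Powers with a small exponent *)

Section powers.
Context {R : realType}.
Implicit Types s x q h : R.

(** The graph of the concave function [x^s] lies below its tangent at 1 (Young's
    inequality for [x^s * 1]). *)
Lemma powR_le_tangent s x : 0 < s < 1 -> 0 <= x -> x `^ s <= 1 + s * (x - 1).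
Proof.
move=> /andP[s0 s1] x0.
have := @conjugate_powR R (x `^ s) 1 s^-1 (1 - s)^-1.
rewrite !invrK -powRrM divff ?gt_eqF// powRr1// powR1 mulr1.
move=> h; apply: le_trans (h _ _ _ _ _) _; rewrite ?powR_ge0 ?invr_gt0 ?subr_gt0//.
  by rewrite addrC subrK.
lra.
Qed.

Lemma powR_le_tangent_at s m x : 0 < s < 1 -> 0 < m -> 0 <= x ->
  x `^ s <= m `^ s * (1 + s * (x / m - 1)).
Proof.
move=> s01 m0 x0; rewrite {1}(_ : x = m * (x / m)); last first.
  by rewrite mulrCA divff ?mulr1// gt_eqF.
have m0' := ltW m0; rewrite powRM ?divr_ge0//; apply: ler_wpM2l; first exact: powR_ge0.
by apply: powR_le_tangent => //; rewrite divr_ge0// ltW.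
Qed.

Lemma powR_mid_concave s a b m : 0 < s < 1 -> 0 < m -> 0 <= a -> 0 <= b ->
  a + b = 2 * m -> a `^ s + b `^ s <= 2 * m `^ s.
Proof.
move=> s01 m0 a0 b0 abm.
have := powR_le_tangent_at s01 m0 a0; have := powR_le_tangent_at s01 m0 b0.
have e : b / m = 2 - a / m by rewrite (_ : b = 2 * m - a); [field; rewrite gt_eqF|lra].
rewrite e; set p := m `^ s; set c := a / m => h1 h2.
apply: le_trans (lerD h2 h1) _; rewrite -mulrDr mulrC; lra.
Qed.

Lemma powR_incr_le s q h : 0 < s < 1 -> 1 <= q <= 2 -> 0 <= h ->
  (q + h) `^ s - q `^ s <= 2 * ((1 + h) `^ s - 1).
Proof.
move=> /andP[s0 s1] /andP[q1 q2] h0; have q0 : 0 < q by exact: lt_le_trans q1.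
rewrite (_ : q + h = q * (1 + h / q)); last by field; rewrite gt_eqF.
have q0' := ltW q0; have s0' := ltW s0.
have hq : 0 <= h / q by rewrite divr_ge0.
have hq1 : 0 <= 1 + h / q by rewrite addr_ge0.
rewrite powRM// -{2}[q `^ s]mulr1 -mulrBr; apply: ler_pM.
- exact: powR_ge0.
- rewrite subr_ge0 -{1}(@powRr0 _ (1 + h / q)) ler_powR// lerDl//.
- apply: (@le_trans _ _ (2 `^ s)); first by rewrite ge0_ler_powR ?nnegrE.
  by rewrite -[leRHS](@powRr1 _ 2)// ler_powR ?(ltW s1)//; lra.
- rewrite lerD2r ge0_ler_powR ?nnegrE ?addr_ge0//.
  by rewrite lerD2l ler_pdivrMr// ler_peMr.
Qed.

Lemma powR_incr_le_tangent s q h : 0 < s < 1 -> 1 <= q -> 0 <= h ->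
  (q + h) `^ s - q `^ s <= s * h.
Proof.
move=> s01 q1 h0; have q0 : 0 < q by exact: lt_le_trans q1.
have [s0 s1] := andP s01.
have := powR_le_tangent_at s01 q0 (addr_ge0 (ltW q0) h0).
rewrite (_ : (q + h) / q - 1 = h / q); last by field; rewrite gt_eqF.
rewrite mulrDr mulr1 -lerBlDl => h1; apply: le_trans h1 _.
have qs : q `^ s <= q by rewrite -[leRHS](powRr1 (ltW q0)) ler_powR// ltW.
rewrite mulrCA; apply: ler_wpM2l; first exact: ltW.
rewrite mulrCA -[leRHS]mulr1; apply: ler_wpM2l => //.
by rewrite ler_pdivrMr// mul1r.
Qed.

(** From [y^s - 1 <= s ln y * y^s] and [ln y <= 8 y^(1/8)].  The factor [s] is the
    point: it makes the half-Laplacian of the profile small. *)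
Lemma powR_small_exponent s y : 0 < s <= 8^-1 -> 1 <= y ->
  y `^ s - 1 <= 8 * s * y `^ 4^-1.
Proof.
move=> /andP[s0 s8] y1; have y0 : 0 < y by exact: lt_le_trans y1.
have ln8 : ln y <= 8 * y `^ 8^-1.
  have : ln (y `^ 8^-1) <= y `^ 8^-1 by apply/ltW/ln_sublinear; rewrite powR_gt0.
  by rewrite ln_powR; lra.
have ey : y `^ s = expR (s * ln y) by rewrite /powR gt_eqF.
have h : y `^ s - 1 <= s * ln y * y `^ s.
  have := expR_ge1Dx (- (s * ln y)); rewrite expRN -ey.
  rewrite -(@ler_pM2r _ (y `^ s)) ?powR_gt0// mulVf ?gt_eqF ?powR_gt0//.
  by rewrite mulrDl mul1r mulNr; lra.
apply: le_trans h _.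
have ys : y `^ s <= y `^ 8^-1 by exact: ler_powR.
have -> : y `^ 4^-1 = y `^ 8^-1 * y `^ 8^-1.
  rewrite -powRD; first by congr (_ `^ _); lra.
  by rewrite gt_eqF// implybT.
have e8 := powR_ge0 y 8^-1.
apply: (@le_trans _ _ (s * (8 * y `^ 8^-1) * y `^ 8^-1)); last lra.
apply: ler_pM => //.
- by rewrite mulr_ge0 ?ln_ge0// ltW.
- exact: powR_ge0.
- by rewrite ler_wpM2l// ltW.
Qed.

Lemma powR4_le_sqrt (rho : R) : 1 <= rho ->
  (1 + rho ^+ 2) `^ 4^-1 <= 2 * Num.sqrt rho.
Proof.
move=> r1; have r0 : 0 < rho by exact: lt_le_trans r1.
apply: (@le_trans _ _ (((2 * rho) ^+ 2) `^ 4^-1)).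
  apply: ge0_ler_powR; rewrite ?nnegrE ?invr_ge0 ?addr_ge0 ?sqr_ge0//.
  have : 1 <= rho ^+ 2 by rewrite expr_ge1// ltW.
  by rewrite exprMn; lra.
rewrite -powR_mulrn ?mulr_ge0// ?(ltW r0)// -powRrM.
rewrite (_ : 2%:R * 4^-1 = 2^-1); last by field.
rewrite powR12_sqrt ?mulr_ge0// ?(ltW r0)//.
rewrite (_ : 2 * Num.sqrt rho = Num.sqrt (2 ^+ 2 * rho)); last first.
  by rewrite sqrtrM ?sqr_ge0// sqrtr_sqr ger0_norm.
by rewrite ler_wsqrtr// expr2 -mulrA ler_wpM2l// ler_peMl ?(ltW r0)//; lra.
Qed.

Lemma powR2_bounds s : 0 < s <= 8^-1 -> 1 <= 2 `^ s :> R /\ 2 `^ s <= 1 + s :> R.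
Proof.
move=> /andP[s0 s8]; split.
  by rewrite -[leLHS](@powRr0 _ 2) ler_powR ?(ltW s0)//; lra.
have s1 : 0 < s < 1 by rewrite s0/=; lra.
by have := @powR_le_tangent s 2 s1 (ltW (ltr0n R 2)); lra.
Qed.

End powers.

Section profile_bounds.
Context {R : realType} {n : nat}.
Implicit Types (x y z : 'rV[R]_n.+1).

Lemma growth_bound (s r : R) z : 0 < s <= 8^-1 -> 0 < r ->
  (1 + r ^- 2 * dotp z z) `^ s - 1 <= 16 * s * growth r z.
Proof.
move=> s8 r0; have [s0 s8'] := andP s8; rewrite -sqr_enorm.
have e0 := enorm_ge0 z.
rewrite /growth; case: (ltP (enorm z) r) => zr.
  have s01 : 0 < s < 1 by rewrite s0/=; lra.
  have h0 : 0 <= r ^- 2 * enorm z ^+ 2 by rewrite mulr_ge0 ?invr_ge0 ?sqr_ge0.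
  have := powR_le_tangent s01 (addr_ge0 ler01 h0).
  rewrite [_ / r ^+ 2]mulrC => h.
  have : 0 <= s * (r ^- 2 * enorm z ^+ 2) by rewrite mulr_ge0// ltW.
  by move: h; set H := r ^- 2 * _; lra.
have rho1 : 1 <= enorm z / r by rewrite ler_pdivlMr// mul1r.
have -> : r ^- 2 * enorm z ^+ 2 = (enorm z / r) ^+ 2 by rewrite exprMn exprVn mulrC.
have y1 : 1 <= 1 + (enorm z / r) ^+ 2 by rewrite lerDl sqr_ge0.
apply: le_trans (powR_small_exponent s8 y1) _.
have -> : Num.sqrt (enorm z) / Num.sqrt r = Num.sqrt (enorm z / r).
  by rewrite sqrtrM// sqrtrV// ltW.
have := powR4_le_sqrt rho1 => /(ler_wpM2l (mulr_ge0 (ler0n R 8) (ltW s0))).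
lra.
Qed.

(** By the parallelogram identity the bases of the powers at [x + z] and [x - z] have
    mean [1 + k |x - y|^2 + k |z|^2]; the power is concave. *)
Lemma profile_second_diff (s k : R) y x z : 0 < s < 1 -> 0 <= k ->
  profile s k y (x + z) + profile s k y (x - z) - 2 * profile s k y x <=
  2 * ((1 + k * dotp (x - y) (x - y) + k * dotp z z) `^ s - profile s k y x).
Proof.
move=> s01 k0; rewrite mulrBr lerD2r /profile.
have q1 w := @profile_base R n.+1 k y w k0.
apply: powR_mid_concave => //.
- by rewrite (@lt_le_trans _ _ 1)// (le_trans (q1 x))// lerDl mulr_ge0// dotp_ge0.
- exact: (le_trans ler01 (q1 (x + z))).
- exact: (le_trans ler01 (q1 (x - z))).
rewrite (_ : x + z - y = (x - y) + z); last by rewrite addrAC.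
rewrite (_ : x - z - y = (x - y) + (- z)); last by rewrite addrAC.
rewrite !dotp_sqrD !(dotpNl, dotpNr); ring.
Qed.

Lemma sqdist_second_diff w x z :
  dotp (x + z - w) (x + z - w) + dotp (x - z - w) (x - z - w)
  - 2 * dotp (x - w) (x - w) = 2 * enorm z ^+ 2.
Proof.
rewrite (_ : x + z - w = (x - w) + z); last by rewrite addrAC.
rewrite (_ : x - z - w = (x - w) + (- z)); last by rewrite addrAC.
rewrite sqr_enorm !dotp_sqrD !(dotpNl, dotpNr); ring.
Qed.

End profile_bounds.

(** * The difference of two viscosity inequalities *)

Section comparison.
Context {R : realType} {n : nat}.
Implicit Types (u phi : 'rV[R]_n -> R) (x : 'rV[R]_n).

Definition bounded_lipschitz {V : zmodType} (N : V -> R) (K : R) (h : 'rV[R]_n -> V) :=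
  (forall x, N (h x) <= K) /\ forall x y, N (h x - h y) <= K * enorm (x - y).

(** The half-Laplacian of [u] at [x], with [u] replaced by [phi] near [x]. *)
Definition half_lap kappa u phi x : R := I_near kappa phi x + I_far kappa u x.

(** What subtracting the equation at [x2] from the equation at [x1] leaves: the
    nonlocal term is isolated and the rest is Lipschitz. *)
Definition difference_inequality u (C P : R) := forall phi1 phi2 x1 x2,
  is_C2 phi1 -> is_C2 phi2 ->
  (forall y, u y - phi1 y <= u x1 - phi1 x1) ->
  (forall y, u x2 - phi2 x2 <= u y - phi2 y) ->
  enorm (grad phi2 x2) <= P ->
  forall kappa, 0 < kappa < 1 ->
  half_lap kappa u phi1 x1 - half_lap kappa u phi2 x2 <=
  C * (enorm (x1 - x2) + enorm (grad phi1 x1 - grad phi2 x2)).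

Lemma quotient_difference (a1 a2 g1 g2 X Y delta lambda1 : R) :
  0 < lambda1 -> lambda1 <= a1 -> lambda1 <= a2 -> 0 < delta ->
  g1 + a1 * X < delta -> - delta < g2 + a2 * Y ->
  X - Y <= 2 * delta / lambda1 + `|g2 - g1| / lambda1
    + `|g2| * `|a1 - a2| / lambda1 ^+ 2.
Proof.
move=> l0 la1 la2 d0 h1 h2.
have a10 := lt_le_trans l0 la1; have a20 := lt_le_trans l0 la2.
have hX : X <= (delta - g1) / a1 by rewrite ler_pdivlMr// mulrC; lra.
have hY : (- delta - g2) / a2 <= Y by rewrite ler_pdivrMr// mulrC; lra.
apply: (@le_trans _ _ (delta / a1 + delta / a2 + (g2 - g1) / a1
    + g2 * (a1 - a2) / (a1 * a2))).
  have -> : delta / a1 + delta / a2 + (g2 - g1) / a1 + g2 * (a1 - a2) / (a1 * a2) =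
      (delta - g1) / a1 - (- delta - g2) / a2 by field; rewrite !gt_eqF.
  exact: lerB.
have inv a : lambda1 <= a -> 0 <= a^-1 <= lambda1^-1.
  move=> la; have a0 := lt_le_trans l0 la.
  by rewrite invr_ge0 (ltW a0)/= lef_pV2.
have /andP[i10 i1] := inv _ la1; have /andP[i20 i2] := inv _ la2.
apply: lerD; first apply: lerD.
- rewrite -mulrA mulrDl mul1r -mulrDr mulrDr.
  by apply: lerD; apply: ler_wpM2l => //; exact: ltW.
- apply: (@le_trans _ _ (`|g2 - g1| / a1)); first by rewrite ler_wpM2r// ler_norm.
  by rewrite ler_wpM2l.
- apply: (@le_trans _ _ (`|g2| * `|a1 - a2| / (a1 * a2))).
    rewrite ler_wpM2r ?invr_ge0 ?mulr_ge0 ?(ltW a10) ?(ltW a20)//.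
    by rewrite -normrM ler_norm.
  rewrite ler_wpM2l ?mulr_ge0// expr2 lef_pV2 ?posrE ?mulr_gt0//.
  by apply: ler_pM => //; exact: ltW.
Qed.

(** A control [al] that is almost optimal at [x2] is played at [x1], and an answer
    [be] that is almost optimal against it at [x1] is played at [x2].  Both inequalities then
    hold for the same pair of controls and can be divided by [a]. *)
Lemma isaacs_difference (A B : Type) (a c f : A -> B -> 'rV[R]_n -> R)
    (b : A -> B -> 'rV[R]_n -> 'rV[R]_n) u (K U L P lambda1 : R) :
  0 <= K -> 0 <= U -> 0 <= L -> 0 <= P -> 0 < lambda1 ->
  (forall al be, bounded_lipschitz Num.norm K (a al be)) ->
  (forall al be, bounded_lipschitz enorm K (b al be)) ->
  (forall al be, bounded_lipschitz Num.norm K (c al be)) ->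
  (forall al be, bounded_lipschitz Num.norm K (f al be)) ->
  (forall al be x, lambda1 < a al be x) ->
  (forall x, `|u x| <= U) -> (forall x y, `|u x - u y| <= L * enorm (x - y)) ->
  viscosity_subsolution a c f b u -> viscosity_supersolution a c f b u ->
  difference_inequality u
    (K * (1 + U + L + P) / lambda1 + K * (1 + U + P) * K / lambda1 ^+ 2) P.
Proof.
move=> K0 U0 L0 P0 l0 Ka Kb Kc Kf la uU uL [_ _ usub] [_ _ usup].
move=> phi1 phi2 x1 x2 C1 C2 max1 min2 gP kappa k01.
set p1 := grad phi1 x1; set p2 := grad phi2 x2; set d := enorm (x1 - x2).
apply/ler_addgt0Pl => e e0.
pose delta := e * lambda1 / 2.
have d0 : 0 < delta by rewrite divr_gt0// mulr_gt0.
have := usup phi2 x2 C2 min2 kappa k01.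
move=> /(lt_le_trans (_ : (- delta%:E < 0)%E)) => /(_ _) /ereal_sup_gt [|_ [al _ <-]].
  by rewrite oppe_lt0 lte_fin.
move=> hal.
have h2 be := lt_le_trans hal (ereal_inf_lbound (imageT _ be)).
have := usub phi1 x1 C1 max1 kappa k01.
move=> /(le_trans (ereal_sup_ubound (imageT _ al))) /le_lt_trans.
move=> /(_ delta%:E); rewrite lte_fin => /(_ d0) /ereal_inf_lt[_ [be _ <-]] h1.
have {}h2 := h2 be; move: h1 h2; rewrite -EFinN !lte_fin.
move=> h1 h2.
pose g phi x := f al be x + c al be x * u x + dotp (b al be x) (grad phi x).
have {}h1 : g phi1 x1 + a al be x1 * half_lap kappa u phi1 x1 < delta.
  by rewrite /half_lap mulrDr addrA.
have {}h2 : - delta < g phi2 x2 + a al be x2 * half_lap kappa u phi2 x2.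
  by rewrite /half_lap mulrDr addrA.
apply: le_trans (quotient_difference l0 (ltW (la _ _ _)) (ltW (la _ _ _)) d0 h1 h2) _.
rewrite (_ : 2 * delta / lambda1 = e); last by rewrite /delta; field; rewrite gt_eqF.
rewrite -addrA lerD2l mulrDl.
have dp0 := enorm_ge0 (p1 - p2); have dd0 : 0 <= d := enorm_ge0 _.
set S := d + enorm (p1 - p2); have S0 : 0 <= S by rewrite addr_ge0.
have Sd : d <= S by rewrite lerDl.
have [Ba La] := Ka al be; have [Bb Lb] := Kb al be.
have [Bc Lc] := Kc al be; have [Bf Lf] := Kf al be.
have hg : `|g phi2 x2 - g phi1 x1| <= K * (1 + U + L + P) * S.
  have -> : g phi2 x2 - g phi1 x1 =
      (f al be x2 - f al be x1) + (c al be x2 - c al be x1) * u x2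
      + c al be x1 * (u x2 - u x1)
      + dotp (b al be x2 - b al be x1) p2 + dotp (b al be x1) (p2 - p1).
    by rewrite /g !dotpDl !dotpDr !dotpNl !dotpNr -/p1 -/p2; ring.
  have hd : enorm (x2 - x1) = d by rewrite enormB.
  have t1 : `|f al be x2 - f al be x1| <= K * d by rewrite -hd.
  have t2 : `|(c al be x2 - c al be x1) * u x2| <= K * d * U.
    by rewrite normrM; apply: ler_pM => //; rewrite -hd.
  have t3 : `|c al be x1 * (u x2 - u x1)| <= K * (L * d).
    by rewrite normrM; apply: ler_pM => //; rewrite -hd.
  have t4 : `|dotp (b al be x2 - b al be x1) p2| <= K * d * P.
    apply: le_trans (dotp_le_enorm _ _) _.
    by apply: ler_pM; rewrite ?enorm_ge0// -hd.
  have t5 : `|dotp (b al be x1) (p2 - p1)| <= K * enorm (p1 - p2).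
    apply: le_trans (dotp_le_enorm _ _) _; rewrite (enormB p2 p1).
    by apply: ler_pM; rewrite ?enorm_ge0.
  apply: (@le_trans _ _ (K * d + K * d * U + K * (L * d) + K * d * P
      + K * enorm (p1 - p2))).
    do 4! [apply: le_trans (ler_normD _ _) _; apply: lerD => //].
  have Kdp : 0 <= K * enorm (p1 - p2) * (U + L + P) by rewrite !mulr_ge0 ?addr_ge0.
  by rewrite /S; lra.
have hg2 : `|g phi2 x2| <= K * (1 + U + P).
  have t1 : `|c al be x2 * u x2| <= K * U by rewrite normrM; apply: ler_pM.
  have t2 : `|dotp (b al be x2) p2| <= K * P.
    apply: le_trans (dotp_le_enorm _ _) _.
    by apply: ler_pM; rewrite ?enorm_ge0.
  apply: (@le_trans _ _ (K + K * U + K * P)); last lra.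
  by do 2! [apply: le_trans (ler_normD _ _) _; apply: lerD => //].
apply: lerD; rewrite [leRHS]mulrAC; apply: ler_wpM2r.
- by rewrite invr_ge0 ltW.
- exact: hg.
- by rewrite invr_ge0 sqr_ge0.
rewrite -[leRHS]mulrA; apply: ler_pM; [exact: normr_ge0|exact: normr_ge0|exact: hg2|].
exact: le_trans (La x1 x2) (ler_wpM2l K0 Sd).
Qed.

End comparison.

(** * Doubling of variables *)

Section doubling.
Context {R : realType} {n : nat}.
Implicit Types (u : 'rV[R]_n -> R) (x y : 'rV[R]_n).

Lemma profile_le_sqdist (s k Z : R) y x : 0 < s -> 0 < k -> 1 <= Z ->
  profile s k y x <= Z -> dotp (x - y) (x - y) <= Z `^ s^-1 / k.
Proof.
move=> s0 k0 Z1 h; rewrite ler_pdivlMr// mulrC.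
apply: (@le_trans _ _ (1 + k * dotp (x - y) (x - y))); first by rewrite lerDr.
have q1 := profile_base y x (ltW k0).
have q0 : 0 <= 1 + k * dotp (x - y) (x - y) by exact: le_trans ler01 q1.
rewrite (_ : 1 + k * dotp (x - y) (x - y) = profile s k y x `^ s^-1).
  by apply: ge0_ler_powR; rewrite ?nnegrE ?invr_ge0 ?powR_ge0 ?(ltW s0)// (le_trans ler01).
by rewrite /profile -powRrM divff ?gt_eqF// powRr1.
Qed.

Lemma continuous_fst_snd (T : topologicalType) :
  continuous (fun p : T * T => p.1) /\ continuous (fun p : T * T => p.2).
Proof. by split => p; [exact: cvg_fst|exact: cvg_snd]. Qed.

Lemma continuous_translate (h : 'rV[R]_n) : continuous (fun x => x + h).
Proof. by move=> x; apply: continuousD; [exact: cvg_id|exact: cst_continuous]. Qed.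

Lemma continuous_sqdist_pair :
  continuous (fun p : 'rV[R]_n * 'rV[R]_n => dotp (p.1 - p.2) (p.1 - p.2)).
Proof.
under eq_fun do rewrite -sqr_enorm expr2.
have h : continuous (fun p : 'rV[R]_n * 'rV[R]_n => enorm (p.1 - p.2)).
  move=> p; apply: (@continuous_comp _ _ _ (fun p : 'rV[R]_n * 'rV[R]_n => p.1 - p.2)).
    by apply: continuousB; [exact: cvg_fst|exact: cvg_snd].
  exact: continuous_enorm.
exact: continuous_mul.
Qed.

(** The profile confines [x] and the paraboloid confines [y], so the supremum is
    attained on a compact set. *)
Lemma doubling_max u (U T B s k : R) (h1 h2 x0 : 'rV[R]_n) :
  continuous u -> (forall x, `|u x| <= U) ->
  0 < T -> 0 < B -> 0 < s -> 0 < k ->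
  let Phi x y := u (x + h1) - u (y + h2) - T * profile s k x0 x
                 - B * dotp (x - y) (x - y) in
  exists xb yb, forall x y, Phi x y <= Phi xb yb.
Proof.
move=> cu uU T0 B0 s0 k0 Phi.
have U0 : 0 <= U by exact: le_trans (normr_ge0 _) (uU 0).
have uP x y : - (2 * U) <= u x - u y <= 2 * U.
  have := uU x; have := uU y; rewrite !ler_norml => /andP[? ?] /andP[? ?].
  by apply/andP; split; lra.
pose Z := 4 * U / T + 1.
have Z1 : 1 <= Z by rewrite lerDr divr_ge0 ?mulr_ge0// ltW.
pose r1 := Num.sqrt (Z `^ s^-1 / k).
pose r2 := Num.sqrt ((4 * U + T) / B).
pose rho := enorm x0 + r1 + r2.
have r10 : 0 <= r1 by exact: sqrtr_ge0.
have r20 : 0 <= r2 by exact: sqrtr_ge0.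
pose K := [set z : 'rV[R]_n | enorm z <= rho].
have K0 : K x0 by rewrite /K/= /rho -addrA lerDl addr_ge0.
have cK : compact (K `*` K) by apply: compact_setX; exact: compact_eball.
have Phi00 : - (2 * U) - T <= Phi x0 x0.
  have prof1 : profile s k x0 x0 = 1.
    by rewrite /profile subrr -(scale0r 0) dotpZl mul0r mulr0 addr0 powR1.
  have /andP[? _] := uP (x0 + h1) (x0 + h2).
  by rewrite /Phi prof1 mulr1 subrr -(scale0r 0) dotpZl mul0r mulr0 subr0; lra.
have cPhi : continuous (fun p : 'rV[R]_n * 'rV[R]_n => Phi p.1 p.2).
  have [c1 c2] := continuous_fst_snd 'rV[R]_n.
  have cN (F : 'rV[R]_n * 'rV[R]_n -> R) : continuous F -> continuous (fun p => - F p).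
    by move=> cF p; exact: (continuousN (cF p)).
  have cc (F : 'rV[R]_n -> R) (G : 'rV[R]_n * 'rV[R]_n -> 'rV[R]_n) :
      continuous F -> continuous G -> continuous (fun p => F (G p)).
    by move=> cF cG p; apply: (@continuous_comp _ _ _ G F); [exact: cG|exact: cF].
  have cs (r : R) : continuous (fun _ : 'rV[R]_n * 'rV[R]_n => r).
    by move=> p; exact: cst_continuous.
  have cp : continuous (profile s k x0).
    by apply: is_C1_continuous; case: (is_C2_profile s x0 (ltW k0)).
  apply: continuous_add; last first.
    by apply: (cN); apply: continuous_mul; [exact: cs|exact: continuous_sqdist_pair].
  apply: continuous_add; last by apply: (cN); apply: continuous_mul; [exact: cs|exact: cc].
  have ct (h : 'rV[R]_n) (G : 'rV[R]_n * 'rV[R]_n -> 'rV[R]_n) :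
      continuous G -> continuous (fun p => u (G p + h)).
    move=> cG; apply: (cc u (fun p => G p + h)) => // p.
    by apply: (@continuous_comp _ _ _ G (fun x => x + h)); [exact: cG|exact: continuous_translate].
  by apply: continuous_add; [exact: ct|apply: (cN); exact: ct].
have KK0 : K `*` K !=set0 by exists (x0, x0).
have [[xb yb] _ maxP] := compact_EVT_max KK0 cK (continuous_subspaceT cPhi).
exists xb, yb => x y; rewrite leNgt; apply/negP => lt_xy.
have h00 : Phi x0 x0 <= Phi xb yb by apply: (maxP (x0, x0)); rewrite inE.
have lo := le_lt_trans (le_trans Phi00 h00) lt_xy.
have /andP[_ up] := uP (x + h1) (y + h2).
have D0 := dotp_ge0 (x - y).
have P0 : 0 <= profile s k x0 x by exact: powR_ge0.
have hsum : T * profile s k x0 x + B * dotp (x - y) (x - y) <= 4 * U + T.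
  by move: lo; rewrite /Phi; lra.
have hx : enorm (x - x0) <= r1.
  rewrite /r1 /enorm ler_wsqrtr//; apply: profile_le_sqdist => //.
  rewrite /Z -(ler_pM2l T0) mulrDr mulr1 mulrCA divff ?gt_eqF// mulr1.
  by apply: le_trans hsum; rewrite lerDl mulr_ge0// ltW.
have hy : enorm (x - y) <= r2.
  rewrite /r2 /enorm ler_wsqrtr// ler_pdivlMr// mulrC.
  by apply: le_trans hsum; rewrite lerDr mulr_ge0// ltW.
have nx : enorm x <= enorm x0 + r1.
  by rewrite -(subrK x0 x) (le_trans (ler_enormD _ _))// addrC lerD2l.
have ny : enorm y <= rho.
  rewrite -(subrK x y) (le_trans (ler_enormD _ _))// enormB /rho addrC.
  exact: lerD.
have Kxy : (K `*` K) (x, y).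
  by split => //=; rewrite /K/= (le_trans nx)// /rho lerDl.
have := maxP (x, y); rewrite inE => /(_ Kxy) /=.
by rewrite leNgt lt_xy.
Qed.

End doubling.

(** * Improvement of oscillation *)

Lemma exists_small (R : realType) (A B : R) : 0 <= A -> 0 < B ->
  exists2 e, 0 < e & forall e', 0 < e' -> e' <= e -> A * e' < B.
Proof.
move=> A0 B0; have A1 : 0 < A + 1 by rewrite ltr_wpDl.
exists (B / (A + 1)); first by rewrite divr_gt0.
move=> e' e'0 ee; apply: (@le_lt_trans _ _ (A * (B / (A + 1)))).
  by rewrite ler_wpM2l.
by rewrite mulrA ltr_pdivrMr// mulrDr mulr1 (mulrC B) ltrDl.
Qed.

Section improvement.
Context {R : realType} {n : nat}.
Implicit Types (x y z : 'rV[R]_n.+1).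
Local Notation mu := (lebesgue_rV n.+1).
Local Notation N := (@moment_const R n).
Local Notation c := (c_half R n.+1).

Lemma far_difference (u : 'rV[R]_n.+1 -> R) (U kappa : R) x1 x2 :
  continuous u -> (forall x, `|u x| <= U) -> 0 < kappa ->
  I_far kappa u x1 - I_far kappa u x2 =
  c * \int[mu]_(z in [set z | kappa <= enorm z])
        (((u (x2 + z) - u x2) - (u (x1 + z) - u x1)) * jump_kernel z).
Proof.
move=> cu uU k0; set A := [set z | _].
have iq x : mu.-integrable A (EFin \o diff_quot u x).
  apply: (@integrable_bounded_far _ _ (fun z => u (x + z) - u x) (U + U)) => //.
    apply: measurable_funB => //.
    apply: (measurableT_comp (continuous_rV_measurable cu)).
    rewrite (_ : +%R x = fun z => x + 1 *: z); first exact: measurable_rV_affine.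
    by apply/funext => z; rewrite scale1r.
  by move=> z; rewrite (le_trans (ler_normB _ _))// lerD.
rewrite /I_far !mulNr opprK addrC -mulrBr; congr (_ * _).
rewrite -RintegralB//; last exact: measurable_eballC.
by apply: eq_Rintegral => z _; rewrite [RHS]mulrBl.
Qed.

Lemma measurable_sublevel (u : 'rV[R]_n.+1 -> R) x0 (r m : R) : continuous u ->
  measurable [set x | enorm (x - x0) < r /\ u x <= m].
Proof.
move=> cu; rewrite (_ : [set x | _] =
    (fun x => - x0 + 1 *: x) @^-1` [set z | enorm z < r] `&` u @^-1` `]-oo, m]%classic).
  apply: measurableI; rewrite -[X in measurable X]setTI.
    by apply: measurable_rV_affine => //; exact: measurable_eball.
  by apply: (continuous_rV_measurable cu).
by apply/seteqP; split=> x /=; rewrite in_itv/= scale1r addrC.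
Qed.

(** The deficit [D z] of the doubled function at [(xb + z, yb + z)], relative to its
    maximum, is nonnegative and free of the penalty; it is at least [T / 4] where
    [W (xb + z) <= m].  The integrand is [D z] minus an increment of the profile, and the
    even part of the latter is of order [s T growth]. *)
Lemma far_gain (u : 'rV[R]_n.+1 -> R) (U L s r m T b kappa m0 : R)
    (h1 h2 x0 xb yb : 'rV[R]_n.+1) :
  let W x := u (x + h1) - u (x + h2) in
  let Phi x y := u (x + h1) - u (y + h2) - 2 * T * profile s (r ^- 2) x0 x
                 - b * dotp (x - y) (x - y) in
  continuous u -> (forall x, `|u x| <= U) ->
  (forall x y, `|u x - u y| <= L * enorm (x - y)) ->
  0 < s <= 8^-1 -> 0 < r -> 0 < T -> 0 < b -> 0 < kappa ->
  (forall x y, Phi x y <= Phi xb yb) ->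
  enorm (xb - x0) < r -> m - 5 / 4 * T <= Phi xb yb ->
  L * enorm (xb - yb) <= T / 4 ->
  (m0%:E <= mu [set x | (enorm (x - x0) < r)%R /\ (W x <= m)%R])%E ->
  T / 4 * ((m0 - (2 * kappa) ^+ n.+1) / (2 * r) ^+ n.+2) - 128 * T * s * (2 * N / r) <=
  2 * \int[mu]_(z in [set z | kappa <= enorm z])
    (((u (yb + h2 + z) - u (yb + h2)) - (u (xb + h1 + z) - u (xb + h1))) * jump_kernel z).
Proof.
move=> W Phi cu uU uL s8 r0 T0 b0 k0 maxP xr lowP Ld m0S.
have [s0 s18] := andP s8; have s01 : 0 < s < 1 by rewrite s0/=; lra.
have rk : 0 <= r ^- 2 by rewrite invr_ge0 sqr_ge0.
pose S0 := [set x | enorm (x - x0) < r /\ W x <= m].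
have cW : continuous W.
  have ct h : continuous (fun x => u (x + h)).
    move=> x; apply: (@continuous_comp _ _ _ (fun x => x + h) u); last exact: cu.
    exact: continuous_translate.
  by apply: continuous_add => // x; exact: (continuousN (ct h2 x)).
have mS0 : measurable S0 by exact: measurable_sublevel.
have mu_ h x : measurable_fun setT (fun z => u (x + h + z)).
  apply: (measurableT_comp (continuous_rV_measurable cu)).
  rewrite (_ : +%R (x + h) = fun z => (x + h) + 1 *: z).
    exact: measurable_rV_affine.
  by apply/funext => z; rewrite scale1r.
pose S := (fun z => xb + 1 *: z) @^-1` S0.
pose B z := (u (yb + h2 + z) - u (yb + h2)) - (u (xb + h1 + z) - u (xb + h1)).
apply: (@far_lower R n B S (4 * U) r kappa (T / 4) (128 * T * s) m0 r0 k0).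
- by rewrite divr_ge0// ltW.
- by rewrite !mulr_ge0// ltW.
- by apply: measurable_funB; apply: measurable_funB => //.
- move=> z; rewrite (_ : 4 * U = (U + U) + (U + U)); last by ring.
  apply: le_trans (ler_normB _ _) _; apply: lerD;
    by apply: le_trans (ler_normB _ _) _; apply: lerD.
- by rewrite -[X in measurable X]setTI; apply: measurable_rV_affine.
- move=> z [/=]; rewrite scale1r => zr _.
  rewrite (_ : z = (xb + z - x0) - (xb - x0)); last first.
    by rewrite opprB addrA subrK addrAC subrr add0r.
  by rewrite (le_lt_trans (ler_enormD _ _))// enormN mulr2n mulrDl mul1r ltrD.
- by rewrite /S lebesgue_rV_affine ?normr1.
move=> z _.
pose P := profile s (r ^- 2) x0.
pose D z := Phi xb yb - Phi (xb + z) (yb + z).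
have D0 w : 0 <= D w by rewrite subr_ge0.
have shift (w h v : 'rV[R]_n.+1) : w + v + h = w + h + v by rewrite addrAC.
have BD w : B w = D w - 2 * T * (P (xb + w) - P xb).
  rewrite /B /D /Phi -/P.
  rewrite (_ : xb + w - (yb + w) = xb - yb); last by rewrite opprD addrACA subrr addr0.
  by rewrite (shift xb h1 w) (shift yb h2 w); ring.
have DS : T / 4 * \1_S z <= D z.
  rewrite indicE; case: (boolP (z \in S)) => [/set_mem|_]; last by rewrite mulr0.
  rewrite /S /S0 /= scale1r mulr1 => -[_ Wm].
  have P1 : 1 <= P (xb + z).
    have q1 := profile_base x0 (xb + z) rk.
    by rewrite -[leLHS](@powRr0 _ (1 + r ^- 2 * dotp (xb + z - x0) (xb + z - x0)))
      ler_powR// ltW.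
  have TP : 2 * T * 1 <= 2 * T * P (xb + z) by rewrite ler_wpM2l// mulr_ge0// ltW.
  have uy := uL (xb + z + h2) (yb + z + h2).
  rewrite (_ : _ - (yb + z + h2) = xb - yb) in uy; last first.
    by rewrite !opprD addrACA subrr addr0 addrACA subrr addr0.
  have {}uy := le_trans (ler_norm _) uy.
  have bd : 0 <= b * dotp (xb + z - (yb + z)) (xb + z - (yb + z)).
    by rewrite mulr_ge0 ?dotp_ge0// ltW.
  have PhiW : Phi (xb + z) (yb + z) <= W (xb + z) + L * enorm (xb - yb)
      - 2 * T * P (xb + z).
    by rewrite /Phi /W -/P; lra.
  by rewrite /D; lra.
have sd : P (xb + z) + P (xb - z) - 2 * P xb <= 64 * s * growth r z.
  apply: le_trans (profile_second_diff _ _ _ s01 rk) _.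
  have q1 := profile_base x0 xb rk.
  have q2 : 1 + r ^- 2 * dotp (xb - x0) (xb - x0) <= 2.
    rewrite -sqr_enorm (_ : 2 = 1 + 1)// lerD2l mulrC ler_pdivrMr ?exprn_gt0// mul1r.
    by rewrite lerXn2r ?nnegrE ?enorm_ge0// ltW.
  have h0 : 0 <= r ^- 2 * dotp z z by rewrite mulr_ge0// dotp_ge0.
  have q12 : 1 <= 1 + r ^- 2 * dotp (xb - x0) (xb - x0) <= 2 by apply/andP.
  have := powR_incr_le s01 q12 h0; have := growth_bound z s8 r0.
  by rewrite /profile; lra.
have T2 : 2 * T * (P (xb + z) + P (xb - z) - 2 * P xb) <= 2 * T * (64 * s * growth r z).
  by rewrite ler_wpM2l// mulr_ge0// ltW.
rewrite !BD.
have := D0 (- z); lra.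
Qed.

End improvement.

Section test_functions.
Context {R : realType} {n : nat}.
Implicit Types (x y z : 'rV[R]_n.+1).

Lemma profile_translate (s k : R) x0 h x :
  profile s k (x0 + h) x = profile s k x0 (x - h).
Proof. by rewrite /profile opprD addrA addrAC. Qed.

Lemma is_C2_continuous (f : 'rV[R]_n.+1 -> R) : is_C2 f -> continuous f.
Proof. by move=> [Cf _]; exact: is_C1_continuous. Qed.

Lemma test_fun_second_diff_le (A s k b : R) y0 w x z : 0 < s < 1 -> 0 <= k -> 0 <= A ->
  0 <= b ->
  test_fun A s k y0 b w (x + z) + test_fun A s k y0 b w (x - z)
    - 2 * test_fun A s k y0 b w x <= 2 * (A * s * k + b) * enorm z ^+ 2.
Proof.
move=> s01 k0 A0 b0; rewrite /test_fun.
have q1 := profile_base y0 x k0.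
have h0 : 0 <= k * dotp z z by rewrite mulr_ge0// dotp_ge0.
have h : profile s k y0 (x + z) + profile s k y0 (x - z) - 2 * profile s k y0 x <=
    2 * (s * (k * enorm z ^+ 2)).
  apply: le_trans (profile_second_diff y0 x z s01 k0) _; rewrite sqr_enorm.
  by rewrite ler_wpM2l//; exact: powR_incr_le_tangent.
have comb (p1 p2 p d1 d2 d0 E : R) : p1 + p2 - 2 * p <= 2 * (s * (k * E)) ->
    d1 + d2 - 2 * d0 = 2 * E ->
    A * p1 + b * d1 + (A * p2 + b * d2) - 2 * (A * p + b * d0) <= 2 * (A * s * k + b) * E.
  move=> hp hd; have := ler_wpM2l A0 hp; have := congr1 ( *%R b) hd; lra.
exact: (comb _ _ _ _ _ _ _ h (sqdist_second_diff w x z)).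
Qed.

Lemma paraboloid_second_diff (s b : R) y0 w x z :
  test_fun 0 s 0 y0 b w (x + z) + test_fun 0 s 0 y0 b w (x - z)
    - 2 * test_fun 0 s 0 y0 b w x = 2 * b * enorm z ^+ 2.
Proof.
rewrite /test_fun !mul0r !add0r mulrAC -(sqdist_second_diff w x z).
rewrite (mulrC _ b) mulrBr mulrDr; congr (_ - _); exact: mulrCA.
Qed.

End test_functions.

(** The gain is [3/8] of [c beta Y] and the errors add up to [5/16] of it. *)
Lemma improvement_arith (R : realFieldType)
    (c beta Y s C1 t L e S near1 near2 far1 far2 FI Lam1 b N kappa : R) :
  0 < c * beta * Y / 16 ->
  - (c * (Lam1 * (N * kappa))) <= near1 -> near2 <= c * (b * (N * kappa)) ->
  c * (Lam1 + b) * N * kappa < c * beta * Y / 16 ->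
  far1 - far2 = c * FI -> c * (3 / 4 * (beta * Y)) <= c * (2 * FI) ->
  near1 + far1 - (near2 + far2) <= S -> S <= C1 * (t + L * e + 4 * s * Y) ->
  C1 * t <= c * beta * Y / 16 -> C1 * L * e < c * beta * Y / 16 ->
  8 * C1 * s * Y <= c * beta / 4 * Y -> False.
Proof. lra. Qed.

Section improvement.
Context {R : realType} {n : nat}.
Implicit Types (x y z : 'rV[R]_n.+1).
Local Notation mu := (lebesgue_rV n.+1).
Local Notation N := (@moment_const R n).
Local Notation c := (c_half R n.+1).

(** If the conclusion failed at [x1], the doubled function would exceed at [(x1, x1)]
    all its values with [x] outside the ball, so its maximum point lies inside, where the gain
    from the set [W <= m] contradicts the difference inequality. *)
Lemma improvement (u : 'rV[R]_n.+1 -> R) (U L C1 s r m T c0 : R)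
    (h1 h2 x0 : 'rV[R]_n.+1) :
  let W x := u (x + h1) - u (x + h2) in
  let beta := c0 / 2 ^+ (n + 5) in
  continuous u -> (forall x, `|u x| <= U) ->
  0 < L -> (forall x y, `|u x - u y| <= L * enorm (x - y)) ->
  0 <= C1 -> difference_inequality u C1 (2 * L) ->
  0 < c0 -> 0 < s <= 8^-1 -> 256 * s * N <= beta / 4 -> 8 * C1 * s <= c * beta / 4 ->
  0 < r -> 0 < T -> 16 * C1 * enorm (h1 - h2) * r <= c * beta * T ->
  (forall x, r <= enorm (x - x0) ->
    W x <= m + T - 2 * T * 2 `^ s + 2 * T * profile s (r ^- 2) x0 x) ->
  ((c0 * r ^+ n.+1)%:E <= mu [set x | (enorm (x - x0) < r)%R /\ (W x <= m)%R])%E ->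
  forall x, enorm (x - x0) <= r / 2 ->
    W x <= m + T - 2 * T * 2 `^ s + 2 * T * (5 / 4) `^ s.
Proof.
move=> W beta cu uU L0 uL C10 diffu c00 s8 sN sC r0 T0 ET H1 H2 x1 x1r.
have [s0 s18] := andP s8; have s01 : 0 < s < 1 by rewrite s0/=; lra.
have rk0 : 0 < r ^- 2 by rewrite invr_gt0 exprn_gt0.
have beta0 : 0 < beta by rewrite divr_gt0// exprn_gt0.
have c_0 : 0 < c by exact: c_half_gt0.
pose P := profile s (r ^- 2) x0.
pose M0 := m + T - 2 * T * 2 `^ s.
rewrite leNgt; apply/negP => gapx.
have P54 : P x1 <= (5 / 4) `^ s.
  rewrite /P /profile ge0_ler_powR ?nnegrE ?(ltW s0)//.
  - by rewrite addr_ge0 ?mulr_ge0 ?dotp_ge0// ltW.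
  - rewrite -sqr_enorm mulrC -lerBrDl ler_pdivrMr ?exprn_gt0//.
    apply: (@le_trans _ _ ((r / 2) ^+ 2)); last by rewrite exprMn; lra.
    by rewrite lerXn2r ?nnegrE ?enorm_ge0 ?divr_ge0// ltW.
pose g := W x1 - 2 * T * P x1 - M0.
have g0 : 0 < g.
  have : 2 * T * P x1 <= 2 * T * (5 / 4) `^ s by rewrite ler_wpM2l// mulr_ge0// ltW.
  by rewrite /g /M0; lra.
pose Y := T / r; have Y0 : 0 < Y by rewrite divr_gt0.
have cbY : 0 < c * beta * Y / 16 := divr_gt0 (mulr_gt0 (mulr_gt0 c_0 beta0) Y0) (ltr0n R 16).
have [e e0 [he1 he2 he3]] : exists2 e, 0 < e &
    [/\ L ^+ 2 * e < g, L ^+ 2 * e < T / 4 & C1 * L * e < c * beta * Y / 16].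
  have [e1 e10 he1] := exists_small (sqr_ge0 L) g0.
  have [e2 e20 he2] := exists_small (sqr_ge0 L) (divr_gt0 T0 (ltr0n R 4)).
  have [e3 e30 he3] := exists_small (mulr_ge0 C10 (ltW L0)) cbY.
  have e0 : 0 < Num.min e1 (Num.min e2 e3) by rewrite !lt_min e10 e20.
  exists (Num.min e1 (Num.min e2 e3)) => //; split.
  - by apply: he1; rewrite // ge_min lexx.
  - by apply: he2; rewrite // !ge_min lexx orbT.
  - by apply: he3; rewrite // !ge_min lexx !orbT.
pose b := e^-1; have b0 : 0 < b by rewrite invr_gt0.
have [xb [yb maxP]] := @doubling_max _ _ u U (2 * T) b s (r ^- 2) h1 h2 x0 cu uU
  (mulr_gt0 (ltr0n R 2) T0) b0 s0 rk0.
pose Phi x y := u (x + h1) - u (y + h2) - 2 * T * P x - b * dotp (x - y) (x - y).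
have {}maxP x y : Phi x y <= Phi xb yb by exact: maxP.
pose d := enorm (xb - yb); have d0 : 0 <= d by exact: enorm_ge0.
(* comparing with the diagonal bounds the penalty, hence the gap *)
have db : b * d <= L.
  have [->|dn0] := eqVneq d 0; first by rewrite mulr0 ltW.
  have dp : 0 < d by rewrite lt_neqAle eq_sym dn0.
  have := maxP xb xb; rewrite /Phi subrr -(scale0r 0) dotpZl mul0r mulr0.
  have := le_trans (ler_norm _) (uL (xb + h2) (yb + h2)).
  rewrite (_ : xb + h2 - (yb + h2) = xb - yb); last by rewrite opprD addrACA subrr addr0.
  rewrite -/d -sqr_enorm -/d => h h'.
  have : b * d * d <= L * d by rewrite -mulrA -expr2; lra.
  by rewrite ler_pM2r.
have dL : d <= L * e by rewrite -ler_pdivrMr// mulrC.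
have Ld : L * d <= L ^+ 2 * e by rewrite expr2 -mulrA ler_wpM2l// ltW.
have PhiM0 : M0 + g <= Phi xb yb.
  apply: le_trans (maxP x1 x1); rewrite /Phi subrr -(scale0r 0) dotpZl mul0r mulr0 subr0.
  by rewrite /g /W; lra.
have xbr : enorm (xb - x0) < r.
  rewrite ltNge; apply/negP => /H1; rewrite -/M0 -/(P xb) => Wxb.
  have := le_trans (ler_norm _) (uL (xb + h2) (yb + h2)).
  rewrite (_ : xb + h2 - (yb + h2) = xb - yb); last by rewrite opprD addrACA subrr addr0.
  rewrite -/d => h.
  have bdd : 0 <= b * dotp (xb - yb) (xb - yb) by rewrite mulr_ge0 ?dotp_ge0// ltW.
  by move: PhiM0 Wxb; rewrite /Phi /W; lra.
have [p21 p22] := powR2_bounds s8.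
have lowP : m - 5 / 4 * T <= Phi xb yb.
  have : 2 * T * 2 `^ s <= 2 * T * (1 + s) by rewrite ler_wpM2l// mulr_ge0// ltW.
  have : T * s <= T * 8^-1 by rewrite ler_wpM2l// ltW.
  by move: PhiM0; rewrite /M0; lra.
pose phi1 := test_fun (2 * T) s (r ^- 2) (x0 + h1) b (yb + h1).
pose phi2 := test_fun 0 s 0 0 (- b) (xb + h2).
pose X1 := xb + h1; pose X2 := yb + h2.
have C2phi1 : is_C2 phi1 by apply: is_C2_test_fun; exact: ltW.
have C2phi2 : is_C2 phi2 by exact: is_C2_test_fun.
have max1 y : u y - phi1 y <= u X1 - phi1 X1.
  have := maxP (y - h1) yb; rewrite /Phi /phi1 /test_fun !profile_translate -/P.
  rewrite subrK -/X1 (_ : X1 - h1 = xb); last by rewrite /X1 addrK.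
  have -> : y - (yb + h1) = y - h1 - yb by rewrite opprD addrA addrAC.
  have -> : X1 - (yb + h1) = xb - yb by rewrite /X1 opprD addrACA subrr addr0.
  lra.
have min2 y : u X2 - phi2 X2 <= u y - phi2 y.
  have := maxP xb (y - h2); rewrite /Phi /phi2 /test_fun !mul0r !add0r subrK.
  rewrite (_ : xb - (y - h2) = - (y - (xb + h2))); last first.
    by rewrite !opprD !opprK addrCA addrA.
  rewrite (_ : X2 - (xb + h2) = - (xb - yb)); last first.
    by rewrite /X2 opprD addrACA subrr addr0 opprB.
  rewrite !(dotpNl, dotpNr) !opprK; lra.
have grad2 : grad phi2 X2 = (2 * b) *: (xb - yb).
  rewrite /phi2 grad_test_fun// !mulr0 !mul0r scale0r add0r /X2.
  rewrite (_ : yb + h2 - (xb + h2) = - (xb - yb)); last first.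
    by rewrite opprD addrACA subrr addr0 opprB.
  by rewrite scalerN mulrN scaleNr opprK.
pose q := 1 + r ^- 2 * dotp (xb - x0) (xb - x0).
have grad1 : grad phi1 X1 - grad phi2 X2 =
    (2 * (2 * T) * s * r ^- 2 * q `^ (s - 1)) *: (xb - x0).
  rewrite grad2 /phi1 grad_test_fun ?(ltW rk0)// /X1.
  have -> : xb + h1 - (x0 + h1) = xb - x0 by rewrite opprD addrACA subrr addr0.
  have -> : xb + h1 - (yb + h1) = xb - yb by rewrite opprD addrACA subrr addr0.
  by rewrite addrK.
have ng2 : enorm (grad phi2 X2) <= 2 * L.
  by rewrite grad2 enormZ -/d ger0_norm ?mulr_ge0 ?(ltW b0)// -mulrA ler_wpM2l.
have q1 : 1 <= q by exact: profile_base (ltW rk0).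
have ng1 : enorm (grad phi1 X1 - grad phi2 X2) <= 4 * s * Y.
  have qs : 0 <= q `^ (s - 1) <= 1.
    rewrite powR_ge0/= -[leRHS](powRr0 q) ler_powR//; lra.
  have [qs0 qs1] := andP qs.
  rewrite grad1 enormZ ger0_norm; last first.
    by rewrite !mulr_ge0 ?(ltW T0) ?(ltW s0) ?(ltW rk0).
  rewrite (_ : 4 * s * Y = 2 * (2 * T) * s * r ^- 2 * 1 * r); last first.
    by rewrite /Y; field; rewrite gt_eqF.
  apply: ler_pM; rewrite ?enorm_ge0 ?(ltW xbr)//.
    by rewrite !mulr_ge0 ?(ltW T0) ?(ltW s0) ?(ltW rk0).
  by rewrite ler_wpM2l// !mulr_ge0 ?(ltW T0) ?(ltW s0) ?(ltW rk0).
have nX : enorm (X1 - X2) <= enorm (h1 - h2) + d.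
  rewrite /X1 /X2 opprD addrACA addrC; exact: ler_enormD.
(* [kappa] makes the singular parts negligible, and cutting out the ball of radius
   [kappa] costs at most half of the set where [W <= m] *)
pose Lam := 2 * T * s * r ^- 2 + b + b.
have Lam0 : 0 <= 2 * T * s * r ^- 2 by rewrite !mulr_ge0 ?(ltW T0) ?(ltW s0) ?(ltW rk0).
have cNL : 0 <= c * Lam * N.
  apply: mulr_ge0; last exact: moment_const_ge0.
  exact: (mulr_ge0 (ltW c_0) (addr_ge0 (addr_ge0 Lam0 (ltW b0)) (ltW b0))).
have m00 : 0 < c0 * r ^+ n.+1 / 2 by rewrite divr_gt0// mulr_gt0// exprn_gt0.
have [kappa k0 [hk1 hk2 k4]] : exists2 kappa, 0 < kappa &
    [/\ c * Lam * N * kappa < c * beta * Y / 16, 2 * kappa < c0 * r ^+ n.+1 / 2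
      & kappa <= 4^-1].
  have [k1 k10 hk1] := exists_small cNL cbY.
  have [k2 k20 hk2] := exists_small (ler0n R 2) m00.
  have k0 : 0 < Num.min k1 (Num.min k2 4^-1) by rewrite !lt_min k10 k20/=.
  exists (Num.min k1 (Num.min k2 4^-1)) => //; split.
  - by apply: hk1; rewrite // ge_min lexx.
  - by apply: hk2; rewrite // !ge_min lexx orbT.
  - by rewrite !ge_min lexx !orbT.
have k01 : 0 < kappa < 1 by rewrite k0/= (le_lt_trans k4)// invf_lt1// ltr1n.
have hk2' : (2 * kappa) ^+ n.+1 <= c0 * r ^+ n.+1 / 2.
  apply: le_trans (ltW hk2); rewrite exprS -[leRHS]mulr1 ler_wpM2l ?mulr_ge0 ?(ltW k0)//.
  by rewrite exprn_ile1// ?mulr_ge0 ?(ltW k0)//; move: k4; clear; lra.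
have near1 := @I_near_ge R n phi1 X1 (2 * T * s * r ^- 2 + b) kappa (ltW c_0)
  (is_C2_continuous C2phi1) (addr_ge0 Lam0 (ltW b0)).
have {}near1 := near1 (fun z => test_fun_second_diff_le _ _ _ _ s01 (ltW rk0)
  (mulr_ge0 (ler0n R 2) (ltW T0)) (ltW b0)) k0.
have near2 : I_near kappa phi2 X2 <= c * (b * (N * kappa)).
  apply: I_near_le; rewrite ?(ltW c_0) ?(ltW b0)//; first exact: is_C2_continuous.
  by move=> z; rewrite paraboloid_second_diff mulrN mulNr.
have Ld4 : L * enorm (xb - yb) <= T / 4 by exact: le_trans Ld (ltW he2).
have far := @far_gain R n u U L s r m T b kappa (c0 * r ^+ n.+1) h1 h2 x0 xb yb cu uU uL
  s8 r0 T0 b0 k0 maxP xbr lowP Ld4 H2.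
have fardiff := @far_difference R n u U kappa X1 X2 cu uU k0.
have cmp := diffu phi1 phi2 X1 X2 C2phi1 C2phi2 max1 min2 ng2 kappa k01.
move: far fardiff; rewrite -/X1 -/X2; set FI := Rintegral _ _ _ => far fardiff.
have gain : T / 4 * ((c0 * r ^+ n.+1 - (2 * kappa) ^+ n.+1) / (2 * r) ^+ n.+2) >= beta * Y.
  have -> : beta * Y = T / 4 * ((c0 * r ^+ n.+1 / 2) / (2 * r) ^+ n.+2).
    rewrite /beta /Y exprMn (exprS r n.+1) (_ : (n + 5 = 3 + n.+2)%N); last by rewrite addnC.
    by rewrite exprD; field; rewrite ?gt_eqF ?exprn_gt0.
  apply: ler_wpM2l; first by rewrite divr_ge0// ltW.
  apply: ler_wpM2r; first by rewrite invr_ge0 exprn_ge0// mulr_ge0// ltW.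
  by move: hk2'; clear; set p := c0 * _; set v := (2 * kappa) ^+ _; lra.
have FIlow : 3 / 4 * (beta * Y) <= 2 * FI.
  apply: le_trans far; have : 256 * s * N * Y <= beta / 4 * Y by rewrite ler_wpM2r// ltW.
  have -> : 256 * s * N * Y = 128 * T * s * (2 * N / r) by rewrite /Y; ring.
  by move: gain; clear; set v := T / 4 * _; set w := 128 * T * s * _; set p := beta; lra.
have cFI : c * (3 / 4 * (beta * Y)) <= c * (2 * FI) by rewrite ler_wpM2l// ltW.
have up : C1 * (enorm (X1 - X2) + enorm (grad phi1 X1 - grad phi2 X2)) <=
    C1 * (enorm (h1 - h2) + L * e + 4 * s * Y).
  apply: ler_wpM2l => //; apply: lerD => //.
  by apply: le_trans nX _; rewrite lerD2l.
have up1 : C1 * enorm (h1 - h2) <= c * beta * Y / 16.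
  have : 16 * C1 * enorm (h1 - h2) <= c * beta * Y by rewrite /Y mulrA ler_pdivlMr.
  by clear; set p := enorm _; set v := c * beta * Y; lra.
have up2 : 8 * C1 * s * Y <= c * beta / 4 * Y by rewrite ler_wpM2r// ltW.
exact: (improvement_arith cbY near1 near2 hk1 fardiff cFI cmp up up1 he3 up2).
Qed.

End improvement.

(** * Holder continuity of increments *)

Section alternative.
Context {R : realType} {n : nat}.
Implicit Types (x y z : 'rV[R]_n.+1).
Local Notation mu := (lebesgue_rV n.+1).

(** Half the volume of the cube of side [2 / (n + 1)], which lies in the unit ball. *)
Definition half_cube : R := (2 / n.+1%:R) ^+ n.+1 / 2.

Lemma half_cube_gt0 : 0 < half_cube.
Proof. by rewrite divr_gt0// exprn_gt0// divr_gt0// ltr0n. Qed.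

(** The two sets cover a cube inscribed in the ball. *)
Lemma sublevel_alternative (W : 'rV[R]_n.+1 -> R) x0 (r m : R) : continuous W -> 0 < r ->
  ((half_cube * r ^+ n.+1)%:E <= mu [set x | (enorm (x - x0) < r)%R /\ (W x <= m)%R])%E \/
  ((half_cube * r ^+ n.+1)%:E <= mu [set x | (enorm (x - x0) < r)%R /\ (- W x <= - m)%R])%E.
Proof.
move=> cW r0; set S1 := [set x | _]; set S2 := [set x | enorm (x - x0) < r /\ - W x <= - m].
have mS1 : measurable S1 by exact: measurable_sublevel.
have mS2 : measurable S2.
  by apply: (@measurable_sublevel _ _ (fun x => - W x)) => x; exact: (continuousN (cW x)).
pose d : R := r / n.+1%:R; have d0 : 0 < d by rewrite divr_gt0// ltr0n.
pose a i : set (measurableTypeR R) := `](x0 0 i - d), (x0 0 i + d)[%classic.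
have ma i : measurable (a i) by exact: measurable_itv.
have muQ : mu (box a) = (2 * (half_cube * r ^+ n.+1))%:E.
  rewrite /box (lebesgue_rV_box ma) (_ : 2 * _ = (2 * d) ^+ n.+1); last first.
    rewrite /half_cube /d (_ : 2 * (r / n.+1%:R) = 2 / n.+1%:R * r); last by ring.
    by rewrite (exprMn _ (2 / _)); field.
  rewrite (eq_bigr (fun=> (2 * d)%:E)); last first.
    move=> i _; rewrite lebesgue_measure_itv/= lte_fin ltrD2l gtrN//.
    by rewrite -EFinB; congr EFin; ring.
  elim: n.+1 => [|k ih]; first by rewrite big_ord0 expr0.
  by rewrite big_ord_recl ih exprS EFinM.
have QS : box a `<=` S1 `|` S2.
  move=> x ax; have xr : enorm (x - x0) < r.
    apply: le_lt_trans (enorm_le_sum _) _.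
    rewrite (_ : r = \sum_(i < n.+1) d); last first.
      by rewrite sumr_const card_ord /d -[RHS]mulr_natr divfK ?pnatr_eq0.
    apply: ltr_sum => [|i _]; first by apply/hasP; exists ord0; rewrite ?mem_index_enum.
    have := ax i; rewrite /a /= in_itv/= => /andP[? ?].
    by rewrite !mxE ltr_norml; lra.
  by case: (leP (W x) m) => [|/ltW] h; [left|right]; split; rewrite // lerN2.
have h : (mu (box a) <= mu S1 + mu S2)%E.
  apply: le_trans (measureU2 _ mS1 mS2).
  by apply: le_measure; rewrite ?inE//; [exact: measurable_box|exact: measurableU].
case: (leP (half_cube * r ^+ n.+1)%:E (mu S1)) => [|l1]; first by left.
case: (leP (half_cube * r ^+ n.+1)%:E (mu S2)) => [|l2]; first by right.
have := le_lt_trans h (lteD l1 l2); rewrite muQ -EFinD lte_fin.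
by rewrite mulr_natl mulr2n ltxx.
Qed.

End alternative.

Section oscillation.
Context {R : realType} {n : nat}.
Implicit Types (x y z : 'rV[R]_n.+1).

Lemma powR_invpow4 (sigma : R) k : ((4 ^+ k)^-1) `^ sigma = (4 `^ (- sigma)) ^+ k.
Proof.
rewrite -powR_mulrn ?powR_ge0// -powRrM -powR_invn// -powRrM; congr (_ `^ _); ring.
Qed.

(** Tails at dyadic scales are dominated by the profile: [lam^-i] grows slower
    than [(4 * 16^(i-1))^s]. *)
Lemma tail_growth (s lam q : R) (i : nat) : 0 < s <= 8^-1 -> 0 < lam ->
  lam^-1 <= 2 `^ s -> 1 + 4 * 16 ^+ i <= q ->
  lam^-1 ^+ i.+1 - 1 <= q `^ s - 2 `^ s.
Proof.
move=> s8 l0 hl hq; have [s0 _] := andP s8; have [p1 _] := powR2_bounds s8.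
have q2 : 2 * 2 ^+ i.+1 <= q.
  apply: le_trans hq; rewrite exprS.
  have : 2 ^+ i <= 16 ^+ i :> R by rewrite lerXn2r ?nnegrE//; lra.
  lra.
have : 2 `^ s * (2 `^ s) ^+ i.+1 <= q `^ s.
  rewrite -powR_mulrn ?powR_ge0// powRAC powR_mulrn// -powRM ?exprn_ge0//.
  by rewrite ge0_ler_powR ?nnegrE ?(ltW s0) ?mulr_ge0 ?exprn_ge0// (le_trans _ q2)// mulr_ge0// exprn_ge0.
have : lam^-1 ^+ i.+1 <= (2 `^ s) ^+ i.+1.
  by rewrite lerXn2r// nnegrE ?invr_ge0 ?powR_ge0// ltW.
have : 1 <= (2 `^ s) ^+ i.+1 by exact: exprn_ege1.
move: p1; set p := 2 `^ s; set Z := p ^+ _; set l := _ ^+ _ => p1 Z1 lZ pZ.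
have : 0 <= (p - 1) * (Z - 1) by rewrite mulr_ge0// subr_ge0.
lra.
Qed.

Section iteration.
Context (W : 'rV[R]_n.+1 -> R) (x0 : 'rV[R]_n.+1) (lam T0 : R).
Hypotheses (lam0 : 0 < lam) (lam1 : lam < 1) (T00 : 0 < T0).
Local Notation T k := (T0 * lam ^+ k).

(** Besides the bound [T k] on the ball of radius [4^-k], this keeps the bounds at
    all earlier scales, relative to the current centre [m]: they control the tails. *)
Definition osc_bound (k : nat) (m : R) :=
  (forall x, `|W x - m| <= 2 * T0 - T k) /\
  forall j x, (j <= k)%N -> enorm (x - x0) <= (4 ^+ j)^-1 ->
    `|W x - m| <= 2 * T j - T k.

Lemma osc_bound_step k m m' : osc_bound k m -> `|m' - m| <= T k - T k.+1 ->
  (forall x, enorm (x - x0) <= (4 ^+ k.+1)^-1 -> `|W x - m'| <= T k.+1) ->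
  osc_bound k.+1 m'.
Proof.
move=> [glob loc] mm' new.
have shift x : `|W x - m'| <= `|W x - m| + (T k - T k.+1).
  rewrite (_ : W x - m' = (W x - m) - (m' - m)); last by ring.
  by rewrite (le_trans (ler_normB _ _))// lerD2l.
split => [x|j x].
  by apply: le_trans (shift x) _; have := glob x; lra.
rewrite leq_eqVlt => /orP[/eqP ->|jk] xj.
  by apply: le_trans (new x xj) _; rewrite mulr_natl mulr2n addrK.
by apply: le_trans (shift x) _; have := loc j x jk xj; lra.
Qed.

(** This is the growth hypothesis of [improvement]: the bounds at earlier scales place
    [W - m] below the profile. *)
Lemma osc_bound_profile s k m : 0 < s <= 8^-1 -> lam^-1 <= 2 `^ s ->
  osc_bound k m -> let r := (4 ^+ k)^-1 / 2 in
  forall x, r <= enorm (x - x0) ->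
  `|W x - m| <= T k - 2 * T k * 2 `^ s + 2 * T k * profile s (r ^- 2) x0 x.
Proof.
move=> s8 hlam [glob loc] r x rx.
have [s0 _] := andP s8; have [p1 _] := powR2_bounds s8.
have r0 : 0 < r by rewrite divr_gt0// invr_gt0 exprn_gt0.
have Tk0 : 0 < T k by rewrite mulr_gt0// exprn_gt0.
have h2 : (enorm (x - x0) / r) ^+ 2 = r ^- 2 * dotp (x - x0) (x - x0).
  by rewrite exprMn exprVn sqr_enorm mulrC.
(* outside the ball of radius [4^-(k-i)] the profile dominates the bound known on
   the next larger ball *)
have key i : (i < k)%N -> 2 * 4 ^+ i * r <= enorm (x - x0) ->
    2 * T (k - i.+1)%N - T k <= T k - 2 * T k * 2 `^ s + 2 * T k * profile s (r ^- 2) x0 x.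
  move=> ik hx.
  have -> : T (k - i.+1)%N = T k * lam^-1 ^+ i.+1.
    by rewrite -mulrA exprVn -expfB_cond ?gt_eqF// subnKC ?(ltn_ord)//.
  have : lam^-1 ^+ i.+1 - 1 <= profile s (r ^- 2) x0 x - 2 `^ s.
    apply: tail_growth => //; rewrite lerD2l -h2.
    rewrite (_ : 4 * 16 ^+ i = (2 * 4 ^+ i) ^+ 2); last first.
      by rewrite exprMn -exprM mulnC exprM; congr (_ * _ ^+ _); ring.
    by rewrite lerXn2r ?nnegrE ?divr_ge0 ?enorm_ge0 ?mulr_ge0 ?exprn_ge0 ?(ltW r0)// ler_pdivlMr.
  move/(ler_wpM2l (ltW Tk0)); lra.
have base : T k <= T k - 2 * T k * 2 `^ s + 2 * T k * profile s (r ^- 2) x0 x.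
  have : 2 `^ s <= profile s (r ^- 2) x0 x.
    rewrite /profile ge0_ler_powR ?nnegrE ?(ltW s0)//.
      by rewrite -h2 addr_ge0 ?sqr_ge0.
    by rewrite (_ : 2 = 1 + 1)// lerD2l -h2 exprn_ege1// ler_pdivlMr ?mul1r.
  move/(ler_wpM2l (ltW Tk0)); lra.
have scale i : (i <= k)%N -> 2 * 4 ^+ i * r = (4 ^+ (k - i))^-1.
  move=> ik; rewrite /r -{1}(subnK ik) exprD; field.
  by rewrite !expf_neq0.
have scan l : forall i, (i + l)%N = k -> 2 * 4 ^+ i * r < enorm (x - x0) ->
    `|W x - m| <= T k - 2 * T k * 2 `^ s + 2 * T k * profile s (r ^- 2) x0 x.
  elim: l => [|l ih] i ilk hx.
    apply: le_trans (glob x) _; move: ilk; rewrite addn0; case: i hx => [|i] hx ik.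
      by apply: le_trans base; rewrite -ik expr0 mulr1 mulr_natl mulr2n addrK.
    have := key i; rewrite ik subnn expr0 mulr1; apply; first by rewrite -ik.
    apply: le_trans (ltW hx); rewrite ler_wpM2r ?(ltW r0)// ler_wpM2l//.
    by rewrite exprS ler_peMl ?exprn_ge0//; lra.
  have ik : (i < k)%N by rewrite -ilk addnS ltnS leq_addr.
  case: (ltP (2 * 4 ^+ i.+1 * r) (enorm (x - x0))) => hx'.
    by apply: ih hx'; rewrite addSnnS.
  rewrite scale// in hx'.
  by apply: le_trans (loc _ _ (leq_subr _ _) hx') _; apply: key => //; exact: ltW.
case: (ltP (2 * 4 ^+ 0 * r) (enorm (x - x0))) => hx; first exact: scan hx.
rewrite scale// subn0 in hx.
by apply: le_trans (loc k x (leqnn k) hx) _; apply: le_trans base; lra.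
Qed.

End iteration.
End oscillation.

Section holder.
Context {R : realType} {n : nat}.
Implicit Types (x y z h : 'rV[R]_n.+1).
Local Notation N := (@moment_const R n).
Local Notation c := (c_half R n.+1).

(** One of the two alternatives lowers the upper bound on the increment or raises the
    lower one: exchanging [h1] and [h2] changes the sign of [W]. *)
Lemma oscillation_decay (u : 'rV[R]_n.+1 -> R) (U L C1 s lam A : R)
    (h1 h2 x0 : 'rV[R]_n.+1) :
  let W x := u (x + h1) - u (x + h2) in
  let beta := @half_cube R n / 2 ^+ (n + 5) in
  let t := enorm (h1 - h2) in
  continuous u -> (forall x, `|u x| <= U) ->
  0 < L -> (forall x y, `|u x - u y| <= L * enorm (x - y)) ->
  0 <= C1 -> difference_inequality u C1 (2 * L) ->
  0 < s <= 8^-1 -> 256 * s * N <= beta / 4 -> 8 * C1 * s <= c * beta / 4 ->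
  2^-1 <= lam -> lam < 1 -> lam^-1 <= 2 `^ s -> 1 - lam <= 2 `^ s - (5 / 4) `^ s ->
  L <= A -> 16 * C1 <= c * beta * A -> 0 < t ->
  forall k, exists m, osc_bound W x0 lam (A * t) k m.
Proof.
move=> W beta t cu uU L0 uL C10 diffu s8 sN sC lh lam1 lams lamth LA EA t0.
have lam0 : 0 < lam by apply: lt_le_trans lh; rewrite invr_gt0.
have A0 : 0 < A by exact: lt_le_trans LA.
have At0 : 0 < A * t by rewrite mulr_gt0.
have [s0 _] := andP s8.
have WL x : `|W x| <= A * t.
  apply: le_trans (uL _ _) _; rewrite (_ : x + h1 - (x + h2) = h1 - h2); last first.
    by rewrite opprD addrACA subrr add0r.
  by rewrite ler_wpM2r// enorm_ge0.
have ct h : continuous (fun x => u (x + h)).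
  move=> x; apply: (@continuous_comp _ _ _ (fun x => x + h) u); last exact: cu.
  exact: continuous_translate.
have cW : continuous W.
  by apply: continuous_add => // x; exact: (continuousN (ct h2 x)).
elim=> [|k [m IH]].
  exists 0; split => [x|j x].
    by rewrite subr0 expr0 mulr1 mulr_natl mulr2n addrK.
  by rewrite leqn0 => /eqP -> _; rewrite subr0 expr0 mulr1 mulr_natl mulr2n addrK.
pose T := A * t * lam ^+ k; pose r : R := (4 ^+ k)^-1 / 2.
have T0 : 0 < T by rewrite mulr_gt0// exprn_gt0.
have r0 : 0 < r by rewrite divr_gt0// invr_gt0 exprn_gt0.
have prof := @osc_bound_profile _ _ W x0 lam (A * t) lam0 At0 s k m s8 lams IH.
have beta0 : 0 < beta by rewrite divr_gt0 ?half_cube_gt0// exprn_gt0.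
have cb0 : 0 < c * beta by rewrite mulr_gt0// c_half_gt0.
have ET : 16 * C1 * t * r <= c * beta * T.
  rewrite /T (_ : c * beta * (A * t * lam ^+ k) = c * beta * A * t * lam ^+ k); last by ring.
  apply: ler_pM => //.
  - by rewrite !mulr_ge0// ltW.
  - exact: ltW.
  - by rewrite ler_wpM2r// ltW.
  apply: (@le_trans _ _ (2^-1 ^+ k)); last by rewrite lerXn2r ?nnegrE ?(ltW lam0).
  apply: (@le_trans _ _ (4 ^+ k)^-1).
    by rewrite /r ler_piMr ?invr_ge0 ?exprn_ge0// invf_le1// ler1n.
  rewrite -exprVn lerXn2r ?nnegrE ?invr_ge0// lef_pV2 ?posrE// ler_nat//.
have rr x : enorm (x - x0) <= (4 ^+ k.+1)^-1 -> enorm (x - x0) <= r / 2.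
  by move=> /le_trans; apply; rewrite /r exprS invfM; lra.
have thr (w : R) : w <= m + T - 2 * T * 2 `^ s + 2 * T * (5 / 4) `^ s ->
    w <= m - (1 - lam) * T + lam * T.
  by move: (ler_wpM2l (ltW T0) lamth); lra.
have TS : A * t * lam ^+ k.+1 = lam * T by rewrite /T exprS; ring.
have [_ loc] := IH.
have local x : enorm (x - x0) <= (4 ^+ k.+1)^-1 -> `|W x - m| <= T.
  move=> xr; apply: le_trans (loc k x (leqnn k) _) _; last by rewrite mulr_natl mulr2n addrK.
  apply: le_trans xr _; rewrite lef_pV2 ?posrE ?exprn_gt0// exprS ler_peMl ?exprn_ge0//.
  by rewrite ler1n.
have [alt|alt] := sublevel_alternative x0 m cW r0.
- exists (m - (1 - lam) * T); apply: (osc_bound_step IH).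
    rewrite addrAC subrr add0r normrN -/T TS ger0_norm; first by lra.
    by rewrite mulr_ge0 ?(ltW T0)// subr_ge0 ltW.
  move=> x xr; rewrite TS.
  have := @improvement R n u U L C1 s r m T _ h1 h2 x0 cu uU L0 uL C10 diffu
    (@half_cube_gt0 R n) s8 sN sC r0 T0 ET _ alt x (rr x xr).
  move=> /(_ _)/thr => h; have {}h : W x <= m - (1 - lam) * T + lam * T.
    apply: h => y ry; have := le_trans (ler_norm _) (prof y ry); rewrite -/T /W; lra.
  have := local x xr; rewrite !ler_norml => /andP[? ?]; lra.
- exists (m + (1 - lam) * T); apply: (osc_bound_step IH).
    rewrite addrAC subrr add0r -/T TS ger0_norm; first by lra.
    by rewrite mulr_ge0 ?(ltW T0)// subr_ge0 ltW.
  move=> x xr; rewrite TS.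
  have ET' : 16 * C1 * enorm (h2 - h1) * r <= c * beta * T by rewrite enormB.
  have WN y : u (y + h2) - u (y + h1) = - W y by rewrite /W opprB.
  have H1 y : r <= enorm (y - x0) -> u (y + h2) - u (y + h1) <=
      - m + T - 2 * T * 2 `^ s + 2 * T * profile s (r ^- 2) x0 y.
    move=> ry; have := le_trans (ler_norm _) (prof y ry).
    have := prof y ry; rewrite -/T ler_norml WN => /andP[? _] _; lra.
  have alt' : ((@half_cube R n * r ^+ n.+1)%:E <= lebesgue_rV n.+1
      [set x | (enorm (x - x0) < r)%R /\ (u (x + h2) - u (x + h1) <= - m)%R])%E.
    by move: alt; under eq_set do rewrite -WN.
  have := @improvement R n u U L C1 s r (- m) T _ h2 h1 x0 cu uU L0 uL C10 diffu
    (@half_cube_gt0 R n) s8 sN sC r0 T0 ET' H1 alt' x (rr x xr).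
  have tl := ler_wpM2l (ltW T0) lamth.
  rewrite WN => h; have {}h : - W x <= - m - (1 - lam) * T + lam * T by lra.
  have := local x xr; rewrite !ler_norml => /andP[? ?]; lra.
Qed.

(** [s] has to be small against the dimension and the drift constant [C1]; [lam] is
    then the larger of the rates allowed by the improvement and by the tails. *)
Lemma half_laplacian_parameters (C1 L : R) : 0 <= C1 -> 0 < L ->
  let beta := @half_cube R n / 2 ^+ (n + 5) in
  exists s lam A, [/\ 0 < s <= 8^-1, 256 * s * N <= beta / 4, 8 * C1 * s <= c * beta / 4 &
    [/\ 2^-1 <= lam < 1, lam^-1 <= 2 `^ s, 1 - lam <= 2 `^ s - (5 / 4) `^ s,
       L <= A & 16 * C1 <= c * beta * A]].
Proof.
move=> C10 L0 beta.
have beta0 : 0 < beta by rewrite divr_gt0 ?half_cube_gt0// exprn_gt0.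
have cb0 : 0 < c * beta by rewrite mulr_gt0// c_half_gt0.
have N0 : 0 <= 256 * N := mulr_ge0 (ler0n R 256) moment_const_ge0.
have [s1 s10 hs1] := exists_small N0 (divr_gt0 beta0 (ltr0n R 4)).
have [s2 s20 hs2] := exists_small (mulr_ge0 (ler0n R 8) C10) (divr_gt0 cb0 (ltr0n R 4)).
pose s := Num.min s1 (Num.min s2 8^-1).
have s0 : 0 < s by rewrite !lt_min s10 s20/=.
have s18 : s <= 8^-1 by rewrite !ge_min lexx !orbT.
have s8 : 0 < s <= 8^-1 by rewrite s0.
have [p1 p2] := powR2_bounds s8.
have p54 : (5 / 4) `^ s < 2 `^ s :> R by apply: gt0_ltr_powR; rewrite ?nnegrE//; lra.
have p54' : 1 <= (5 / 4) `^ s :> R.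
  by rewrite -[leLHS](@powRr0 _ (5 / 4)) ler_powR ?(ltW s0)//; lra.
have pp : 0 < 2 `^ s :> R by exact: lt_le_trans p1.
pose lam := Num.max (1 - (2 `^ s - (5 / 4) `^ s)) (2 `^ s)^-1.
exists s, lam, (Num.max L (16 * C1 / (c * beta))); split => //.
- rewrite mulrAC; apply: ltW; apply: hs1 => //.
  by rewrite ge_min lexx.
- by apply: ltW; apply: hs2 => //; rewrite !ge_min lexx orbT.
split.
- apply/andP; split.
    rewrite le_max; apply/orP; right; rewrite lef_pV2 ?posrE//.
    by apply: le_trans p2 _; move: s18; clear; lra.
  rewrite gt_max invf_lt1//; apply/andP; split; first by rewrite gtrBl subr_gt0.
  exact: le_lt_trans p54' p54.
- by rewrite -[leRHS]invrK lef_pV2 ?posrE ?invr_gt0// ?le_max ?lexx ?orbT// lt_max invr_gt0 pp orbT.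
- by rewrite lerBlDr -lerBlDl le_max lexx.
- by rewrite le_max lexx.
- by rewrite [leRHS]mulrC -ler_pdivrMr// le_max lexx orbT.
Qed.

(** With [lam = 4^(-sigma)] the geometric decay of the oscillation over the radii
    [4^-k] is a power law. *)
Theorem increments_holder (u : 'rV[R]_n.+1 -> R) (U L C1 : R) :
  continuous u -> (forall x, `|u x| <= U) ->
  0 < L -> (forall x y, `|u x - u y| <= L * enorm (x - y)) ->
  0 <= C1 -> difference_inequality u C1 (2 * L) ->
  exists sigma C, [/\ 0 < sigma < 1, 0 <= C & forall h1 h2 x y,
    `|(u (x + h1) - u (x + h2)) - (u (y + h1) - u (y + h2))| <=
    C * enorm (h1 - h2) * enorm (x - y) `^ sigma].
Proof.
move=> cu uU L0 uL C10 diffu.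
have [s [lam [A [s8 sN sC [/andP[lh l1] lams lamth LA EA]]]]] :=
  half_laplacian_parameters C10 L0.
have lam0 : 0 < lam by apply: lt_le_trans lh; rewrite invr_gt0.
have A0 : 0 < A by exact: lt_le_trans LA.
pose sigma := - ln lam / ln 4.
have ln4 : 0 < ln (4 : R) by rewrite ln_gt0// ltr1n.
have lamE : lam = 4 `^ (- sigma).
  rewrite /powR gt_eqF// (_ : - sigma * ln 4 = ln lam) ?lnK//.
  by rewrite /sigma; field; rewrite gt_eqF.
have sig0 : 0 < sigma by rewrite /sigma divr_gt0// oppr_gt0 ln_lt0// lam0.
have sig1 : sigma < 1.
  rewrite /sigma ltr_pdivrMr// mul1r -lnV ?posrE// ltr_ln ?posrE ?invr_gt0//.
  by apply: (@le_lt_trans _ _ 2); [rewrite -[leRHS]invrK lef_pV2 ?posrE ?invr_gt0|rewrite ltr_nat].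
exists sigma, (2 * A / lam); split; first by rewrite sig0.
  by rewrite divr_ge0 ?mulr_ge0 ?(ltW A0) ?(ltW lam0).
move=> h1 h2 x y.
have [e12|h12] := eqVneq h1 h2.
  by rewrite e12 !subrr normr0 enorm0 mulr0 mul0r.
have t0 : 0 < enorm (h1 - h2) by rewrite enorm_gt0 subr_eq0.
set t := enorm (h1 - h2) in t0 *; set W := fun x => u (x + h1) - u (x + h2).
have osc := @oscillation_decay u U L C1 s lam A h1 h2 x cu uU L0 uL C10 diffu s8 sN sC
  lh l1 lams lamth LA EA t0.
rewrite -/(W x) -/(W y).
pose D := enorm (x - y).
have [D0|D0] := leP D 0.
  have : D == 0 by rewrite eq_le D0 enorm_ge0.
  rewrite enorm_eq0 subr_eq0 => /eqP ->; rewrite subrr normr0.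
  by rewrite !mulr_ge0 ?powR_ge0 ?invr_ge0 ?(ltW A0) ?(ltW lam0) ?(ltW t0).
have WL z : `|W z| <= A * t.
  apply: le_trans (uL _ _) _; rewrite (_ : z + h1 - (z + h2) = h1 - h2); last first.
    by rewrite opprD addrACA subrr add0r.
  by rewrite ler_wpM2r// enorm_ge0.
have [D1|D1] := leP 1 D.
  apply: (@le_trans _ _ (2 * A / lam * t * 1)).
    apply: le_trans (ler_normB _ _) _; apply: le_trans (lerD (WL x) (WL y)) _.
    rewrite mulr1 (_ : A * t + A * t = 2 * A * t); last by ring.
    rewrite ler_wpM2r ?(ltW t0)// ler_peMr ?mulr_ge0 ?(ltW A0)//.
    by rewrite invf_ge1// ltW.
  rewrite ler_wpM2l ?mulr_ge0 ?invr_ge0 ?(ltW A0) ?(ltW lam0) ?(ltW t0)//.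
  by rewrite -[leLHS](powRr0 D) ler_powR ?(ltW sig0).
have [|k /andP[k1 k2]] := @dyadic_above R D^-1; first by rewrite invf_ge1// ltW.
have [m [_ loc]] := osc k.
have hD : D <= (4 ^+ k)^-1 by rewrite -[leLHS]invrK lef_pV2 ?posrE ?invr_gt0 ?exprn_gt0.
have hD' : (4 ^+ k.+1)^-1 <= D by rewrite -[leRHS]invrK lef_pV2 ?posrE ?invr_gt0 ?exprn_gt0// ltW.
have tk z : enorm (z - x) <= (4 ^+ k)^-1 -> `|W z - m| <= A * t * lam ^+ k.
  by move=> /(loc k z (leqnn k)); rewrite mulr_natl mulr2n addrK.
have Wx := tk x; rewrite subrr enorm0 invr_ge0 exprn_ge0// in Wx.
have Wy := tk y; rewrite enormB in Wy.
apply: (@le_trans _ _ (2 * (A * t * lam ^+ k))).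
  rewrite (_ : W x - W y = (W x - m) - (W y - m)); last by ring.
  by rewrite mulr_natl mulr2n (le_trans (ler_normB _ _))// lerD// ?Wx// Wy.
have pw : lam ^+ k.+1 <= D `^ sigma.
  rewrite lamE -powR_invpow4; apply: ge0_ler_powR => //; first exact: ltW.
    by rewrite nnegrE invr_ge0 exprn_ge0.
  by rewrite nnegrE ltW.
rewrite (_ : 2 * (A * t * lam ^+ k) = 2 * A / lam * t * lam ^+ k.+1); last first.
  by rewrite exprS; field; rewrite gt_eqF.
by rewrite ler_wpM2l// !mulr_ge0 ?invr_ge0 ?(ltW A0) ?(ltW lam0) ?(ltW t0).
Qed.

End holder.

(** * From increments to the gradient *)

Section increments_to_C1.
Context {R : realType} {n : nat}.
Implicit Types (x y z h v : 'rV[R]_n).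
Context (u : 'rV[R]_n -> R) (L C sigma : R).
Hypotheses (L0 : 0 <= L) (C0 : 0 <= C) (sigma01 : 0 < sigma < 1).
Hypothesis uL : forall x y, `|u x - u y| <= L * enorm (x - y).
Hypothesis uC : forall h x y,
  `|(u (x + h) - u x) - (u (y + h) - u y)| <= C * enorm h * enorm (x - y) `^ sigma.

Lemma powR_sigma_mono a b : 0 <= a -> a <= b -> a `^ sigma <= b `^ sigma.
Proof.
move=> a0 ab; have /andP[s0 _] := sigma01.
by apply: ge0_ler_powR; rewrite ?nnegrE ?(ltW s0)// (le_trans a0).
Qed.

Section direction.
Variable i : 'I_n.
Local Notation e := (delta_mx 0 i : 'rV[R]_n).

(** Each of the [q] increments of length [d] is within [C d (q d)^sigma] of the
    first one. *)
Lemma increment_multiple x (d : R) q : 0 <= d ->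
  `|u (x + (q%:R * d) *: e) - u x - q%:R * (u (x + d *: e) - u x)| <=
  q%:R * (C * d * (q%:R * d) `^ sigma).
Proof.
move=> d0; elim: q => [|q ih].
  by rewrite !mul0r scale0r addr0 subrr subr0 normr0.
set w := u (x + d *: e) - u x in ih *.
have e1 : x + (q.+1%:R * d) *: e = x + (q%:R * d) *: e + d *: e.
  by rewrite -addrA -scalerDl -natr1 mulrDl mul1r.
have := uC (d *: e) (x + (q%:R * d) *: e) x; rewrite -e1 -/w.
have qd0 : 0 <= q%:R * d by rewrite mulr_ge0.
rewrite (addrAC x) subrr add0r !enorm_delta (ger0_norm d0) (ger0_norm qd0) => step.
have mono : (q%:R * d) `^ sigma <= (q.+1%:R * d) `^ sigma.
  by apply: powR_sigma_mono; rewrite ?mulr_ge0// ler_wpM2r// ler_nat.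
have Cd0 : 0 <= C * d by rewrite mulr_ge0.
rewrite (_ : u (x + (q.+1%:R * d) *: e) - u x - q.+1%:R * w =
    (u (x + (q.+1%:R * d) *: e) - u (x + (q%:R * d) *: e) - w) +
    (u (x + (q%:R * d) *: e) - u x - q%:R * w)); last first.
  by rewrite -[q.+1%:R]natr1; ring.
apply: le_trans (ler_normD _ _) _.
rewrite (_ : q.+1%:R * (C * d * _) = C * d * (q.+1%:R * d) `^ sigma
    + q%:R * (C * d * (q.+1%:R * d) `^ sigma)); last first.
  by set p := _ `^ _; rewrite -natr1; ring.
apply: lerD; first by apply: le_trans step _; rewrite ler_wpM2l.
by apply: le_trans ih _; rewrite ler_wpM2l// ler_wpM2l.
Qed.

Definition slope x (t : R) := (u (x + t *: e) - u x) / t.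

Lemma slope_le x t : 0 < t -> `|slope x t| <= L.
Proof.
move=> t0; rewrite /slope normrM normfV (gtr0_norm t0) ler_pdivrMr//.
by apply: le_trans (uL _ _) _; rewrite addrAC subrr add0r enorm_delta gtr0_norm.
Qed.

(** Dividing [t] by [d] leaves a remainder shorter than [d], which costs at most
    [2 L d / t]. *)
Lemma slope_small_step x (t d : R) : 0 < d -> 0 < t ->
  `|slope x t - slope x d| <= C * t `^ sigma + 2 * L * d / t.
Proof.
move=> d0 t0; pose q := Num.truncn (t / d).
have td0 : 0 <= t / d by rewrite divr_ge0// ltW.
have /andP[q1 q2] := truncn_itv td0.
rewrite ler_pdivlMr// in q1; rewrite ltr_pdivrMr// in q2.
rewrite -(@ler_pM2l _ t)// -{1}(gtr0_norm t0) -normrM mulrBr mulrDr.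
have -> : t * slope x t = u (x + t *: e) - u x by rewrite /slope mulrCA divff ?mulr1// gt_eqF.
have -> : t * (2 * L * d / t) = 2 * L * d by rewrite mulrCA divff ?mulr1// gt_eqF.
rewrite (_ : _ - t * slope x d = (u (x + t *: e) - u (x + (q%:R * d) *: e))
   + (u (x + (q%:R * d) *: e) - u x - q%:R * (u (x + d *: e) - u x))
   - (t - q%:R * d) * slope x d); last by rewrite /slope; field; rewrite gt_eqF.
have rho0 : 0 <= t - q%:R * d by rewrite subr_ge0.
have rho1 : t - q%:R * d <= d by rewrite lerBlDr -{1}[d]mul1r -mulrDl addrC natr1 ltW.
have a1 : `|u (x + t *: e) - u (x + (q%:R * d) *: e)| <= L * d.
  apply: le_trans (uL _ _) _; rewrite opprD addrACA subrr add0r -scalerBl enorm_delta.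
  by rewrite ger0_norm// ler_wpM2l.
have a3 : `|(t - q%:R * d) * slope x d| <= d * L.
  by rewrite normrM ger0_norm//; apply: ler_pM => //; exact: slope_le.
have a2 : `|u (x + (q%:R * d) *: e) - u x - q%:R * (u (x + d *: e) - u x)| <=
    t * (C * t `^ sigma).
  apply: le_trans (increment_multiple _ _ (ltW d0)) _.
  have qd0 : 0 <= q%:R * d by rewrite mulr_ge0// ltW.
  set p := (q%:R * d) `^ sigma.
  rewrite (_ : q%:R * (C * d * p) = q%:R * d * (C * p)); last by ring.
  by apply: ler_pM => //; rewrite ?mulr_ge0 ?powR_ge0// ler_wpM2l// powR_sigma_mono.
apply: le_trans (ler_normB _ _) _; apply: le_trans (lerD (ler_normD _ _) (lexx _)) _.
lra.
Qed.

(** Both slopes are compared with the slope of step [d], and [d] tends to 0. *)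
Lemma slope_cauchy x (t s : R) : 0 < t -> 0 < s ->
  `|slope x t - slope x s| <= C * t `^ sigma + C * s `^ sigma.
Proof.
move=> t0 s0; apply/ler_addgt0Pl => eps eps0.
pose A := 2 * L / t + 2 * L / s.
have A0 : 0 <= A by rewrite addr_ge0 ?divr_ge0 ?mulr_ge0// ltW.
have A1 : 0 < A + 1 by rewrite ltr_wpDl.
pose d := eps / (A + 1); have d0 : 0 < d by rewrite divr_gt0.
have Ad : A * d <= eps.
  rewrite /d mulrA ler_pdivrMr// mulrDr mulr1 (mulrC eps) lerDl; exact: ltW.
have h1 := slope_small_step x d0 t0; have h2 := slope_small_step x d0 s0.
rewrite (_ : slope x t - slope x s = (slope x t - slope x d) - (slope x s - slope x d));
  last by ring.
apply: le_trans (ler_normB _ _) _; apply: le_trans (lerD h1 h2) _.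
have e : A * d = 2 * L * d / t + 2 * L * d / s by rewrite /A; ring.
by rewrite e in Ad; lra.
Qed.

(** Since [slope x t - C t^sigma <= slope x s + C s^sigma] for all [t, s > 0], the
    supremum of the left-hand sides is the limit of the slopes. *)
Definition partial x := sup [set slope x t - C * t `^ sigma | t in [set t | 0 < t]].

Lemma slope_partial x t : 0 < t -> `|slope x t - partial x| <= C * t `^ sigma.
Proof.
move=> t0; set S := [set slope x t - C * t `^ sigma | t in [set t | 0 < t]].
have ubS s : 0 < s -> ubound S (slope x s + C * s `^ sigma).
  move=> s0 _ [r /= r0 <-].
  by have := le_trans (ler_norm _) (slope_cauchy x r0 s0); lra.
have St : S (slope x t - C * t `^ sigma) by exists t.
have supS : has_sup S.
  by split; [exists (slope x t - C * t `^ sigma)|exists (slope x t + C * t `^ sigma); exact: ubS].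
rewrite ler_norml; apply/andP; split.
  have : partial x <= slope x t + C * t `^ sigma.
    by apply: ge_sup; [exists (slope x t - C * t `^ sigma)|exact: ubS].
  lra.
have : slope x t - C * t `^ sigma <= partial x by exact: (ub_le_sup supS.2 St).
lra.
Qed.

Lemma partial_holder x y : `|partial x - partial y| <= C * enorm (x - y) `^ sigma.
Proof.
have /andP[s0 s1] := sigma01; apply/ler_addgt0Pl => eps eps0.
have A1 : 0 < 2 * C + 1 by rewrite ltr_wpDl// mulr_ge0.
pose t := (eps / (2 * C + 1)) `^ sigma^-1.
have et : t `^ sigma = eps / (2 * C + 1).
  by rewrite /t -powRrM mulVf ?gt_eqF// powRr1// divr_ge0// ltW.
have t0 : 0 < t by rewrite powR_gt0// divr_gt0.
have Ct : 2 * (C * t `^ sigma) <= eps.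
  by rewrite et !mulrA ler_pdivrMr// mulrDr mulr1 (mulrC eps) lerDl ltW.
have hs : `|slope x t - slope y t| <= C * enorm (x - y) `^ sigma.
  rewrite /slope -mulrBl normrM normfV (gtr0_norm t0) ler_pdivrMr//.
  apply: le_trans (uC _ _ _) _; rewrite enorm_delta gtr0_norm//; lra.
have := slope_partial x t0; have := slope_partial y t0; move: hs.
rewrite !ler_norml => /andP[? ?] /andP[? ?] /andP[? ?]; apply/andP; split; lra.
Qed.

(** A negative step is a positive step from the other endpoint. *)
Lemma increment_partial x t :
  `|u (x + t *: e) - u x - t * partial x| <= 2 * C * `|t| * `|t| `^ sigma.
Proof.
have pos y s : 0 < s ->
    `|u (y + s *: e) - u y - s * partial y| <= C * s * s `^ sigma.
  move=> s0; have := slope_partial y s0; rewrite -(ler_pM2l s0) -{1}(gtr0_norm s0) -normrM.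
  rewrite mulrBr /slope mulrCA divff ?gt_eqF// mulr1; lra.
case: (ltgtP t 0) => [tn|tp|->].
- have st : 0 < - t by rewrite oppr_gt0.
  have h1 := pos (x + t *: e) _ st.
  have h2 := partial_holder (x + t *: e) x.
  rewrite addrAC subrr add0r enorm_delta in h2.
  rewrite (ltr0_norm tn) in h2 *.
  rewrite scaleNr addrK in h1.
  have h3 : `|t * (partial (x + t *: e) - partial x)| <= - t * (C * (- t) `^ sigma).
    by rewrite normrM (ltr0_norm tn) ler_wpM2l// ltW.
  rewrite (_ : u (x + t *: e) - u x - t * partial x =
    - (u x - u (x + t *: e) - - t * partial (x + t *: e))
    + t * (partial (x + t *: e) - partial x)); last by ring.
  apply: le_trans (ler_normD _ _) _; rewrite normrN.
  by apply: le_trans (lerD h1 h3) _; lra.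
- rewrite (gtr0_norm tp); apply: le_trans (pos x t tp) _.
  by rewrite ler_wpM2r ?powR_ge0// ler_wpM2r ?(ltW tp)// ler_peMl//; lra.
- by rewrite scale0r addr0 subrr mul0r subr0 !normr0 mulr0 mul0r.
Qed.

End direction.

(** Telescoping along the coordinate directions. *)
Lemma increment_gradient x h :
  `|u (x + h) - u x - \sum_i h 0 i * partial i x| <=
  3 * C * n%:R * enorm h * (n%:R * enorm h) `^ sigma.
Proof.
set M := (n%:R * enorm h) `^ sigma.
pose hs (s : seq 'I_n) : 'rV[R]_n := \sum_(i <- s) h 0 i *: delta_mx 0 i.
have H (s : seq 'I_n) : (size s <= n)%N ->
    `|u (x + hs s) - u x - \sum_(i <- s) h 0 i * partial i x| <=
      (size s)%:R * (3 * C * enorm h * M) /\ enorm (hs s) <= (size s)%:R * enorm h.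
  elim: s => [|i s ih] sn.
    by rewrite /hs !big_nil addr0 subrr subr0 normr0 !mul0r enorm0.
  have [ih1 ih2] := ih (ltnW sn).
  have hi : `|h 0 i| <= enorm h by exact: coord_le_enorm.
  have split1 : x + hs (i :: s) = x + hs s + h 0 i *: delta_mx 0 i.
    by rewrite {1}/hs big_cons -/(hs s) addrA addrAC.
  split; last first.
    rewrite /hs big_cons -/(hs s) (le_trans (ler_enormD _ _))// enorm_delta.
    by rewrite /= -natr1 mulrDl mul1r addrC lerD.
  have hsM : enorm (hs s) `^ sigma <= M.
    apply: powR_sigma_mono; first exact: enorm_ge0.
    apply: le_trans ih2 _; rewrite ler_wpM2r ?enorm_ge0// ler_nat; exact: ltnW.
  have hM : `|h 0 i| `^ sigma <= M.
    apply: powR_sigma_mono => //; apply: le_trans hi _.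
    rewrite ler_peMl ?enorm_ge0// ler1n; exact: leq_ltn_trans sn.
  have M0 : 0 <= M by exact: powR_ge0.
  have a1 := increment_partial i (x + hs s) (h 0 i).
  have a2 : `|h 0 i * (partial i (x + hs s) - partial i x)| <= enorm h * (C * M).
    rewrite normrM; apply: ler_pM => //.
    apply: le_trans (partial_holder i _ _) _; rewrite addrAC subrr add0r.
    by rewrite ler_wpM2l.
  have a1' : 2 * C * `|h 0 i| * `|h 0 i| `^ sigma <= 2 * C * enorm h * M.
    by apply: ler_pM; rewrite ?powR_ge0 ?mulr_ge0// ler_wpM2l// mulr_ge0.
  rewrite split1 big_cons.
  rewrite (_ : _ - _ = (u (x + hs s + h 0 i *: delta_mx 0 i) - u (x + hs s)
      - h 0 i * partial i (x + hs s))
    + h 0 i * (partial i (x + hs s) - partial i x)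
    + (u (x + hs s) - u x - \sum_(j <- s) h 0 j * partial j x)); last by ring.
  apply: le_trans (ler_normD _ _) _; apply: le_trans (lerD (ler_normD _ _) (lexx _)) _.
  rewrite /= -natr1 mulrDl mul1r addrC; apply: lerD => //.
  by apply: le_trans (lerD (le_trans a1 a1') a2) _; lra.
have [] := H (index_enum 'I_n) _; first by rewrite [index_enum _]unlock -enumT size_enum_ord.
have -> : hs (index_enum 'I_n) = h.
  by rewrite /hs [in RHS](row_sum_delta h).
have -> : size (index_enum 'I_n) = n by rewrite [index_enum _]unlock -enumT size_enum_ord.
by move=> h1 _; apply: le_trans h1 _; lra.
Qed.

Let gradient_form x : 'rV[R]_n -> R := fun h => \sum_i h 0 i * partial i x.

Let gradient_form_linear x : linear (gradient_form x).
Proof.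
move=> k h h'; rewrite /gradient_form scaler_sumr -big_split; apply: eq_bigr => i _.
by rewrite !mxE mulrDl -mulrA.
Qed.

HB.instance Definition _ x := GRing.isLinear.Build _ _ _ _ _ (gradient_form_linear x).

Let gradient_form_continuous x : continuous (gradient_form x).
Proof.
rewrite /gradient_form; elim: (index_enum _) => [|i s ih].
  by under eq_fun do rewrite big_nil; move=> h; exact: cst_continuous.
under eq_fun do rewrite big_cons; apply: continuous_add => //.
by apply: continuous_mul; [exact: coord_continuous|move=> h; exact: cst_continuous].
Qed.

Let gradient_expansion x : u \o shift x = cst (u x) + gradient_form x +o_ (0 : 'rV[R]_n) id.
Proof.
have /andP[s0 s1] := sigma01.
apply/eqaddoP => eps eps0.
pose m : R := n.+1%:R; have m0 : 0 < m by rewrite ltr0n.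
pose A := 3 * C * m * m; have A0 : 0 <= A by rewrite !mulr_ge0// ltW.
have A1 : 0 < A + 1 by rewrite ltr_wpDl.
pose d := (eps / (A + 1)) `^ sigma^-1 / (m * m).
have d0 : 0 < d by rewrite divr_gt0 ?mulr_gt0// powR_gt0// divr_gt0.
apply: filterS (nbhsx_ballx (0 : 'rV[R]_n) _ d0) => h.
rewrite -ball_normE /= sub0r normrN => hd.
rewrite -[_ h]/(u (h + x) - (u x + gradient_form x h)) opprD addrA (addrC h).
apply: le_trans (increment_gradient x h) _.
have nm : n%:R <= m by rewrite ler_nat.
have hm : enorm h <= m * `|h|.
  by apply: le_trans (enorm_le_norm h) _; rewrite ler_wpM2r.
have pw : (n%:R * enorm h) `^ sigma <= eps / (A + 1).
  apply: (@le_trans _ _ ((m * m * d) `^ sigma)).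
    apply: powR_sigma_mono; first by rewrite mulr_ge0 ?enorm_ge0.
    rewrite -mulrA; apply: ler_pM; rewrite ?enorm_ge0//.
    by apply: le_trans hm _; rewrite ler_wpM2l ?(ltW m0)// ltW.
  rewrite /d mulrCA divff ?mulf_neq0 ?gt_eqF// mulr1 -powRrM mulVf ?gt_eqF// powRr1//.
  by rewrite divr_ge0 ?ltW.
apply: (@le_trans _ _ (3 * C * m * (m * `|h|) * (eps / (A + 1)))).
  apply: ler_pM; rewrite ?powR_ge0 ?mulr_ge0 ?enorm_ge0//.
  by apply: ler_pM; rewrite ?mulr_ge0 ?enorm_ge0// ler_wpM2l// mulr_ge0.
rewrite (_ : 3 * C * m * (m * `|h|) * (eps / (A + 1)) = A * eps / (A + 1) * `|h|);
  last by rewrite /A; ring.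
rewrite ler_wpM2r// ler_pdivrMr// [A * _]mulrC; apply: ler_wpM2l; first exact: ltW.
by rewrite lerDl.
Qed.

Theorem C1_of_increments : is_C1 u /\ forall x y,
  enorm (grad u x - grad u y) <= n%:R * C * enorm (x - y) `^ sigma.
Proof.
have diffE x : 'd u x = gradient_form x :> ('rV[R]_n -> R).
  exact: (diff_unique (@gradient_form_continuous x) (gradient_expansion x)).
have du x : differentiable u x.
  apply/diff_locallyP; rewrite diffE; split; first exact: gradient_form_continuous.
  exact: gradient_expansion.
have De i x : 'D_(delta_mx 0 i) u x = partial i x.
  rewrite deriveE// diffE /gradient_form (bigD1 i)//= big1 => [|j ji].
    by rewrite !mxE !eqxx mul1r addr0.
  by rewrite !mxE (negbTE ji) andbF mul0r.
have /andP[s0 _] := sigma01.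
split.
  apply/is_C1P; split => // i; under eq_fun do rewrite De.
  move=> x; apply/(@cvgrPdist_lt _ _ _ (nbhs x)) => eps eps0.
  have A1 : 0 < C + 1 by rewrite ltr_wpDl.
  pose d := (eps / (C + 1)) `^ sigma^-1 / n.+1%:R.
  have d0 : 0 < d by rewrite divr_gt0 ?ltr0n// powR_gt0// divr_gt0.
  apply: filterS (nbhsx_ballx x _ d0) => y; rewrite -ball_normE /= => xy.
  apply: le_lt_trans (partial_holder i x y) _.
  apply: (@le_lt_trans _ _ (C * (eps / (C + 1)))).
    rewrite ler_wpM2l//; apply: (@le_trans _ _ ((n.+1%:R * d) `^ sigma)).
      apply: powR_sigma_mono; first exact: enorm_ge0.
      apply: le_trans (enorm_le_norm _) _; apply: ler_pM => //; last exact: ltW.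
      by rewrite ler_nat.
    rewrite /d mulrCA divff ?pnatr_eq0// mulr1 -powRrM mulVf ?gt_eqF// powRr1//.
    by rewrite divr_ge0 ?ltW.
  by rewrite mulrA ltr_pdivrMr// mulrDr mulr1 (mulrC eps) ltrDl.
move=> x y; apply: le_trans (enorm_le_sum _) _.
rewrite -mulrA mulr_natl -[n in _ *+ n]card_ord -sumr_const; apply: ler_sum => i _.
by rewrite !mxE !De; exact: partial_holder.
Qed.

End increments_to_C1.

(** * The regularity theorem *)

(** The space has at least two points, so both suprema are over nonempty sets of
    nonnegative numbers. *)
Lemma C01_norm_ge (R : realType) (n : nat) (V : zmodType) (N : V -> R)
    (h : 'rV[R]_n.+1 -> V) : (forall v, 0 <= N v) ->
  (0 <= C01_norm N h)%E /\
  ((forall x, (N (h x))%:E <= C01_norm N h) /\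
   forall x y, x != y -> (N (h x - h y) / enorm (x - y))%:E <= C01_norm N h)%E.
Proof.
move=> N0; rewrite /C01_norm; set A := [set _ | x in _]; set B := [set _ | p in _].
have supA x : ((N (h x))%:E <= ereal_sup A)%E by apply: ereal_sup_ubound; exists x.
have supB x y : x != y -> ((N (h x - h y) / enorm (x - y))%:E <= ereal_sup B)%E.
  by move=> xy; apply: ereal_sup_ubound; exists (x, y).
have A0 : (0 <= ereal_sup A)%E by apply: le_trans (supA 0); rewrite lee_fin.
have B0 : (0 <= ereal_sup B)%E.
  have e0 : (const_mx 1 : 'rV[R]_n.+1) != 0.
    by apply/eqP => /rowP/(_ ord0); rewrite !mxE => /eqP; rewrite oner_eq0.
  by apply: le_trans (supB _ _ e0); rewrite lee_fin divr_ge0// enorm_ge0.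
split; first exact: adde_ge0.
split=> [x|x y xy]; first by apply: le_trans (supA x) _; exact: leeDl.
by apply: le_trans (supB x y xy) _; exact: leeDr.
Qed.

Lemma C01_norm_bounded_lipschitz (R : realType) (n : nat) (V : zmodType) (N : V -> R)
    (h : 'rV[R]_n.+1 -> V) (K : R) : (forall v, 0 <= N v) -> N 0 = 0 ->
  (C01_norm N h <= K%:E)%E -> bounded_lipschitz N K h.
Proof.
move=> N0 N00 hK; have [_ [h1 h2]] := C01_norm_ge h N0; split => [x|x y].
  by rewrite -lee_fin (le_trans (h1 x)).
have [->|xy] := eqVneq x y; first by rewrite !subrr N00 enorm0 mulr0.
have := le_trans (h2 x y xy) hK; rewrite lee_fin ler_pdivrMr//.
by rewrite enorm_gt0 subr_eq0.
Qed.

Theorem theorem2p6 (R : realType) (n : nat) (A B : metricType R)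
    (a c f : A -> B -> 'rV[R]_n -> R)
    (b : A -> B -> 'rV[R]_n -> 'rV[R]_n)
    (K lambda lambda1 : R) (u : 'rV[R]_n -> R) :
  (0 < n)%N ->
  compact [set: A] -> compact [set: B] ->
  continuous (fun p : A * B * 'rV[R]_n => a p.1.1 p.1.2 p.2) ->
  continuous (fun p : A * B * 'rV[R]_n => b p.1.1 p.1.2 p.2) ->
  continuous (fun p : A * B * 'rV[R]_n => c p.1.1 p.1.2 p.2) ->
  continuous (fun p : A * B * 'rV[R]_n => f p.1.1 p.1.2 p.2) ->
  (forall al be,
     (C01_norm Num.norm (a al be) + C01_norm enorm (b al be)
      + C01_norm Num.norm (c al be) + C01_norm Num.norm (f al be) <= K%:E)%E) ->
  0 < lambda -> (forall al be x, lambda < c al be x) ->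
  0 < lambda1 -> (forall al be x, lambda1 < a al be x) ->
  viscosity_solution a c f b u ->
  eucl_lipschitz u ->
  is_C1 u /\
  exists sigma C : R, 0 < sigma < 1 /\
    forall x y, enorm (grad u x - grad u y) <= C * enorm (x - y) `^ sigma.
Proof.
case: n a c f b u => [//|n] a c f b u _ _ _ _ _ _ _ hK _ _ l1 la [cu bu sub sup] [L uL].
have [U uU] : exists U, forall x, `|u x| <= U.
  by case: bu => M [_ MP]; exists (M + 1) => x; apply: (MP (M + 1)); rewrite ?ltrDl.
have U0 : 0 <= U by exact: le_trans (normr_ge0 _) (uU 0).
pose L' := Num.max L 1; have L'0 : 0 < L' by rewrite lt_max ltr01 orbT.
have uL' x y : `|u x - u y| <= L' * enorm (x - y).
  by apply: le_trans (uL x y) _; rewrite ler_wpM2r ?enorm_ge0// le_max lexx.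
pose K' := Num.max K 0; have K'0 : 0 <= K' by rewrite le_max lexx orbT.
have KK : (K%:E <= K'%:E)%E by rewrite lee_fin le_max lexx.
have N0 : forall v : R, 0 <= `|v| by [].
have E0 : forall v : 'rV[R]_n.+1, 0 <= enorm v by exact: enorm_ge0.
have four al be : [/\ bounded_lipschitz Num.norm K' (a al be),
    bounded_lipschitz enorm K' (b al be), bounded_lipschitz Num.norm K' (c al be)
    & bounded_lipschitz Num.norm K' (f al be)].
  have [a0 _] := C01_norm_ge (a al be) N0; have [b0 _] := C01_norm_ge (b al be) E0.
  have [c0 _] := C01_norm_ge (c al be) N0; have [f0 _] := C01_norm_ge (f al be) N0.
  have h := le_trans (hK al be) KK.
  have ab := adde_ge0 a0 b0; have abc := adde_ge0 ab c0.
  have h3 := le_trans (leeDl _ f0) h; have h2 := le_trans (leeDl _ c0) h3.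
  split; apply: C01_norm_bounded_lipschitz; rewrite ?normr0 ?enorm0//.
  - exact: le_trans (leeDl _ b0) h2.
  - exact: le_trans (leeDr _ a0) h2.
  - exact: le_trans (leeDr _ ab) h3.
  - exact: le_trans (leeDr _ abc) h.
have P0 : 0 <= 2 * L' by rewrite mulr_ge0// ltW.
pose C1 := K' * (1 + U + L' + 2 * L') / lambda1
  + K' * (1 + U + 2 * L') * K' / lambda1 ^+ 2.
have diffu : difference_inequality u C1 (2 * L').
  apply: (isaacs_difference K'0 U0 (ltW L'0) P0 l1 _ _ _ _ la uU uL' sub sup) => al be;
    by have [] := four al be.
have C10 : 0 <= C1.
  by rewrite addr_ge0 ?divr_ge0 ?mulr_ge0 ?addr_ge0 ?sqr_ge0 ?(ltW l1) ?(ltW L'0).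
have [sigma [C [sig01 C0 H]]] := increments_holder cu uU L'0 uL' C10 diffu.
have uC h x y : `|(u (x + h) - u x) - (u (y + h) - u y)| <=
    C * enorm h * enorm (x - y) `^ sigma.
  by have := H h 0 x y; rewrite !addr0 subr0.
have [C1u gradu] := C1_of_increments (ltW L'0) C0 sig01 uL' uC.
by split => //; exists sigma, (n.+1%:R * C).
Qed.
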